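(* Let $d=1$, $\beta\ge 2$, $L>0$, and let the covariance kernel $K$ on $[0,1]$ have uniformly bounded eigenfunctions, $\sup_{j\in\mathbb{N}}\sup_{t\in[0,1]}|\psi_j(t)|\le C_\psi<\infty$, and polynomially decaying eigenvalues $C^{-1}j^{-1-2\beta}\le\mu_j\le Cj^{-1-2\beta}$, $j\in\mathbb{N}$, for some constant $C>0$. Consider $f_0\in\Theta^{\beta}(L)$ of the form $$f_0(x)=c_L\sum_{j=2}^{\infty}j^{-1/2-\beta}(\log j)^{-1}\psi_j(x),\qquad x\in[0,1],$$ for sufficiently small $c_L>0$. Let $N=nm$ with $(\log n)^2\ll m\lesssim n^{1/(1+2\beta)}$. Let $\Pi^{\dagger}_{n,m}(\cdot|\mathbb{D}_N)$ be the aggregated posterior obtained with the naive averaging method and $\hat f_{n,m}$ its mean. Then, for sufficiently small $c>0$, as $N\to\infty$ (the first inequality holding for all large $N$), $$E_0\|\hat f_{n,m}-f_0\|_2^2\ge c(\log N)^{-2}(N/m)^{-2\beta/(1+2\beta)},$$ $$E_0\Pi^{\dagger}_{n,m}\Big(f:\|f-f_0\|_2^2\le c(\log N)^{-2}(N/m)^{-2\beta/(1+2\beta)}\,\Big|\,\mathbb{D}_N\Big)\to 0.$$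
   Context: $\mathbb{N}=\{1,2,\dots\}$; $\|\cdot\|_2$ is the $L_2([0,1])$-norm. $a_n\ll b_n$ means $a_n/b_n\to0$; $a_n\lesssim b_n$ means $a_n\le Cb_n$ for a constant $C$ not depending on $n$. $K$ is a stationary positive definite kernel with expansion $K(x,x')=\sum_{j\in\mathbb{N}}\mu_j\psi_j(x)\psi_j(x')$ on $[0,1]$, where $(\psi_j)$ is an orthonormal basis of $L_2([0,1])$. Define $\Theta^\beta(L)=\{f=\sum_j f_j\psi_j\in L_2([0,1]):\sum_j j^{2\beta}f_j^2\le L^2\}$. Distributed regression model: $N=nm$ observations are split over $m$ machines; machine $k\in\{1,\dots,m\}$ holds $\mathbb{D}_n^{(k)}=(X_i^{(k)},Y_i^{(k)})_{i=1}^n$ with $Y_i^{(k)}=f_0(X_i^{(k)})+\varepsilon_i^{(k)}$, $X_i^{(k)}$ i.i.d. uniform on $[0,1]$, $\varepsilon_i^{(k)}$ i.i.d. $\mathcal{N}(0,\sigma^2)$ independent of the design, $\sigma^2>0$ known and bounded below by a positive constant. $\mathbb{D}_N$ is the whole data set, $E_0$ is expectation under $f_0$. Naive averaging method: in each machine $k$ the (unadjusted) prior $GP(0,K)$ is put on the regression function and the local posterior given $\mathbb{D}_n^{(k)}$ is formed with noise variance $\sigma^2$: it is a Gaussian process with mean $K(x,\mathbb{X}^{(k)})[K(\mathbb{X}^{(k)},\mathbb{X}^{(k)})+\sigma^2I_n]^{-1}\mathbb{Y}^{(k)}$ and covariance $K(x,x')-K(x,\mathbb{X}^{(k)})[K(\mathbb{X}^{(k)},\mathbb{X}^{(k)})+\sigma^2I_n]^{-1}K(\mathbb{X}^{(k)},x')$,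 where $\mathbb{X}^{(k)},\mathbb{Y}^{(k)}$ collect the local design points and observations and $K(A,B)$ is the matrix of kernel evaluations. A draw from the aggregated posterior $\Pi^\dagger_{n,m}(\cdot|\mathbb{D}_N)$ is the average $m^{-1}\sum_{k=1}^m f^{(k)}$ of independent single draws $f^{(k)}$ from the $m$ local posteriors. *)

(* Defs.v *)
From HB Require Import structures.
From mathcomp Require Export all_boot all_order all_algebra.
From mathcomp Require Export all_classical all_reals all_analysis.

Set Implicit Arguments.
Unset Strict Implicit.
Unset Printing Implicit Defensive.

Import Order.TTheory GRing.Theory Num.Theory.
Export numFieldNormedType.Exports.

Local Open Scope classical_set_scope.
Local Open Scope ring_scope.

(* Functions on [0,1] are represented by functions R -> R of which only the
   values on `[0, 1] are used.  Sequences over {1, 2, ...} are functions on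
   nat whose value at 0 is never used. *)

Section L2.
Context {R : realType}.
Implicit Types (f g : R -> R) (psi : nat -> R -> R).

Definition sqnormL2 f : \bar R :=
  (\int[lebesgue_measure]_(x in `[0%R : R, 1%R]) ((f x) ^+ 2)%:E)%E.

Definition in_L2 f : Prop :=
  measurable_fun `[0%R : R, 1%R] f /\ (sqnormL2 f < +oo)%E.

Definition innerL2 f g : R :=
  \int[lebesgue_measure]_(x in `[0%R : R, 1%R]) (f x * g x).

Definition orthonormal_basis psi : Prop :=
  [/\ forall j, (0 < j)%N -> in_L2 (psi j),
      forall i j, (0 < i)%N -> (0 < j)%N -> innerL2 (psi i) (psi j) = (i == j)%:R
    & forall g, in_L2 g ->
        sqnormL2 (fun x => g x - \sum_(1 <= j < J) innerL2 g (psi j) * psi j x)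
          @[J --> \oo] --> 0%E].

Definition Sobolev_ball psi (beta L : R) : set (R -> R) :=
  [set f | in_L2 f /\
    (\sum_(1 <= j <oo) (j%:R `^ (2 * beta) * innerL2 f (psi j) ^+ 2)%:E
       <= (L ^+ 2)%:E)%E].

End L2.

Section Kernel.
Context {R : realType}.
Implicit Types K : R -> R -> R.

Definition stationary K : Prop :=
  exists k : R -> R, forall x x' : R, x \in `[0, 1] -> x' \in `[0, 1] ->
    K x x' = k (x - x').

Definition positive_definite K : Prop :=
  (forall x x' : R, x \in `[0, 1] -> x' \in `[0, 1] -> K x x' = K x' x) /\
  forall (r : nat) (t a : 'I_r -> R), (forall i, t i \in `[0, 1]) ->
    0 <= \sum_(i < r) \sum_(j < r) a i * a j * K (t i) (t j).

Definition kernel_expansion K (mu : nat -> R) (psi : nat -> R -> R) : Prop :=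
  forall x x' : R, x \in `[0, 1] -> x' \in `[0, 1] ->
    \sum_(1 <= j < J) mu j * psi j x * psi j x' @[J --> \oo] --> K x x'.

End Kernel.

Section Independence.
Context d (T : measurableType d) (R : realType) (P : probability T R).

(* Applied below to sigma-algebras only: as each F i contains setT, the product
   rule over the whole finite index type gives it for every subfamily. *)
Definition mutually_independent (I : finType) (F : I -> set (set T)) : Prop :=
  forall E : I -> set T, (forall i, F i (E i)) ->
    P (\bigcap_(i in [set: I]) E i) = (\prod_(i : I) P (E i))%E.

Definition sigma_RV (X : T -> R) : set (set T) :=
  preimage_set_system setT X measurable.

Definition sigma_process (f : R -> T -> R) : set (set T) :=
  <<s [set E | exists (t : R) (A : set R),
         [/\ t \in `[0, 1], measurable A & E = f t @^-1` A]] >>.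

End Independence.

(* N(m, v) with v the variance, a point mass if v = 0.  The library's
   normal_prob takes the standard deviation, and is not Gaussian when it is 0. *)
Definition gaussian_law {R : realType} (m v : R) (A : set R) : \bar R :=
  if v == 0 then \d_m A else normal_prob m (Num.sqrt v) A.

(* Joint measurability makes the L2 norm of the sample paths a random
   variable. *)
Definition gaussian_process d (T : measurableType d) (R : realType)
    (Q : probability T R) (f : R -> T -> R) (m : R -> R) (c : R -> R -> R) :
    Prop :=
  measurable_fun (`[0%R : R, 1%R] `*` [set: T]) (fun p : R * T => f p.1 p.2) /\
  forall (r : nat) (t a : 'I_r -> R), (forall i, t i \in `[0, 1]) ->
  forall A : set R, measurable A ->
    Q [set w | A (\sum_(i < r) a i * f (t i) w)] =
    gaussian_law (\sum_(i < r) a i * m (t i))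
      (\sum_(i < r) \sum_(j < r) a i * a j * c (t i) (t j)) A.

Section Posterior.
Context {R : realType}.
Variables (K : R -> R -> R) (sigma : R).

Section Local.
Variables (n : nat) (x y : 'I_n -> R).

Definition kernel_row (s : R) : 'rV[R]_n := \row_j K s (x j).
Definition kernel_col (s : R) : 'cV[R]_n := \col_i K (x i) s.
Definition kernel_mx : 'M[R]_n := \matrix_(i, j) K (x i) (x j).

Definition posterior_mean (s : R) : R :=
  (kernel_row s *m invmx (kernel_mx + (sigma ^+ 2)%:M) *m \col_i y i) 0 0.

Definition posterior_cov (s s' : R) : R :=
  K s s' -
  (kernel_row s *m invmx (kernel_mx + (sigma ^+ 2)%:M) *m kernel_col s') 0 0.

End Local.

(* f k is a draw from the k-th local posterior, the draws being independent,
   all realized on the probability space (T, Q). *)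
Definition naive_draws (m n : nat) (x y : 'I_m -> 'I_n -> R)
    d (T : measurableType d) (Q : probability T R) (f : 'I_m -> R -> T -> R) :
    Prop :=
  (forall k, gaussian_process Q (f k) (posterior_mean (x k) (y k))
               (posterior_cov (x k))) /\
  mutually_independent Q (fun k => sigma_process (f k)).

End Posterior.

Section Aggregation.
Context d (T : measurableType d) (R : realType) (Q : probability T R).
Variables (m : nat) (f : 'I_m -> R -> T -> R).

Definition aggregated_draw (w : T) : R -> R :=
  fun s => m%:R^-1 * \sum_(k < m) f k s w.

Definition aggregated_posterior (B : set (R -> R)) : \bar R :=
  Q [set w | B (aggregated_draw w)].

Definition aggregated_mean (s : R) : R :=
  fine 'E_Q[fun w => aggregated_draw w s].

End Aggregation.

Section Model.
Context d (T : measurableType d) (R : realType) (P : probability T R).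
Variables (m n : nat) (sigma : R) (X eps : 'I_m -> 'I_n -> {RV P >-> R}).

Definition design_noise_family (u : 'I_m * 'I_n + 'I_m * 'I_n) :
    {RV P >-> R} :=
  match u with inl ki => X ki.1 ki.2 | inr ki => eps ki.1 ki.2 end.

Definition regression_model : Prop :=
  [/\ forall k i w, X k i w \in `[0, 1],
      forall k i (A : set R), measurable A ->
        distribution P (X k i) A = uniform_prob (@ltr01 R) A,
      forall k i (A : set R), measurable A ->
        distribution P (eps k i) A = normal_prob 0 sigma A
    & mutually_independent P (fun u => sigma_RV (design_noise_family u))].

Definition design (w : T) : 'I_m -> 'I_n -> R := fun k i => X k i w.

Definition response (f0 : R -> R) (w : T) : 'I_m -> 'I_n -> R :=
  fun k i => f0 (X k i w) + eps k i w.

End Model.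

Definition truth {R : realType} (psi : nat -> R -> R) (beta cL : R) (x : R) : R :=
  cL * limn (fun J => \sum_(2 <= j < J)
                        j%:R `^ (- (1 / 2) - beta) * (ln j%:R)^-1 * psi j x).

Definition rate {R : realType} (beta : R) (m n : nat) : R :=
  (ln (n * m)%:R) ^- 2 *
  ((n * m)%:R / m%:R) `^ (- (2 * beta) / (1 + 2 * beta)).

(* Main.v *)
From HB Require Import structures.
Require Import Defs.
From mathcomp Require Import measurable_realfun ring lra.

(** The unadjusted prior makes every machine smooth its [n] observations at the
    resolution [n^(1/(1+2 beta))].  Frequencies beyond it are shrunk towards 0
    by each machine in the same way; averaging over the machines reduces the
    variance but keeps this bias, whose square is of the order of the rate.

    To see the bias, test against a block of frequencies
    [h = \sum_(B <= j < 2 B) psi_j], of squared norm [B], where [B = lambda D],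
    [D] is of order [n^(1/(1+2 beta))] and [lambda] is a large constant.  Let
    [signal = <f0, h>].  By Cauchy-Schwarz [|g - f0|^2 >= <g - f0, h>^2 / B],
    and [signal^2 / B] is of the order of the rate.  So it is enough that the
    component [<g, h>] of the averaged mean, and of an averaged draw, stays well
    below the signal ([aggregated_mean_risk_ge], [aggregated_posterior_le]).

    The component of a local mean is [\sum_i v_i y_i], where the weights are
    [v = u (K_n + sigma^2)^(-1)], [K_n] is the kernel matrix of the design and
    [u_i = \sum_(B <= j < 2 B) mu_j psi_j(x_i)].  With
    [tau = \sum_(B <= j < 2 B) mu_j], Cauchy-Schwarz in the kernel gives
    [(u v)^2 <= tau (v K_n v)], and since
    [u v = v K_n v + sigma^2 |v|^2] the weights bound themselves:
    [v K_n v <= tau] and [sigma^2 |v|^2 <= tau], whatever the design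
    ([ridge_energy_le]).  Three contributions to the component follow.
    - Frequencies below [D] lie in the reproducing kernel space; their square is
      at most [tau \sum_(j < D) f_j^2 / mu_j], a fraction of order [1 / lambda]
      of [signal^2] ([weights_low_le], [low_energy_le]).
    - Frequencies from [D] on contribute at most [tau / sigma^2] times a sum of
      squares which, averaged over the machines, concentrates around [n] times
      the squared norm of this part of [f0]; this is again a fraction of order
      [1 / lambda] of [signal^2] ([weights_high_le], [high_deviation_prob]).
    - The noise has variance at most a constant times [tau], and
      [tau / signal^2] is of order [(ln D)^2 / D] ([noise_variance]).

    On the event where all three are small ([good_event]) the mean misses most
    of the signal.  The component of a draw fluctuates around that of its mean
    with the posterior variance, which is at most the prior variance [tau], so a
    draw cannot recover the signal either ([fluct_int_variance]).
    [single_experiment] collects these estimates at a fixed sample size, with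
    failure probabilities of order [1 / sqrt D]. *)

Set Implicit Arguments.
Unset Strict Implicit.
Unset Printing Implicit Defensive.

Import Order.TTheory GRing.Theory Num.Theory.

Local Open Scope classical_set_scope.
Local Open Scope ring_scope.

(** * Sums over frequencies *)

Section Numeric.
Context {R : realType}.
Implicit Types (p x : R) (j D J : nat).

Lemma inv_le_lnB j : (2 <= j)%N -> (j%:R : R)^-1 <= ln j%:R - ln j.-1%:R.
Proof.
move=> j2; have j0 : (0 : R) < j%:R by rewrite ltr0n (leq_trans _ j2).
have j10 : (0 : R) < j.-1%:R by rewrite ltr0n -ltnS prednK// (leq_trans _ j2).
have jE : (j.-1%:R : R) = j%:R - 1 by rewrite -subn1 natrB// (leq_trans _ j2).
rewrite -lerN2 opprB -ln_div ?posrE//.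
have -> : (j.-1%:R / j%:R : R) = 1 + - j%:R^-1 by rewrite jE mulrBl mul1r divff ?gt_eqF.
apply: le_ln1Dx; rewrite ltrN2 invf_lt1// ltr1n//.
Qed.

(** The inequality [1 + p / j <= exp (p (ln j - ln (j - 1)))] compares a term
    with an increment of [x |-> x^(-p)], so that tails telescope. *)
Lemma powR_telescope p j : 0 < p -> (2 <= j)%N ->
  j%:R `^ (- 1 - p) <= p^-1 * (j.-1%:R `^ (- p) - j%:R `^ (- p)).
Proof.
move=> p0 j2; have j0 : (0 : R) < j%:R by rewrite ltr0n (leq_trans _ j2).
have j10 : (0 : R) < j.-1%:R by rewrite ltr0n -ltnS prednK// (leq_trans _ j2).
rewrite ler_pdivlMl//.
have -> : j%:R `^ (- 1 - p) = j%:R^-1 * j%:R `^ (- p).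
  by rewrite powRD ?powR_inv1 ?ltW// (gt_eqF j0) implybT.
have -> : j.-1%:R `^ (- p) = expR (p * (ln j%:R - ln j.-1%:R)) * j%:R `^ (- p).
  by rewrite /powR !gt_eqF// -expRD; congr expR; ring.
have e : 1 + p * j%:R^-1 <= expR (p * (ln j%:R - ln j.-1%:R)).
  apply: (le_trans (expR_ge1Dx _)).
  by rewrite ler_expR ler_pM2l// inv_le_lnB.
rewrite mulrA -{3}(mul1r (_ `^ _)) -mulrBl ler_wpM2r ?powR_ge0//.
by rewrite lerBrDl.
Qed.

Lemma powR_tail_sum p D J : 0 < p -> (2 <= D)%N ->
  \sum_(D <= j < J) (j%:R : R) `^ (- 1 - p) <= 2 `^ p / p * D%:R `^ (- p).
Proof.
move=> p0 D2; have D0 : (0 : R) < D%:R by rewrite ltr0n (leq_trans _ D2).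
have D10 : (0 : R) < D.-1%:R by rewrite ltr0n -ltnS prednK// (leq_trans _ D2).
have DE : (D.-1%:R : R) = D%:R - 1 by rewrite -subn1 natrB// (leq_trans _ D2).
(* As D - 1 >= D / 2, the telescoped bound at D - 1 becomes one at D. *)
have half : D.-1%:R `^ (- p) <= 2 `^ p * D%:R `^ (- p).
  have D2R : (2 : R) <= D%:R by rewrite ler_nat.
  rewrite /powR !gt_eqF//.
  rewrite -expRD ler_expR.
  have : ln D%:R - ln 2 <= ln D.-1%:R :> R.
    rewrite -ln_div ?posrE// ler_ln ?posrE ?divr_gt0//.
    rewrite DE; lra.
  nra.
have [DJ|DJ] := leqP D J; last first.
  rewrite big_geq ?(ltnW DJ)// mulr_ge0 ?powR_ge0// divr_ge0 ?powR_ge0 ?ltW//.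
suff : \sum_(D <= j < J) (j%:R : R) `^ (- 1 - p) <=
    p^-1 * (D.-1%:R `^ (- p) - J.-1%:R `^ (- p)).
  move=> /le_trans; apply.
  rewrite mulrAC mulrC ler_wpM2r ?invr_ge0 ?(ltW p0)//.
  by rewrite (le_trans _ half)// gerBl powR_ge0.
elim: J DJ => [|J IH] DJ; first by rewrite leqn0 in DJ; move: DJ D2 => /eqP ->.
move: DJ; rewrite leq_eqVlt => /predU1P[<-|].
  by rewrite big_geq// subrr mulr0.
rewrite ltnS => DJ; rewrite big_nat_recr//=.
have J2 := leq_trans D2 DJ.
apply: (le_trans (lerD (IH DJ) (powR_telescope p0 J2))).
by rewrite -mulrDr ler_pM2l ?invr_gt0//; lra.
Qed.

(** Telescopes, as [1 / (j ln^2 j) <= 1 / ln (j - 1) - 1 / ln j]. *)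
Lemma sum_inv_mul_ln2_bounded :
  exists S : R, forall J, \sum_(2 <= j < J) (j%:R * ln j%:R ^+ 2)^-1 <= S.
Proof.
have ln2 : (0 : R) < ln 2 by rewrite ln_gt0// ltr1n.
exists ((2 * ln 2 ^+ 2)^-1 + (ln 2)^-1) => J.
have [J3|J3] := leqP J 2.
  rewrite big_geq// addr_ge0 ?invr_ge0 ?mulr_ge0 ?sqr_ge0 ?ltW//.
rewrite big_ltn// lerD2l.
suff : \sum_(3 <= j < J) (j%:R * ln j%:R ^+ 2)^-1 <= (ln 2)^-1 - (ln J.-1%:R)^-1 :> R.
  move=> /le_trans; apply; rewrite gerBl invr_ge0 ln_ge0// ler1n -ltnS prednK//.
    by rewrite (leq_trans _ J3).
  by rewrite (leq_trans _ J3).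
elim: J J3 => // J IH; rewrite ltnS leq_eqVlt => /predU1P[<-|J3].
  by rewrite big_geq// subrr.
rewrite big_nat_recr//=.
have J0 : (0 : R) < J%:R by rewrite ltr0n (leq_trans _ J3).
have J1 : (2 : R) <= J.-1%:R by rewrite ler_nat -ltnS prednK// (leq_trans _ J3).
have l1 : (0 : R) < ln J.-1%:R by rewrite ln_gt0//; lra.
have JJ : (J.-1%:R : R) <= J%:R by rewrite ler_nat leq_pred.
have l2 : (ln J.-1%:R : R) <= ln J%:R by rewrite ler_ln ?posrE//; lra.
have l3 := lt_le_trans l1 l2.
apply: (le_trans (lerD (IH J3) (lexx _))).
have /(@inv_le_lnB J) : (2 <= J)%N by exact: ltnW.
set a := ln J.-1%:R in l1 l2 *; set b := ln J%:R in l2 l3 *; move=> e.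
suff : (J%:R * b ^+ 2)^-1 <= a^-1 - b^-1 by lra.
have -> : a^-1 - b^-1 = (b - a) * (a * b)^-1 by field; rewrite !gt_eqF.
rewrite invfM ler_pM ?invr_ge0 ?sqr_ge0 ?(ltW J0)//.
by rewrite expr2 lef_pV2 ?posrE ?mulr_gt0// ler_pM2r.
Qed.

(** Apply [ln t <= t] to the fourth root of [x]. *)
Lemma ln_sqr_le_sqrt x : 1 <= x -> ln x ^+ 2 <= 16 * Num.sqrt x.
Proof.
move=> x1; have x0 : 0 < x by lra.
have s1 : 1 <= Num.sqrt x by rewrite -sqrtr1 ler_wsqrtr.
have t1 : 1 <= Num.sqrt (Num.sqrt x) by rewrite -[leLHS]sqrtr1 ler_wsqrtr.
set t := Num.sqrt (Num.sqrt x) in t1 *.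
have t0 : 0 < t by lra.
have tE : t ^+ 2 = Num.sqrt x by rewrite sqr_sqrtr//; lra.
have xE : x = t ^+ 4 by rewrite (exprM t 2 2) tE sqr_sqrtr// ltW.
have lE : ln x = 4 * ln t by rewrite {1}xE lnXn// mulr_natl.
have lt : ln t <= t by have := expR_ge1Dx (ln t); rewrite lnK ?posrE//; lra.
have l0 : 0 <= ln t by rewrite ln_ge0.
rewrite lE -tE; nra.
Qed.

(** Cut at [sqrt D]: below, at most [sqrt D] bounded terms; above,
    [ln j >= (ln D) / 2].  The energy of the low frequencies of the truth thus
    keeps the factor [1 / ln^2 D] that the squared signal has. *)
Lemma sum_inv_ln2_le :
  exists C1 : R, forall D, (2 <= D)%N ->
   \sum_(2 <= j < D) (ln j%:R ^+ 2)^-1 <= C1 * D%:R / ln D%:R ^+ 2.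
Proof.
have ln2 : (0 : R) < ln 2 by rewrite ln_gt0// ltr1n.
exists (16 / ln 2 ^+ 2 + 4).
move=> D D2; have D0 : (0 : R) < D%:R by rewrite ltr0n (leq_trans _ D2).
have lD : (0 : R) < ln D%:R by rewrite ln_gt0// ltr1n.
have lpos j : (2 <= j)%N -> (ln 2 : R) <= ln j%:R.
  by move=> j2; rewrite ler_ln ?posrE ?ltr0n ?ler_nat// (leq_trans _ j2).
set s := Num.sqrt (D%:R : R).
have s0 : 0 < s by rewrite sqrtr_gt0.
have ss : s ^+ 2 = D%:R by rewrite sqr_sqrtr// ltW.
have term j : (2 <= j < D)%N -> (ln (j%:R : R) ^+ 2)^-1 <=
   (if (j <= Num.truncn s)%N then (ln 2 ^+ 2)^-1 else 0) + 4 / ln D%:R ^+ 2.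
  move=> /andP[j2 jD]; case: ifPn => [js|].
    rewrite -[leLHS]addr0 lerD ?divr_ge0 ?sqr_ge0//.
    by rewrite lef_pV2 ?posrE ?exprn_gt0 ?(lt_le_trans _ (lpos _ j2))// lerXn2r ?nnegrE ?(ltW ln2) ?lpos// (le_trans (ltW ln2) (lpos _ j2)).
  rewrite -ltnNge => sj; rewrite add0r.
  have j0 : (0 : R) < j%:R by rewrite ltr0n (leq_trans _ j2).
  have sj' : s < j%:R by rewrite -truncn_lt_nat// ltW.
  have le2 : ln (D%:R : R) <= 2 * ln j%:R.
    rewrite mulr_natl -lnXn// ler_ln ?posrE ?exprn_gt0//.
    by rewrite -ss lerXn2r ?nnegrE ?ltW.
  have lj := lt_le_trans ln2 (lpos _ j2).
  rewrite ler_pdivlMr ?exprn_gt0// mulrC ler_pdivrMr ?exprn_gt0//; nra.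
apply: (le_trans (ler_sum_nat term)).
rewrite big_split/= sumr_const_nat -[leRHS]mulrA [leRHS]mulrDl.
apply: lerD; last first.
  rewrite -[leLHS]mulr_natr -[leLHS]mulrA ler_pM2l// mulrC.
  by rewrite ler_wpM2r ?invr_ge0 ?sqr_ge0// ler_nat leq_subr.
have l16 : ln (D%:R : R) ^+ 2 <= 16 * s by apply: ln_sqr_le_sqrt; rewrite ler1n (leq_trans _ D2).
apply: (@le_trans _ _ (s * (ln 2 ^+ 2)^-1)).
  have sD : s < D%:R.
    have : (2 : R) <= D%:R by rewrite ler_nat.
    rewrite -ss; nra.
  have ND : ((Num.truncn s).+1 <= D)%N by rewrite truncn_lt_nat// ltW.
  rewrite -big_mkcond/= (eq_bigl (fun j => (true && (j < (Num.truncn s).+1))%N))//.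
  rewrite -big_nat_widen// sumr_const_nat -[leLHS]mulr_natl ler_wpM2r ?invr_ge0 ?sqr_ge0//.
  apply: (@le_trans _ _ (Num.truncn s)%:R); last by rewrite truncn_le ltW.
  by rewrite ler_nat subSS leq_subr.
rewrite [leRHS]mulrAC ler_wpM2r ?invr_ge0 ?sqr_ge0//.
by rewrite mulrA ler_pdivlMr ?exprn_gt0// -[in leRHS]ss expr2; nra.
Qed.
End Numeric.

(** * Series in a bounded orthonormal family *)

Section BoundedFunctions.
Context d (T : measurableType d) (R : realType).
Implicit Types f g : T -> R.

(** A class closed under the operations met below, in which integrability with
    respect to a finite measure is automatic. *)
Definition bounded_mfun f :=
  measurable_fun setT f /\ exists M, forall x, `|f x| <= M.

Lemma bounded_mfun_cst a : bounded_mfun (fun=> a).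
Proof. by split; [exact: measurable_cst | exists `|a|]. Qed.

Lemma bounded_mfunD f g : bounded_mfun f -> bounded_mfun g ->
  bounded_mfun (fun x => f x + g x).
Proof.
move=> [mf [M fM]] [mg [N gN]]; split; first exact: measurable_funD.
by exists (M + N) => x; rewrite (le_trans (ler_normD _ _))// lerD.
Qed.

Lemma bounded_mfunM f g : bounded_mfun f -> bounded_mfun g ->
  bounded_mfun (fun x => f x * g x).
Proof.
move=> [mf [M fM]] [mg [N gN]]; split; first exact: measurable_funM.
by exists (M * N) => x; rewrite normrM ler_pM.
Qed.

Lemma bounded_mfunN f : bounded_mfun f -> bounded_mfun (fun x => - f x).
Proof.
move=> [mf [M fM]]; split; first exact: measurableT_comp.
by exists M => x; rewrite normrN.
Qed.

Lemma bounded_mfunB f g : bounded_mfun f -> bounded_mfun g ->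
  bounded_mfun (fun x => f x - g x).
Proof. by move=> bf bg; apply: bounded_mfunD => //; exact: bounded_mfunN. Qed.

Lemma bounded_mfunX f n : bounded_mfun f -> bounded_mfun (fun x => f x ^+ n).
Proof.
move=> bf; elim: n => [|n IH]; first exact: bounded_mfun_cst.
by under eq_fun do rewrite exprS; exact: bounded_mfunM.
Qed.

Lemma bounded_mfun_sum I (r : seq I) (Pr : pred I) (F : I -> T -> R) :
  (forall i, Pr i -> bounded_mfun (F i)) ->
  bounded_mfun (fun x => \sum_(i <- r | Pr i) F i x).
Proof.
move=> bF; rewrite (_ : (fun _ => _) = \sum_(i <- r | Pr i) F i); last first.
  by apply/funext => x; rewrite fct_sumE.
by apply: big_ind => //; [exact: bounded_mfun_cst | exact: bounded_mfunD].
Qed.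

(** The terms below [B] are left free: basis functions are controlled for
    positive indices only. *)
Lemma bounded_mfun_sum_nat (B E : nat) (F : nat -> T -> R) :
  (forall j, (B <= j)%N -> bounded_mfun (F j)) ->
  bounded_mfun (fun x => \sum_(B <= j < E) F j x).
Proof.
move=> bF; under eq_fun do rewrite big_nat_cond.
by apply: bounded_mfun_sum => j /andP[/andP[Bj _] _]; exact: bF.
Qed.

Lemma bounded_mfun_integrable (P : {finite_measure set T -> \bar R}) f :
  bounded_mfun f -> P.-integrable setT (EFin \o f).
Proof.
move=> [mf [M fM]]; apply/integrableP; split; first exact/measurable_EFinP.
apply: (@le_lt_trans _ _ (\int[P]_x M%:E)%E).
  apply: ge0_le_integral => //=.
  - by do 2! apply: measurableT_comp => //.
  - by move=> x _; rewrite lee_fin fM.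
by rewrite integral_cst// lte_mul_pinfty ?fin_num_measure ?lee_fin// ?(le_trans (normr_ge0 _) (fM point))// fin_num_fun_lty//; exact: fin_num_measure.
Qed.

Lemma bounded_Rintegral_sum (P : {finite_measure set T -> \bar R}) I (r : seq I)
    (F : I -> T -> R) : (forall i, bounded_mfun (F i)) ->
  \int[P]_x (\sum_(i <- r) F i x) = \sum_(i <- r) \int[P]_x F i x.
Proof.
move=> bF; elim: r => [|i r IH].
  by under eq_Rintegral do rewrite big_nil; rewrite big_nil Rintegral_cst// mul0r.
under eq_Rintegral do rewrite big_cons; rewrite big_cons -IH.
rewrite RintegralD//; apply: (bounded_mfun_integrable P); first exact: bF.
exact: bounded_mfun_sum.
Qed.

Lemma bounded_Rintegral_sum_nat (P : {finite_measure set T -> \bar R}) (B E : nat)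
    (F : nat -> T -> R) : (forall j, (B <= j)%N -> bounded_mfun (F j)) ->
  \int[P]_x (\sum_(B <= j < E) F j x) = \sum_(B <= j < E) \int[P]_x F j x.
Proof.
move=> bF; pose F' j := if (B <= j)%N then F j else fun=> 0.
transitivity (\int[P]_x (\sum_(B <= j < E) F' j x)).
  by apply: eq_Rintegral => x _; apply: eq_big_nat => j /andP[Bj _]; rewrite /F' Bj.
rewrite bounded_Rintegral_sum; last first.
  by move=> j; rewrite /F'; case: ifP => [/bF//|_]; exact: bounded_mfun_cst.
by apply: eq_big_nat => j /andP[Bj _]; rewrite /F' Bj.
Qed.

Lemma bounded_RintegralZr (P : {finite_measure set T -> \bar R}) f a :
  bounded_mfun f -> \int[P]_x (f x * a) = (\int[P]_x f x) * a.
Proof. by move=> bf; rewrite RintegralZr//; exact: (bounded_mfun_integrable P). Qed.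

Lemma bounded_cvg_Rintegral (P : {finite_measure set T -> \bar R})
    (f_ : nat -> T -> R) f (M : R) :
  (forall n, measurable_fun setT (f_ n)) -> (forall n x, `|f_ n x| <= M) ->
  (forall x, f_ n x @[n --> \oo] --> f x) ->
  \int[P]_x f_ n x @[n --> \oo] --> \int[P]_x f x.
Proof.
move=> mf fM cf.
have mlim : measurable_fun setT f by apply: (measurable_fun_cvg mf) => x _; exact: cf.
have := @dominated_convergence _ _ _ P setT measurableT
  (fun n => EFin \o f_ n) (EFin \o f) (fun=> M%:E).
case.
- by move=> n; exact/measurable_EFinP.
- exact/measurable_EFinP.
- by apply: aeW => x _; apply/cvg_EFin; [exact: nearW | exact: cf].
- apply: (@bounded_mfun_integrable P (fun=> M)); exact: bounded_mfun_cst.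
- by apply: aeW => x n _ /=; rewrite lee_fin.
move=> If _; have fi := integrable_fin_num measurableT If.
by rewrite -(fineK fi) => /fine_cvgP[_].
Qed.

End BoundedFunctions.

Section AbsolutelyConvergentSums.
Context {R : realType}.
Implicit Types u : nat -> R.

Lemma sum1_cvg u (S : R) : (forall J, \sum_(1 <= j < J) `|u j| <= S) ->
  cvgn (fun J => \sum_(1 <= j < J) u j).
Proof.
move=> uS; pose v j := if j is 0 then 0 else u j.
have vE (F : R -> R) J : F 0 = 0 ->
    \sum_(1 <= j < J) F (u j) = series (F \o v) J.
  move=> F0; rewrite /series/=; case: J => [|J]; first by rewrite !big_geq.
  rewrite [RHS]big_ltn//= F0 add0r; apply: eq_big_nat => j /andP[j1 _].
  by case: j j1.
rewrite (_ : (fun _ => _) = series v); last first.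
  by apply/funext => J; rewrite (vE id).
apply: normed_cvg; apply: nondecreasing_is_cvgn.
  by apply: nondecreasing_series => n _ _; exact: normr_ge0.
exists S => _ [J _ <-]; apply: le_trans (uS J).
by rewrite (vE Num.norm)// normr0.
Qed.

Lemma sum1_lim_le u (S : R) : (forall J, \sum_(1 <= j < J) `|u j| <= S) ->
  `|limn (fun J => \sum_(1 <= j < J) u j)| <= S.
Proof.
move=> uS; have cu := sum1_cvg uS.
rewrite -lim_norm//; apply: limr_le; first exact: is_cvg_norm.
by apply: nearW => J; rewrite (le_trans (ler_norm_sum _ _ _)).
Qed.

End AbsolutelyConvergentSums.

Section OrthonormalSeries.
Context d (T : measurableType d) (R : realType) (P : probability T R).
Variables (phi : nat -> T -> R) (M : R).
Hypothesis mphi : forall j, (0 < j)%N -> measurable_fun setT (phi j).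
Hypothesis phiM : forall j x, (0 < j)%N -> `|phi j x| <= M.

Definition fseries (c : nat -> R) (x : T) : R :=
  limn (fun J => \sum_(1 <= j < J) c j * phi j x).

Let bphi j : (0 < j)%N -> bounded_mfun (phi j).
Proof. by move=> j0; split; [exact: mphi | exists M => x; exact: phiM]. Qed.

Section Convergence.
Variables (c : nat -> R) (S : R).
Hypothesis cS : forall J, \sum_(1 <= j < J) `|c j| <= S.

Lemma fseries_term_le x J : \sum_(1 <= j < J) `|c j * phi j x| <= S * M.
Proof.
apply: (@le_trans _ _ (\sum_(1 <= j < J) `|c j| * M)).
  by apply: ler_sum_nat => j /andP[j1 _]; rewrite normrM ler_wpM2l// phiM.
by rewrite -mulr_suml ler_wpM2r// (le_trans _ (@phiM 1%N x isT)).
Qed.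

Lemma fseries_cvg x :
  \sum_(1 <= j < J) c j * phi j x @[J --> \oo] --> fseries c x.
Proof. exact: (sum1_cvg (fseries_term_le x)). Qed.

Lemma fseries_bound x : `|fseries c x| <= S * M.
Proof. exact: (sum1_lim_le (fseries_term_le x)). Qed.

Lemma fseries_bounded : bounded_mfun (fseries c).
Proof.
split; last by exists (S * M) => x; exact: fseries_bound.
apply: (@measurable_fun_cvg _ _ _ setT (fun J x => \sum_(1 <= j < J) c j * phi j x)).
  move=> J; apply: (proj1 (bounded_mfun_sum_nat _ _)) => j j1.
  by apply: bounded_mfunM; [exact: bounded_mfun_cst | exact: bphi].
by move=> x _; exact: fseries_cvg.
Qed.

(** Dominated convergence: the partial sums are bounded by [S * M]. *)
Lemma fseries_inner g : bounded_mfun g ->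
  \sum_(1 <= j < J) c j * (\int[P]_x (phi j x * g x)) @[J --> \oo] -->
  \int[P]_x (fseries c x * g x).
Proof.
move=> [mg [N gN]].
have bg : bounded_mfun g by split => //; exists N.
have -> : (fun J => \sum_(1 <= j < J) c j * (\int[P]_x (phi j x * g x))) =
   (fun J => \int[P]_x ((\sum_(1 <= j < J) c j * phi j x) * g x)).
  have bp j : (0 < j)%N -> bounded_mfun (fun x => phi j x * g x).
    by move=> j0; apply: bounded_mfunM => //; exact: bphi.
  apply/funext => J; under [RHS]eq_Rintegral do rewrite mulr_suml.
  rewrite bounded_Rintegral_sum_nat; last first.
    move=> j j0; apply: bounded_mfunM => //; apply: bounded_mfunM; last exact: bphi.
    exact: bounded_mfun_cst.
  apply: eq_big_nat => j /andP[j0 _]; rewrite mulrC -(bounded_RintegralZr P _ (bp _ j0)).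
  by apply: eq_Rintegral => x _; rewrite mulrC mulrA.
apply: (@bounded_cvg_Rintegral _ _ _ P _ _ (S * M * N)).
- move=> J; apply: measurable_funM => //.
  apply: (proj1 (bounded_mfun_sum_nat _ _)) => j j1.
  by apply: bounded_mfunM; [exact: bounded_mfun_cst | exact: bphi].
- move=> J x; rewrite normrM ler_pM//.
  by rewrite (le_trans (ler_norm_sum _ _ _))// fseries_term_le.
- by move=> x; apply: cvgMl; exact: fseries_cvg.
Qed.

End Convergence.

Hypothesis ortho : forall i j, (0 < i)%N -> (0 < j)%N ->
  \int[P]_x (phi i x * phi j x) = (i == j)%:R.

Lemma fseries_coef c S i : (forall J, \sum_(1 <= j < J) `|c j| <= S) ->
  (0 < i)%N -> \int[P]_x (fseries c x * phi i x) = c i.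
Proof.
move=> cS i0; have /cvg_lim <- // := fseries_inner cS (bphi i0).
apply: (@lim_near_cst _ _ _ _ _ _ _) => //.
near=> J.
have iJ : (i < J)%N by near: J; exists i.+1.
rewrite (big_rem i) ?mem_index_iota ?i0//= ortho// eqxx mulr1.
rewrite rem_filter ?iota_uniq// big_filter big_nat_cond big1 ?addr0// => j.
by move=> /andP[/andP[j0 _] /= ji]; rewrite ortho// (negbTE ji) mulr0.
Unshelve. all: by end_near. Qed.

(** Pair the series with itself: its coefficients are again [c]. *)
Lemma fseries_sqr c S q : (forall J, \sum_(1 <= j < J) `|c j| <= S) ->
  (forall J, \sum_(1 <= j < J) c j ^+ 2 <= q) ->
  \int[P]_x (fseries c x ^+ 2) <= q.
Proof.
move=> cS cq; under eq_Rintegral do rewrite expr2.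
have /cvg_lim <- // := fseries_inner cS (fseries_bounded cS).
apply: limr_le; first by apply/cvg_ex; eexists; exact: (fseries_inner cS (fseries_bounded cS)).
apply: nearW => J; apply: le_trans (cq J).
rewrite le_eqVlt; apply/orP; left; apply/eqP; apply: eq_big_nat => j /andP[j1 _].
by under eq_Rintegral do rewrite mulrC; rewrite (fseries_coef cS)// expr2.
Qed.

(** Test function that sees a whole range of frequencies, with squared norm the
    number of these frequencies. *)
Definition block B E (x : T) : R := \sum_(B <= j < E) phi j x.

Lemma block_bounded B E : (0 < B)%N -> bounded_mfun (block B E).
Proof.
move=> B0; apply: bounded_mfun_sum_nat => j Bj.
by apply: bphi; exact: leq_trans Bj.
Qed.

Lemma Rintegral_blockr B E f : (0 < B)%N -> bounded_mfun f ->
  \int[P]_x (f x * block B E x) = \sum_(B <= j < E) \int[P]_x (f x * phi j x).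
Proof.
move=> B0 bf; under eq_Rintegral do rewrite /block mulr_sumr.
apply: bounded_Rintegral_sum_nat => j Bj; apply: bounded_mfunM => //.
by apply: bphi; exact: leq_trans Bj.
Qed.

Lemma fseries_block c S B E : (0 < B)%N ->
  (forall J, \sum_(1 <= j < J) `|c j| <= S) ->
  \int[P]_x (fseries c x * block B E x) = \sum_(B <= j < E) c j.
Proof.
move=> B0 cS; rewrite Rintegral_blockr//; last exact: fseries_bounded cS.
apply: eq_big_nat => j /andP[Bj _].
by apply: (fseries_coef cS); exact: leq_trans Bj.
Qed.

Lemma phi_block B E j : (0 < B)%N -> (B <= j < E)%N ->
  \int[P]_x (phi j x * block B E x) = 1.
Proof.
move=> B0 /andP[Bj jE]; have j0 := leq_trans B0 Bj.
rewrite Rintegral_blockr//; last exact: bphi.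
rewrite (big_rem j) ?mem_index_iota ?Bj//= ortho// eqxx.
rewrite rem_filter ?iota_uniq// big_filter big_nat_cond big1 ?addr0// => i.
by move=> /andP[/andP[Bi _] /= ij]; rewrite ortho// ?(leq_trans B0)// eq_sym (negbTE ij).
Qed.

Lemma block_sqr B E : (0 < B)%N -> \int[P]_x (block B E x ^+ 2) = (E - B)%:R.
Proof.
move=> B0; under eq_Rintegral do rewrite expr2.
rewrite Rintegral_blockr//; last exact: block_bounded.
rewrite (eq_big_nat _ _ (F2 := fun=> 1)) ?sumr_const_nat// => j jBE.
by under eq_Rintegral do rewrite mulrC; exact: phi_block.
Qed.

End OrthonormalSeries.

(** * Ridge weights and kernel quadratic forms *)

Section SumCauchySchwarz.
Context {R : realFieldType} {I : Type}.
Implicit Types (r : seq I) (a b w : I -> R).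

Lemma sum_CS r (Pr : pred I) a b :
  (\sum_(i <- r | Pr i) a i * b i) ^+ 2 <=
  (\sum_(i <- r | Pr i) a i ^+ 2) * (\sum_(i <- r | Pr i) b i ^+ 2).
Proof.
set A := \sum_(i <- r | Pr i) a i ^+ 2; set B := \sum_(i <- r | Pr i) b i ^+ 2.
set S := \sum_(i <- r | Pr i) a i * b i.
have A0 : 0 <= A by apply: sumr_ge0 => i _; exact: sqr_ge0.
have B0 : 0 <= B by apply: sumr_ge0 => i _; exact: sqr_ge0.
have key t : 0 <= t ^+ 2 * A - 2 * t * S + B.
  have -> : t ^+ 2 * A - 2 * t * S + B = \sum_(i <- r | Pr i) (t * a i - b i) ^+ 2.
    rewrite /A /B /S !mulr_sumr -sumrB -big_split/=.
    by apply: eq_bigr => i _; ring.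
  by apply: sumr_ge0 => i _; exact: sqr_ge0.
have [A00|A_neq0] := eqVneq A 0.
  rewrite A00 mul0r.
  have [->|S0] := eqVneq S 0; first by rewrite expr0n.
  have := key ((B + 1) / (2 * S)); rewrite A00 mulr0 add0r.
  rewrite (_ : 2 * _ * S = B + 1); first by lra.
  by field.
have {A_neq0} A1 : 0 < A by rewrite lt_neqAle eq_sym A_neq0.
have := key (S / A).
rewrite (_ : _ + B = (A * B - S ^+ 2) / A); last by field; rewrite gt_eqF.
by rewrite pmulr_lge0 ?invr_gt0// subr_ge0.
Qed.

End SumCauchySchwarz.

Lemma sum_sqr_le_card (R : realFieldType) m (a : 'I_m -> R) :
  (\sum_i a i) ^+ 2 <= m%:R * \sum_i a i ^+ 2.
Proof.
have := sum_CS (index_enum 'I_m) xpredT (fun=> 1) a.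
under eq_bigr do rewrite mul1r.
by under [X in _ <= X * _ -> _]eq_bigr do rewrite expr1n; rewrite sumr_const card_ord.
Qed.

Section RidgeSystem.
Context {R : rcfType} {n : nat}.
Variables (G : 'M[R]_n) (s : R).
Hypothesis s0 : s != 0.

Definition quad (v : 'I_n -> R) : R := \sum_i \sum_j v i * v j * G i j.

Hypothesis psd : forall v, 0 <= quad v.

Lemma quad_row (v : 'rV[R]_n) :
  (v *m (G + (s ^+ 2)%:M) *m v^T) 0 0 = quad (v 0) + s ^+ 2 * \sum_i v 0 i ^+ 2.
Proof.
rewrite mulmxDr mulmxDl mxE; congr (_ + _).
  rewrite mxE /quad exchange_big/=; apply: eq_bigr => j _.
  rewrite mxE mulr_suml; apply: eq_bigr => i _; rewrite mxE; ring.
rewrite mul_mx_scalar -scalemxAl mxE; congr (_ * _).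
by rewrite mxE; apply: eq_bigr => i _; rewrite mxE expr2.
Qed.

(** The quadratic form of this matrix is at least [s^2 |v|^2]. *)
Lemma ridge_unitmx : G + (s ^+ 2)%:M \in unitmx.
Proof.
rewrite -row_free_unit -kermx_eq0; apply/eqP/row_matrixP => i.
set v := row i _; rewrite row0.
have vA : v *m (G + (s ^+ 2)%:M) = 0 by rewrite -row_mul mulmx_ker row0.
have := quad_row v; rewrite vA mul0mx mxE => /esym e.
have s2 : 0 < s ^+ 2 by rewrite exprn_even_gt0.
have S0 : \sum_i v 0 i ^+ 2 = 0.
  have : 0 <= \sum_i v 0 i ^+ 2 by apply: sumr_ge0 => k _; exact: sqr_ge0.
  move: e (psd (v 0)); set X := quad _; set Y := \sum_i _ => e X0 Y0.
  apply/eqP; rewrite eq_le Y0 andbT -(pmulr_rle0 _ s2); lra.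
apply/rowP => k; rewrite [RHS]mxE.
have /allP /(_ k) := eqbLR (@psumr_eq0 _ _ (index_enum 'I_n) xpredT (fun i => v 0 i ^+ 2) (fun i _ => sqr_ge0 _)) (introT eqP S0).
by rewrite mem_index_enum => /(_ isT) /=; rewrite sqrf_eq0 => /eqP.
Qed.

Variable u : 'rV[R]_n.

(** Weights that kernel ridge regression gives to the responses, when its fit is
    read through a linear functional taking the values [u] on the kernel
    sections at the design points. *)
Definition ridge_weights : 'rV[R]_n := u *m invmx (G + (s ^+ 2)%:M).
Local Notation v := ridge_weights.

Lemma ridge_energy :
  quad (v 0) + s ^+ 2 * \sum_i v 0 i ^+ 2 = \sum_i u 0 i * v 0 i.
Proof.
rewrite -quad_row /v mulmxKV ?ridge_unitmx// mxE.
by apply: eq_bigr => i _; rewrite mxE.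
Qed.

Lemma ridge_energy_ge0 : 0 <= \sum_i u 0 i * v 0 i.
Proof.
rewrite -ridge_energy addr_ge0// mulr_ge0 ?sqr_ge0// sumr_ge0// => i _.
exact: sqr_ge0.
Qed.

(** The self-bounding step: [e = u v] satisfies [e^2 <= tau * quad v <= tau * e],
    whence [e <= tau], and [e] dominates both [quad v] and [s^2 |v|^2]. *)
Lemma ridge_energy_le (tau : R) : 0 <= tau ->
  (\sum_i u 0 i * v 0 i) ^+ 2 <= tau * quad (v 0) ->
  \sum_i u 0 i * v 0 i <= tau.
Proof.
move=> tau0 dual; have := ridge_energy_ge0; rewrite le_eqVlt => /predU1P[<-//|e0].
have qle : quad (v 0) <= \sum_i u 0 i * v 0 i.
  rewrite -ridge_energy lerDl mulr_ge0 ?sqr_ge0// sumr_ge0// => i _.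
  exact: sqr_ge0.
rewrite -(ler_pM2r e0) -expr2 (le_trans dual)// ler_wpM2l//.
Qed.

End RidgeSystem.

Section KernelFeatures.
Context {R : realType}.
Variables (K : R -> R -> R) (mu : nat -> R) (psi : nat -> R -> R).
Hypothesis Kexp : kernel_expansion K mu psi.
Hypothesis mu0 : forall j, (0 < j)%N -> 0 < mu j.

Definition feature j r (t a : 'I_r -> R) : R := \sum_i a i * psi j (t i).

(** The kernel as a bilinear form on finitely supported measures, given by
    points and weights. *)
Definition kform r q (t a : 'I_r -> R) (t' a' : 'I_q -> R) : R :=
  \sum_i \sum_k a i * a' k * K (t i) (t' k).

Lemma kform_cvg r q (t a : 'I_r -> R) (t' a' : 'I_q -> R) :
  (forall i, t i \in `[0, 1]) -> (forall i, t' i \in `[0, 1]) ->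
  \sum_(1 <= j < J) mu j * (feature j t a * feature j t' a') @[J --> \oo] -->
  kform t a t' a'.
Proof.
move=> t01 t01'.
rewrite (_ : (fun _ => _) = fun J => \sum_i \sum_k a i * a' k *
    \sum_(1 <= j < J) mu j * psi j (t i) * psi j (t' k)); last first.
  apply/funext => J; under [RHS]eq_bigr do under eq_bigr do rewrite mulr_sumr.
  under [RHS]eq_bigr do rewrite exchange_big/=.
  rewrite [RHS]exchange_big/=; apply: eq_bigr => j _.
  rewrite /feature mulr_suml mulr_sumr; apply: eq_bigr => i _.
  rewrite mulr_sumr mulr_sumr; apply: eq_bigr => k _; ring.
by do 2! (apply: cvg_big => [|? _]; first exact: add_continuous); apply: cvgMr; exact: Kexp.
Qed.

(** Limit of the Cauchy-Schwarz inequalities for the partial sums of the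
    expansion of the kernel. *)
Lemma kform_CS r q (t a : 'I_r -> R) (t' a' : 'I_q -> R) :
  (forall i, t i \in `[0, 1]) -> (forall i, t' i \in `[0, 1]) ->
  kform t a t' a' ^+ 2 <= kform t a t a * kform t' a' t' a'.
Proof.
move=> t01 t01'.
have c1 := kform_cvg (a := a) (a' := a') t01 t01'.
have c2 := kform_cvg (a := a) (a' := a) t01 t01.
have c3 := kform_cvg (a := a') (a' := a') t01' t01'.
rewrite expr2; apply: ler_cvg_to (cvgM c1 c1) (cvgM c2 c3) _; apply: nearW => J.
pose b i := Num.sqrt (mu i) * feature i t a.
pose b' i := Num.sqrt (mu i) * feature i t' a'.
have E (x y : nat -> R) : \sum_(1 <= j < J) mu j * (x j * y j) =
   \sum_(1 <= j < J) (Num.sqrt (mu j) * x j) * (Num.sqrt (mu j) * y j).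
  apply: eq_big_nat => j /andP[j1 _].
  by rewrite -[in LHS](sqr_sqrtr (ltW (mu0 j1))); ring.
rewrite /= !E -expr2.
by have := sum_CS (index_iota 1 J) xpredT b b'.
Qed.

Lemma kform_ge0 r (t a : 'I_r -> R) : (forall i, t i \in `[0, 1]) ->
  0 <= kform t a t a.
Proof.
move=> t01; have /cvg_lim <- // := kform_cvg (a := a) (a' := a) t01 t01.
apply: limr_ge; first by apply/cvg_ex; eexists; exact: kform_cvg.
apply: nearW => J; rewrite big_nat_cond sumr_ge0// => j /andP[/andP[j1 _] _].
by apply: mulr_ge0; [exact/ltW/mu0 | rewrite -expr2 sqr_ge0].
Qed.

Lemma kform_ge_block r (t a : 'I_r -> R) B E : (forall i, t i \in `[0, 1]) ->
  (0 < B)%N -> \sum_(B <= j < E) mu j * feature j t a ^+ 2 <= kform t a t a.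
Proof.
move=> t01 B0; have pos j : (0 < j)%N -> 0 <= mu j * feature j t a ^+ 2.
  by move=> j0; rewrite mulr_ge0 ?sqr_ge0// ltW// mu0.
have [EB|BE] := leqP E B; first by rewrite big_geq// kform_ge0.
have /cvg_lim <- // := kform_cvg (a := a) (a' := a) t01 t01.
apply: limr_ge; first by apply/cvg_ex; eexists; exact: kform_cvg.
near=> J; have EJ : (E <= J)%N by near: J; exists E.
under [leRHS]eq_bigr do rewrite -expr2.
rewrite (big_cat_nat B0 (leq_trans (ltnW BE) EJ))/=.
rewrite (big_cat_nat (ltnW BE) EJ)/= addrCA lerDl addr_ge0// big_nat_cond sumr_ge0// => j /andP[/andP[j1 _] _]; apply: pos => //.
by rewrite (leq_trans _ j1)// (leq_trans B0)// ltnW.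
Unshelve. all: by end_near. Qed.

(** [\sum_j c_j psi_j] has squared norm [\sum_j c_j^2 / mu_j] in the reproducing
    kernel space, where the kernel form is dual to evaluation: Cauchy-Schwarz
    with the weights [mu_j]. *)
Lemma feature_dual r (t a : 'I_r -> R) B E (c : nat -> R) :
  (forall i, t i \in `[0, 1]) -> (0 < B)%N ->
  (\sum_i (\sum_(B <= j < E) c j * psi j (t i)) * a i) ^+ 2 <=
  (\sum_(B <= j < E) c j ^+ 2 / mu j) * kform t a t a.
Proof.
move=> t01 B0; set X := \sum_(B <= j < E) c j ^+ 2 / mu j.
have muB j : (B <= j)%N -> 0 < mu j by move=> Bj; rewrite mu0// (leq_trans B0).
have -> : \sum_i (\sum_(B <= j < E) c j * psi j (t i)) * a i =
    \sum_(B <= j < E) (c j / Num.sqrt (mu j)) * (Num.sqrt (mu j) * feature j t a).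
  under eq_bigr do rewrite mulr_suml.
  rewrite exchange_big/=; apply: eq_big_nat => j /andP[Bj _].
  rewrite mulrA divfK ?gt_eqF ?sqrtr_gt0 ?muB// /feature mulr_sumr.
  by apply: eq_bigr => i _; ring.
apply: (le_trans (sum_CS _ xpredT _ _)).
have XE : \sum_(B <= j < E) (c j / Num.sqrt (mu j)) ^+ 2 = X.
  apply: eq_big_nat => j /andP[Bj _].
  by rewrite exprMn exprVn sqr_sqrtr// ltW// muB.
rewrite XE ler_wpM2l//.
  by rewrite -XE sumr_ge0// => j _; exact: sqr_ge0.
apply: le_trans (kform_ge_block a E t01 B0).
rewrite le_eqVlt; apply/orP; left; apply/eqP; apply: eq_big_nat => j /andP[Bj _].
by rewrite exprMn sqr_sqrtr// ltW// muB.
Qed.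

End KernelFeatures.

(** * Moments of Gaussian laws *)

Section Density.
Context d (T : measurableType d) (R : realType).
Variables (mu nu : {measure set T -> \bar R}) (p : T -> R).
Hypotheses (mp : measurable_fun setT p) (p0 : forall x, 0 <= p x).
Hypothesis nuE : forall A, measurable A -> nu A = (\int[mu]_(x in A) (p x)%:E)%E.
Import HBNNSimple.

Let density_nnsfun (f : {nnsfun T >-> R}) :
  (\int[nu]_x (f x)%:E = \int[mu]_x ((f x)%:E * (p x)%:E))%E.
Proof.
under [LHS]eq_integral do rewrite fimfunE -fsumEFin//.
rewrite [LHS]ge0_integral_fsum//; last 2 first.
  - by move=> r; exact/measurable_EFinP/measurableT_comp.
  - by move=> n x _; rewrite EFinM nnfun_muleindic_ge0.
under [RHS]eq_integral.
  move=> x xD; rewrite muleC fimfunE -fsumEFin// ge0_mule_fsumr; last first.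
    by move=> r; rewrite EFinM nnfun_muleindic_ge0.
  over.
rewrite [RHS]ge0_integral_fsum//; last 2 first.
  - move=> r; apply: emeasurable_funM; first exact/measurable_EFinP.
    by apply/measurable_EFinP; do 2 apply/measurableT_comp => //.
  - move=> n x _; rewrite mule_ge0// ?lee_fin//.
    by have := nnfun_muleindic_ge0 f n x; rewrite -EFinM lee_fin.
apply: eq_fsbigr => r _.
rewrite integralZl_indic_nnsfun//= integral_indic//= setIT nuE//.
have [r0|r0] := leP 0 r; last first.
  rewrite preimage_nnfun0// integral_set0 mule0 integral0_eq// => x _.
  by rewrite indic0 mulr0 mule0.
rewrite integral_mkcond -ge0_integralZl//; last 2 first.
  - apply/(measurable_restrictT _ _).1 => //.
    exact/measurable_funTS/measurable_EFinP.
  - by move=> x _; rewrite patchE; case: ifP => // _; rewrite lee_fin.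
apply: eq_integral => x _; rewrite patchE indicE.
by case: ifP => _; rewrite ?mulr1 ?mulr0 ?mule0// muleC.
Qed.

(** Clear for simple functions; then monotone convergence. *)
Lemma integral_density (f : T -> \bar R) :
  measurable_fun setT f -> (forall x, 0 <= f x)%E ->
  (\int[nu]_x f x = \int[mu]_x (f x * (p x)%:E))%E.
Proof.
move=> mf f0.
pose f_ := nnsfun_approx measurableT mf.
have cf x : (f_ n x)%:E @[n --> \oo] --> f x by exact: cvg_nnsfun_approx.
have ndf n m x : (n <= m)%N -> f_ n x <= f_ m x.
  by move=> nm; exact/lefP/nd_nnsfun_approx.
transitivity (lim (\int[nu]_x (f_ n x)%:E @[n --> \oo])%E).
  rewrite -monotone_convergence//=.
  - by apply: eq_integral => x _; apply/esym/cvg_lim => //; exact: cf.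
  - by move=> n; exact/measurable_EFinP/measurable_funTS.
  - by move=> n x _; rewrite lee_fin.
  - by move=> x _ n m nm; rewrite lee_fin ndf.
rewrite (_ : (fun _ => _) = fun n => \int[mu]_x ((f_ n x)%:E * (p x)%:E))%E; last first.
  by apply/funext => n; exact: density_nnsfun.
rewrite -monotone_convergence//=.
- apply: eq_integral => x _; apply/cvg_lim => //.
  by apply: cvgeZr => //; exact: cf.
- by move=> n; apply: emeasurable_funM; exact/measurable_EFinP.
- by move=> n x _; rewrite mule_ge0// lee_fin.
- by move=> x _ n m nm; rewrite lee_wpmul2r ?lee_fin// ndf.
Qed.

End Density.

Lemma integral_prob1 d (T : measurableType d) (R : realType) (P : probability T R) :
  (\int[P]_x 1 = 1)%E.
Proof. by rewrite integral_cst// mul1e; exact: probability_setT. Qed.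

Section NormalMoments.
Context {R : realType}.
Local Notation leb := (@lebesgue_measure R).

Lemma norm_le_1Dsqr (a : R) : `|a| <= 1 + a ^+ 2.
Proof. by rewrite ler_norml; apply/andP; split; nra. Qed.

Lemma integral_normal_prob (m s : R) (f : R -> \bar R) :
  measurable_fun setT f -> (forall x, 0 <= f x)%E ->
  (\int[normal_prob m s]_x f x = \int[leb]_x (f x * (normal_pdf m s x)%:E))%E.
Proof.
move=> mf f0; apply: integral_density => //.
- exact: measurable_normal_pdf.
- exact: normal_pdf_ge0.
Qed.

Lemma normal_pdf_standardize (m s x : R) : 0 < s ->
  normal_pdf m s x = normal_pdf 0 1 ((x - m) / s) * s^-1.
Proof.
move=> s0; rewrite !normal_pdfE ?gt_eqF// /normal_peak /normal_fun subr0.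
have -> : s ^+ 2 * pi *+ 2 = s ^+ 2 * (1 ^+ 2 * pi *+ 2).
  by rewrite expr1n mul1r mulrnAr.
rewrite sqrtrM ?sqr_ge0// sqrtr_sqr gtr0_norm// invfM -[RHS]mulrC [RHS]mulrA.
congr (_ * _); congr expR.
by rewrite expr1n exprMn exprVn -[s ^+ 2 *+ 2]mulr_natr invfM mulrA !mulNr.
Qed.

(** Substitution [x |-> (x - m) / s] in the density. *)
Lemma normal_standardize (m s : R) (g : R -> R) : 0 < s ->
  continuous g -> (forall x, 0 <= g x) ->
  (\int[normal_prob m s]_x (g ((x - m) / s))%:E =
   \int[normal_prob 0 1]_x (g x)%:E)%E.
Proof.
move=> s0 cg g0.
have mg : measurable_fun setT g by exact: continuous_measurable_fun.
pose F (x : R^o) := (x - m) / s.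
have F'E : F^`()%classic = cst s^-1.
  apply/funext => x; rewrite /F derive1E deriveM// deriveD// derive_cst scaler0.
  by rewrite add0r derive_id derive_cst addr0 scaler1.
have mgF : measurable_fun setT (fun x : R => g ((x - m) / s)).
  apply: measurableT_comp => //.
  by apply: measurable_funM => //; exact: measurable_funB.
rewrite (@integral_normal_prob m s (fun x => (g ((x - m) / s))%:E)); last 2 first.
- exact/measurable_EFinP.
- by move=> x; rewrite lee_fin.
rewrite (@integral_normal_prob 0 1 (fun x => (g x)%:E)); last 2 first.
- exact/measurable_EFinP.
- by move=> x; rewrite lee_fin.
under [RHS]eq_integral do rewrite -EFinM.
rewrite (@increasing_ge0_integration_by_substitutionT _ F
   (fun x => g x * normal_pdf 0 1 x)); last 9 first.
- by move=> x y xy; rewrite /F ltr_pM2r ?invr_gt0// ltrD2r.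
- by rewrite F'E => ?; exact: cvg_cst.
- by rewrite F'E; exact: is_cvg_cst.
- by rewrite F'E; exact: is_cvg_cst.
- by [].
- by apply/gt0_cvgMlNy; [rewrite invr_gt0 | exact: cvg_addrr_Ny].
- by apply/gt0_cvgMly; [rewrite invr_gt0 | exact: cvg_addrr].
- by move=> x; apply: cvgM; [exact: cg | apply: continuous_normal_pdf; rewrite oner_eq0].
- by move=> x; rewrite mulr_ge0// normal_pdf_ge0.
apply: eq_integral => x _; rewrite F'E -EFinM; congr EFin.
by rewrite /= (normal_pdf_standardize _ _ s0) mulrA.
Qed.

Lemma lebesgue_integralN (f : R -> \bar R) : measurable_fun setT f ->
  (forall x, 0 <= f x)%E -> (\int[leb]_x f (- x)%R = \int[leb]_x f x)%E.
Proof.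
move=> mf f0.
transitivity (\int[pushforward leb (-%R : _ -> measurableTypeR R)]_x f x)%E.
  by rewrite ge0_integral_pushforward.
by apply: eq_measure_integral => A mA _; exact: lebesgue_measureN.
Qed.

Definition normal_m2 : \bar R := (\int[normal_prob (0 : R) 1]_x (x ^+ 2)%:E)%E.

(** [x^2 exp (- x^2 / 2) <= 4 exp (- x^2 / 4)], and the right-hand side is, up to
    a constant, the density of a wider normal law. *)
Lemma normal_m2_fin : normal_m2 \is a fin_num.
Proof.
rewrite ge0_fin_numE; last by apply: integral_ge0 => x _; rewrite lee_fin sqr_ge0.
rewrite /normal_m2 integral_normal_prob; last 2 first.
- exact/measurable_EFinP.
- by move=> x; rewrite lee_fin sqr_ge0.
pose r : R := Num.sqrt 2.
have r2 : r ^+ 2 = 2 by rewrite sqr_sqrtr.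
have r0 : 0 < r by rewrite sqrtr_gt0.
pose k := 4 * normal_peak 1 / normal_peak r.
have k0 : 0 <= k by rewrite divr_ge0 ?mulr_ge0 ?normal_peak_ge0.
have key (x : R) : x ^+ 2 * normal_pdf 0 1 x <= k * normal_pdf 0 r x.
  rewrite !normal_pdfE ?gt_eqF// /normal_fun subr0.
  rewrite [leRHS]mulrA divfK ?gt_eqF ?normal_peak_gt0 ?gt_eqF//.
  rewrite r2 expr1n.
  have h : x ^+ 2 * expR (- x ^+ 2 / (1 *+ 2)) <= 4 * expR (- x ^+ 2 / (2 *+ 2)).
    rewrite -(ler_pM2r (expR_gt0 (x ^+ 2 / 2))) -!mulrA -!expRD.
    rewrite (_ : - x ^+ 2 / _ + _ = 0); last by field.
    rewrite (_ : - x ^+ 2 / (2 *+ 2) + _ = x ^+ 2 / 4); last by field.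
    by rewrite expR0 mulr1; have := expR_ge1Dx (x ^+ 2 / 4); lra.
  have := ler_wpM2l (normal_peak_ge0 (1 : R)) h.
  by rewrite mulrCA [in X in _ <= X -> _]mulrA [in X in _ <= X -> _](mulrC (normal_peak 1)).
apply: (@le_lt_trans _ _ (\int[leb]_x (k%:E * (normal_pdf 0 r x)%:E))%E).
  apply: ge0_le_integral => //.
  - by move=> x _; rewrite mule_ge0 ?lee_fin ?sqr_ge0 ?normal_pdf_ge0.
  - apply: emeasurable_funM; first exact/measurable_EFinP.
    by apply/measurable_EFinP; exact: measurable_normal_pdf.
  - apply: emeasurable_funM => //.
    by apply/measurable_EFinP; exact: measurable_normal_pdf.
  - by move=> x _; rewrite -!EFinM lee_fin.
rewrite integralZl//; last exact: integrable_normal_pdf.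
by rewrite integral_normal_pdf mule1 ltry.
Qed.

(** Variance of the standard normal law.  The estimates involve it as a constant
    factor only, so it is left unevaluated. *)
Definition kappa : R := fine normal_m2.

Lemma kappa_ge0 : 0 <= kappa.
Proof. by rewrite fine_ge0// integral_ge0// => x _; rewrite lee_fin sqr_ge0. Qed.

Lemma normal_variance (m s : R) : 0 < s ->
  (\int[normal_prob m s]_x ((x - m) ^+ 2)%:E = (kappa * s ^+ 2)%:E)%E.
Proof.
move=> s0.
have -> : (kappa * s ^+ 2)%:E = ((s ^+ 2)%:E * \int[normal_prob 0 1]_x (x ^+ 2)%:E)%E.
  by rewrite mulrC EFinM /kappa fineK ?normal_m2_fin.
rewrite -(@normal_standardize m s (fun x => x ^+ 2) s0 (@exprn_continuous R 2) (fun x => sqr_ge0 x)).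
rewrite -ge0_integralZl//; last 3 first.
- apply/measurable_EFinP/measurable_funX; apply: measurable_funM => //.
  exact: measurable_funB.
- by move=> x _; rewrite lee_fin sqr_ge0.
- by rewrite lee_fin sqr_ge0.
apply: eq_integral => x _; rewrite -EFinM; congr EFin.
by field; rewrite gt_eqF.
Qed.

(** Symmetry of the standard normal density: positive and negative parts have
    equal integrals, which is why the centered mean vanishes. *)
Let integral_funrpos_funrneg :
  (\int[normal_prob (0 : R) 1]_x (Num.max x 0)%:E =
   \int[normal_prob (0 : R) 1]_x (Num.max (- x) 0)%:E)%E.
Proof.
have mM : measurable_fun setT (fun x : R => Num.max x 0) by exact: measurable_maxr.
rewrite !integral_normal_prob//; last 4 first.
- by apply/measurable_EFinP; apply: measurable_maxr.
- by move=> x; rewrite lee_fin le_max lexx orbT.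
- exact/measurable_EFinP.
- by move=> x; rewrite lee_fin le_max lexx orbT.
rewrite -lebesgue_integralN.
- apply: eq_integral => x _; congr (_ * _)%E; congr EFin.
  by rewrite !normal_pdfE ?oner_eq0// /normal_fun !subr0 sqrrN.
- apply: emeasurable_funM; apply/measurable_EFinP => //.
  exact: measurable_normal_pdf.
- by move=> x; rewrite mule_ge0// lee_fin ?normal_pdf_ge0// le_max lexx orbT.
Qed.

Lemma normal_integrable_centered (m s : R) : 0 < s ->
  (normal_prob m s).-integrable setT (fun x => (x - m)%:E).
Proof.
move=> s0; apply/integrableP; split.
  by apply/measurable_EFinP; exact: measurable_funB.
apply: (@le_lt_trans _ _ (\int[normal_prob m s]_x (1 + (x - m) ^+ 2)%:E)%E).
  apply: ge0_le_integral => //.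
  - by apply: measurableT_comp => //; apply/measurable_EFinP; exact: measurable_funB.
  - apply/measurable_EFinP; apply: measurable_funD => //.
    by apply: measurable_funX; exact: measurable_funB.
  - by move=> x _; rewrite lee_fin norm_le_1Dsqr.
under eq_integral do rewrite EFinD.
rewrite ge0_integralD//; last 2 first.
- by move=> x _; rewrite lee_fin sqr_ge0.
- by apply/measurable_EFinP/measurable_funX; exact: measurable_funB.
by rewrite normal_variance// (integral_prob1 (normal_prob m s)) -EFinD ltry.
Qed.

Lemma normal_mean_centered (m s : R) : 0 < s ->
  (\int[normal_prob m s]_x (x - m)%:E = 0)%E.
Proof.
move=> s0; have mB : measurable_fun setT (fun x : R => x - m) by exact: measurable_funB.
have mQ : measurable_fun setT (fun x : R => (x - m) / s) by exact: measurable_funM.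
have maxs (x : R) : Num.max x 0 = s * Num.max (x / s) 0.
  by rewrite maxr_pMr ?mulr0 ?(ltW s0)// mulrC divfK// gt_eqF.
have cmax : continuous (fun x : R => Num.max x 0).
  by move=> x; apply: continuous_max => //; exact: cvg_cst.
have := integrable_fin_num measurableT (normal_integrable_centered m s0).
rewrite integralE.
have pos : (\int[normal_prob m s]_x ((fun x => (x - m)%:E)^\+ x) =
    s%:E * \int[normal_prob (0 : R) 1]_x (Num.max x 0)%:E)%E.
  have p0 (x : R) : 0 <= Num.max x 0 by rewrite le_max lexx orbT.
  rewrite -(@normal_standardize m s (fun x => Num.max x 0) s0 cmax p0).
  have mm : measurable_fun setT (fun x : measurableTypeR R => (Num.max ((x - m) / s) 0)%:E).
    by apply/measurable_EFinP; apply: measurable_maxr.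
  rewrite -(ge0_integralZl (normal_prob m s) measurableT mm); last 2 first.
  - by move=> x _; rewrite lee_fin p0.
  - by rewrite lee_fin ltW.
  by apply: eq_integral => x _; rewrite funeposE -EFin_max (maxs (x - m)) EFinM.
have neg : (\int[normal_prob m s]_x ((fun x => (x - m)%:E)^\- x) =
    s%:E * \int[normal_prob (0 : R) 1]_x (Num.max x 0)%:E)%E.
  rewrite integral_funrpos_funrneg.
  have p0 (x : R) : 0 <= Num.max (- x) 0 by rewrite le_max lexx orbT.
  have cmaxN : continuous (fun x : R => Num.max (- x) 0).
    by move=> x; apply: continuous_max; [exact: opp_continuous | exact: cvg_cst].
  rewrite -(@normal_standardize m s (fun x => Num.max (- x) 0) s0 cmaxN p0).
  have mm : measurable_fun setT (fun x : measurableTypeR R => (Num.max (- ((x - m) / s)) 0)%:E).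
    by apply/measurable_EFinP; apply: measurable_maxr => //; exact: measurableT_comp.
  rewrite -(ge0_integralZl (normal_prob m s) measurableT mm); last 2 first.
  - by move=> x _; rewrite lee_fin p0.
  - by rewrite lee_fin ltW.
  by apply: eq_integral => x _; rewrite funenegE -EFinN -EFin_max (maxs (- (x - m))) mulNr EFinM.
rewrite pos neg; set I := (_ * _)%E; rewrite fin_numB => /andP[fI _].
exact: subee.
Qed.

End NormalMoments.

Section GaussianLawMoments.
Context d (T : measurableType d) (R : realType) (Q : probability T R).
Variables (Z : T -> R) (M v : R).
Hypotheses (mZ : measurable_fun setT Z) (v0 : 0 <= v).
Hypothesis lawZ : forall A : set R, measurable A ->
  Q [set w | A (Z w)] = gaussian_law M v A.

Let Zm : {RV Q >-> measurableTypeR R} :=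
  HB.pack (Z : T -> measurableTypeR R) (isMeasurableFun.Build _ _ _ (measurableTypeR R) Z mZ).

Let Zd : {RV Q >-> R} := HB.pack Z (isMeasurableFun.Build _ _ _ _ Z mZ).

Let law_normal (f : R -> \bar R) : v != 0 ->
  (\int[distribution Q Zm]_x f x = \int[normal_prob M (Num.sqrt v)]_x f x)%E.
Proof.
move=> v_neq0.
apply: (@eq_measure_integral _ _ _ _ (normal_prob M (Num.sqrt v))) => A mA _.
by have := lawZ mA; rewrite /gaussian_law (negbTE v_neq0).
Qed.

Let law_dirac (f : R -> \bar R) : v = 0 ->
  (\int[distribution Q Zd]_x f x = \int[\d_M]_x f x)%E.
Proof.
move=> v_eq0.
apply: eq_measure_integral => A mA _.
by have := lawZ mA; rewrite /gaussian_law v_eq0 eqxx.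
Qed.

(** [gaussian_law] is a point mass or a normal law according to whether [v]
    vanishes; the first two moments follow the same formulas in both cases. *)
Lemma gaussian_variance : (\int[Q]_w ((Z w - M) ^+ 2)%:E = (kappa * v)%:E)%E.
Proof.
have msq : measurable_fun setT (fun x : R => ((x - M) ^+ 2)%:E).
  by apply/measurable_EFinP/measurable_funX; exact: measurable_funB.
have [v_eq0|v_neq0] := eqVneq v 0.
  transitivity (\int[distribution Q Zd]_x ((x - M) ^+ 2)%:E)%E.
    by rewrite ge0_integral_distribution// => x; rewrite lee_fin sqr_ge0.
  by rewrite law_dirac// integral_dirac// diracT mul1e subrr expr0n v_eq0 mulr0.
transitivity (\int[distribution Q Zm]_x ((x - M) ^+ 2)%:E)%E.
  by rewrite ge0_integral_distribution// => x; rewrite lee_fin sqr_ge0.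
have s0 : 0 < Num.sqrt v by rewrite sqrtr_gt0 lt_neqAle eq_sym v_neq0.
by rewrite law_normal// normal_variance// sqr_sqrtr.
Qed.

Lemma gaussian_integrable_centered : Q.-integrable setT (fun w => (Z w - M)%:E).
Proof.
have mB : measurable_fun setT (fun w => Z w - M) by exact: measurable_funB.
apply/integrableP; split; first exact/measurable_EFinP.
apply: (@le_lt_trans _ _ (\int[Q]_x (1 + (Z x - M) ^+ 2)%:E)%E).
  apply: ge0_le_integral => //.
  - by apply: measurableT_comp => //; apply/measurable_EFinP.
  - by apply/measurable_EFinP; apply: measurable_funD => //; exact: measurable_funX.
  - by move=> x _; rewrite lee_fin norm_le_1Dsqr.
under eq_integral do rewrite EFinD.
rewrite ge0_integralD//; last 2 first.
- by move=> x _; rewrite lee_fin sqr_ge0.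
- by apply/measurable_EFinP/measurable_funX.
by rewrite gaussian_variance// integral_prob1 -EFinD ltry.
Qed.

Lemma gaussian_mean_centered : (\int[Q]_w (Z w - M)%:E = 0)%E.
Proof.
have mE : measurable_fun setT (fun x : R => (x - M)%:E).
  by apply/measurable_EFinP; exact: measurable_funB.
have [v_eq0|v_neq0] := eqVneq v 0.
  transitivity (\int[distribution Q Zd]_x (x - M)%:E)%E.
    by rewrite integral_distribution//; exact: gaussian_integrable_centered.
  by rewrite law_dirac// integral_dirac// diracT mul1e subrr.
transitivity (\int[distribution Q Zm]_x (x - M)%:E)%E.
  by rewrite integral_distribution//; exact: gaussian_integrable_centered.
by rewrite law_normal// normal_mean_centered// sqrtr_gt0 lt_neqAle eq_sym v_neq0.
Qed.

End GaussianLawMoments.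

(** * Integrals of random paths *)

Section RealFubini.
Context d1 d2 (S : measurableType d1) (T : measurableType d2) (R : realType).
Variables (U : probability S R) (Q : probability T R) (f : S * T -> R).
Hypothesis If : (U \x Q)%E.-integrable setT (EFin \o f).

Let inner1 : ae_eq U setT (fun x => (\int[Q]_y f (x, y))%:E)
  (fun x => \int[Q]_y (f (x, y))%:E)%E.
Proof.
apply: filterS (ae_integrable1 If) => x Ix _.
by rewrite /Rintegral fineK//; exact: (integrable_fin_num measurableT Ix).
Qed.

Let inner2 : ae_eq Q setT (fun y => (\int[U]_x f (x, y))%:E)
  (fun y => \int[U]_x (f (x, y))%:E)%E.
Proof.
apply: filterS (ae_integrable2 If) => y Iy _.
by rewrite /Rintegral fineK//; exact: (integrable_fin_num measurableT Iy).
Qed.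

Let mf : measurable_fun setT f.
Proof. by apply/measurable_EFinP; case/integrableP : If. Qed.

Let minner1 : measurable_fun setT (fun x => (\int[Q]_y f (x, y))%:E).
Proof.
apply/measurable_EFinP; rewrite /Rintegral.
apply: (measurableT_comp (f := fine)) => //.
exact: (measurable_fubini_F If).
Qed.

Let minner2 : measurable_fun setT (fun y => (\int[U]_x f (x, y))%:E).
Proof.
apply/measurable_EFinP; rewrite /Rintegral.
apply: (measurableT_comp (f := fine)) => //.
exact: (measurable_fubini_G If).
Qed.

Lemma Rfubini :
  \int[U]_x (\int[Q]_y f (x, y)) = \int[Q]_y (\int[U]_x f (x, y)).
Proof.
rewrite {1}/Rintegral [RHS]/Rintegral; congr fine.
rewrite (ae_eq_integral _ _ _ _ _ inner1)//; last exact: (measurable_fubini_F If).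
rewrite [RHS](ae_eq_integral _ _ _ _ _ inner2)//; last exact: (measurable_fubini_G If).
exact: (Fubini If).
Qed.

End RealFubini.

Section IntegratedProcess.
Context d1 d2 (S : measurableType d1) (T : measurableType d2) (R : realType).
Variables (U : probability S R) (Q : probability T R) (g : S * T -> R) (M : R).
Hypothesis mg : measurable_fun setT g.
Hypothesis gM : forall s, (\int[Q]_w (g (s, w) ^+ 2)%:E <= M%:E)%E.

Let mgs w : measurable_fun setT (fun s => g (s, w)).
Proof. exact: measurable_fun_pair1. Qed.

Let mgw s : measurable_fun setT (fun w => g (s, w)).
Proof. exact: measurable_fun_pair2. Qed.

(** Component of a random path along a test function that is absorbed in [g].
    A path whose integral is infinite gets the value 0. *)
Definition pathint w : R := \int[U]_s g (s, w).
Local Notation Z := pathint.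

Let m2 : measurable_fun setT (fun p => (g p ^+ 2)%:E).
Proof. by apply/measurable_EFinP; exact: measurable_funX. Qed.

Let sq12 : (\int[U]_s \int[Q]_w (g (s, w) ^+ 2)%:E <= M%:E)%E.
Proof.
apply: (@le_trans _ _ (\int[U]_s M%:E)%E).
  apply: ge0_le_integral => //.
  - by move=> s _; apply: integral_ge0 => w _; rewrite lee_fin sqr_ge0.
  - apply: (measurable_fun_fubini_tonelli_F _ m2) => p.
    by rewrite lee_fin sqr_ge0.
by rewrite integral_cst//= (probability_setT U) mule1.
Qed.

Let sq21 : (\int[Q]_w \int[U]_s (g (s, w) ^+ 2)%:E <= M%:E)%E.
Proof.
rewrite -(@fubini_tonelli _ _ _ _ _ U Q (fun p => (g p ^+ 2)%:E))//.
by move=> p; rewrite lee_fin sqr_ge0.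
Qed.

Definition pathsq w : \bar R := (\int[U]_s (g (s, w) ^+ 2)%:E)%E.

Let mpathsq : measurable_fun setT pathsq.
Proof.
by apply: (measurable_fun_fubini_tonelli_G _ m2) => p; rewrite lee_fin sqr_ge0.
Qed.

Let pathsq_ge0 w : (0 <= pathsq w)%E.
Proof. by apply: integral_ge0 => s _; rewrite lee_fin sqr_ge0. Qed.

(** By Tonelli the expectation of [pathsq] is at most [M]. *)
Lemma pathsq_null : measurable [set w | pathsq w = +oo%E] /\
  Q [set w | pathsq w = +oo%E] = 0%E.
Proof.
have mN : measurable [set w | pathsq w = +oo%E].
  by rewrite -[X in measurable X]setTI; exact: (mpathsq measurableT (emeasurable_set1 +oo%E)).
split => //.
have Ip : Q.-integrable setT pathsq.
  apply/integrableP; split => //.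
  under eq_integral do rewrite gee0_abs//.
  by rewrite (le_lt_trans sq21)// ltry.
have [N [mN' N0 sub]] := integrable_ae measurableT Ip.
apply/eqP; rewrite eq_le measure_ge0 andbT -N0 le_measure ?inE// => w /= wo.
by apply: sub => /= /(_ Logic.I); rewrite wo.
Qed.

Lemma sq_integrable_integrable w : (pathsq w < +oo)%E ->
  U.-integrable setT (fun s => (g (s, w))%:E).
Proof.
move=> fin; apply/integrableP; split; first exact/measurable_EFinP.
apply: (@le_lt_trans _ _ (\int[U]_s (1 + (g (s, w)) ^+ 2)%:E)%E).
  apply: ge0_le_integral => //.
  - by apply: measurableT_comp => //; exact/measurable_EFinP.
  - by apply/measurable_EFinP; apply: measurable_funD => //; exact: measurable_funX.
  - move=> s _; rewrite lee_fin ler_norml; apply/andP; split; nra.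
under eq_integral do rewrite EFinD.
rewrite ge0_integralD//; last 2 first.
- by move=> s _; rewrite lee_fin sqr_ge0.
- by apply/measurable_EFinP/measurable_funX.
by rewrite integral_cst// mul1e lte_add_pinfty// (le_lt_trans (probability_le1 _ _))// ltry.
Qed.

(** The variance of [s |-> g (s, w)] under [U] is nonnegative. *)
Lemma pathint_sqr_le w : ((Z w ^+ 2)%:E <= pathsq w)%E.
Proof.
have [->|/eqP fin] := eqVneq (pathsq w) +oo%E; first exact: leey.
have {}fin : (pathsq w < +oo)%E by rewrite ltey; exact/eqP.
have I1 := sq_integrable_integrable fin.
have I2 : U.-integrable setT (fun s => (g (s, w) ^+ 2)%:E).
  apply/integrableP; split; first by apply/measurable_EFinP; exact: measurable_funX.
  by under eq_integral do rewrite gee0_abs ?lee_fin ?sqr_ge0//.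
have fE : pathsq w = (\int[U]_s (g (s, w) ^+ 2))%:E.
  by rewrite /Rintegral fineK//; exact: (integrable_fin_num measurableT I2).
rewrite fE lee_fin.
have : 0 <= \int[U]_s ((g (s, w) - Z w) ^+ 2) by apply: Rintegral_ge0 => s _; exact: sqr_ge0.
have -> : \int[U]_s ((g (s, w) - Z w) ^+ 2) =
  \int[U]_s (g (s, w) ^+ 2 - 2 * Z w * g (s, w) + Z w ^+ 2).
  by apply: eq_Rintegral => s _; ring.
have I3 : U.-integrable setT (EFin \o (fun s => 2 * Z w * g (s, w))).
  by have := integrableZl measurableT (2 * Z w) I1.
have I4 : U.-integrable setT (EFin \o (fun s => g (s, w) ^+ 2 - 2 * Z w * g (s, w))).
  exact: (integrableB measurableT I2 I3).
rewrite RintegralD//; last exact: finite_measure_integrable_cst.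
rewrite RintegralB// RintegralZl// Rintegral_cst//.
have -> : fine (U setT) = 1 by rewrite (probability_setT U).
rewrite -/(Z w); nra.
Qed.

Let Ig : (U \x Q)%E.-integrable setT (EFin \o g).
Proof.
apply/integrable12ltyP; first exact/measurable_EFinP.
apply: (@le_lt_trans _ _ (\int[U]_s (1 + M)%:E)%E).
  apply: ge0_le_integral => //.
  - by move=> s _; apply: integral_ge0.
  - apply: (measurable_fun_fubini_tonelli_F (fun p => `|(g p)%:E|%E)) => //.
    by apply: measurableT_comp => //; exact/measurable_EFinP.
  move=> s _.
  apply: (@le_trans _ _ (\int[Q]_w (1 + (g (s, w)) ^+ 2)%:E)%E).
    apply: ge0_le_integral => //.
    + by apply: measurableT_comp => //; exact/measurable_EFinP.
    + by apply/measurable_EFinP; apply: measurable_funD => //; exact: measurable_funX.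
    + move=> w _; rewrite lee_fin ler_norml; apply/andP; split; nra.
  under eq_integral do rewrite EFinD.
  rewrite ge0_integralD//; last 2 first.
  - by move=> w _; rewrite lee_fin sqr_ge0.
  - by apply/measurable_EFinP/measurable_funX.
  by rewrite integral_cst// mul1e EFinD leeD// probability_le1.
rewrite integral_cst//= (probability_setT U) mule1 ltry//.
Qed.

Lemma measurable_pathint : measurable_fun setT Z.
Proof.
rewrite /pathint /Rintegral.
apply: (measurableT_comp (f := fine)) => //.
exact: (measurable_fubini_G Ig).
Qed.

Let sqZ : (\int[Q]_w (Z w ^+ 2)%:E <= M%:E)%E.
Proof.
apply: le_trans sq21; apply: ge0_le_integral => //.
- by move=> w _; rewrite lee_fin sqr_ge0.
- by apply/measurable_EFinP/measurable_funX; exact: measurable_pathint.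
- by move=> w _; exact: pathint_sqr_le.
Qed.

Let M0 : 0 <= M.
Proof.
rewrite -lee_fin; apply: le_trans sqZ; apply: integral_ge0 => w _.
by rewrite lee_fin sqr_ge0.
Qed.

Let measurable_snd_comp (F : T -> R) : measurable_fun setT F ->
  measurable_fun setT (fun p : S * T => F p.2).
Proof. by move=> mF; exact: measurableT_comp. Qed.

Let Imul (F : T -> R) : measurable_fun setT F ->
  (\int[Q]_w (F w ^+ 2)%:E <= M%:E)%E ->
  (U \x Q)%E.-integrable setT (EFin \o (fun p => F p.2 * g p)).
Proof.
move=> mF FM.
have mFg : measurable_fun setT (fun p : S * T => F p.2 * g p).
  by apply: measurable_funM => //; exact: measurable_snd_comp.
apply/integrable12ltyP; first exact/measurable_EFinP.
apply: (@le_lt_trans _ _ (\int[U]_s (M + M)%:E)%E).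
  apply: ge0_le_integral => //.
  - by move=> s _; apply: integral_ge0.
  - apply: (measurable_fun_fubini_tonelli_F (fun p => `|(F p.2 * g p)%:E|%E)) => //.
    by apply: measurableT_comp => //; exact/measurable_EFinP.
  move=> s _.
  apply: (@le_trans _ _ (\int[Q]_w (F w ^+ 2 + (g (s, w)) ^+ 2)%:E)%E).
    apply: ge0_le_integral => //.
    + by apply: measurableT_comp => //; apply/measurable_EFinP; exact: measurable_funM.
    + by apply/measurable_EFinP; apply: measurable_funD => //; exact: measurable_funX.
    + move=> w _; rewrite lee_fin ler_norml; apply/andP; split; nra.
  under eq_integral do rewrite EFinD.
  rewrite ge0_integralD//; last 4 first.
  - by move=> w _; rewrite lee_fin sqr_ge0.
  - by apply/measurable_EFinP/measurable_funX.
  - by move=> w _; rewrite lee_fin sqr_ge0.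
  - by apply/measurable_EFinP/measurable_funX.
  by rewrite EFinD leeD// gM.
rewrite integral_cst//= (probability_setT U) mule1 ltry//.
Qed.

Let RintegralZl_path (c : R) w : (c = 0 \/ U.-integrable setT (fun s => (g (s, w))%:E)) ->
  \int[U]_s (c * g (s, w)) = c * Z w.
Proof.
case=> [->|I1]; last by rewrite RintegralZl.
by under eq_Rintegral do rewrite mul0r; rewrite Rintegral_cst// !mul0r.
Qed.

(** Either way [Z w * g (., w)] has the integral [Z w ^+ 2]. *)
Let path_dichotomy w : Z w = 0 \/ U.-integrable setT (fun s => (g (s, w))%:E).
Proof.
have [fin|nfin] := boolP (\int[U]_s (g (s, w))%:E \is a fin_num)%E; last first.
  by left; rewrite /pathint /Rintegral; move: nfin; case: integral.
right; apply/integrableP; split; first exact/measurable_EFinP.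
move: fin; rewrite integralE fin_numB => /andP[f1 f2].
apply/abse_integralP => //; first exact/measurable_EFinP.
by rewrite integralE -ge0_fin_numE// abse_fin_num fin_numB f1.
Qed.

(** Fubini twice: [E Z^2] is the integral over [s] of [E (Z g_s)], and
    [E (Z g_s)] the integral over [s'] of [E (g_s g_s')].  Since only almost every
    path is integrable, the inner step holds almost everywhere. *)
Lemma pathint_second_moment (Gam : S -> S -> R) :
  (forall s s', \int[Q]_w (g (s, w) * g (s', w)) = Gam s s') ->
  \int[Q]_w (Z w ^+ 2) = \int[U]_s (\int[U]_s' Gam s s').
Proof.
move=> gG.
have mZ := measurable_pathint.
transitivity (\int[Q]_w (\int[U]_s (Z w * g (s, w)))).
  by apply: eq_Rintegral => w _; rewrite RintegralZl_path ?expr2//; exact: path_dichotomy.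
rewrite -(Rfubini (Imul mZ sqZ)); apply: eq_Rintegral => s _ /=.
transitivity (\int[Q]_w (\int[U]_s' (g (s, w) * g (s', w)))).
  have := pathsq_null => -[mN N0].
  rewrite /Rintegral; congr fine; apply: ae_eq_integral => //.
  - by apply/measurable_EFinP; exact: measurable_funM.
  - apply/measurable_EFinP.
    apply: (measurableT_comp (f := fine)) => //.
    exact: (measurable_fubini_G (Imul (mgw s) (gM s))).
  exists [set w | pathsq w = +oo%E]; split => // w /= nw.
  apply: contrapT => h; apply: nw => _; congr EFin.
  rewrite -/(Rintegral _ _ _) RintegralZl_path; first by rewrite mulrC.
  by right; apply: sq_integrable_integrable; rewrite ltey; exact/eqP.
rewrite -(Rfubini (Imul (mgw s) (gM s))).
by apply: eq_Rintegral => s' _; rewrite gG.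
Qed.

Lemma pathint_sqr_integrable : Q.-integrable setT (fun w => (Z w ^+ 2)%:E).
Proof.
apply/integrableP; split; first by apply/measurable_EFinP/measurable_funX; exact: measurable_pathint.
under eq_integral do rewrite gee0_abs ?lee_fin ?sqr_ge0//.
by rewrite (le_lt_trans sqZ)// ltry.
Qed.

End IntegratedProcess.

(** * One random variable against the others *)

Section IndependentProduct.
Context d (T : measurableType d) (R : realType) (P : probability T R).
Variables F Y : T -> R.
Hypotheses (mF : measurable_fun setT F) (mY : measurable_fun setT Y).
Hypothesis indep : forall A B : set R, measurable A -> measurable B ->
  P (F @^-1` A `&` Y @^-1` B) = (P (F @^-1` A) * P (Y @^-1` B))%E.
Hypotheses (iF : P.-integrable setT (EFin \o F))
           (iY : P.-integrable setT (EFin \o Y)).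

Let Fm : {RV P >-> R} := HB.pack F (isMeasurableFun.Build _ _ _ _ F mF).
Let Ym : {RV P >-> R} := HB.pack Y (isMeasurableFun.Build _ _ _ _ Y mY).
Let Z w := (F w, Y w).
Let mZ : measurable_fun setT Z. Proof. exact: measurable_fun_pair. Qed.
Let Zm : {RV P >-> (R * R)%type} := HB.pack Z (isMeasurableFun.Build _ _ _ _ Z mZ).
Let m1 := distribution P Fm.
Let m2 := distribution P Ym.

Let jointE X : measurable X -> (m1 \x m2)%E X = distribution P Zm X.
Proof. by apply: product_measure_unique => A B mA mB; exact: indep. Qed.

Let id1 : m1.-integrable setT EFin.
Proof.
apply/integrableP; split; first exact/measurable_EFinP.
rewrite ge0_integral_distribution//.
  by case/integrableP : iF.
by apply: measurableT_comp => //; exact/measurable_EFinP.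
Qed.

Let id2 : m2.-integrable setT EFin.
Proof.
apply/integrableP; split; first exact/measurable_EFinP.
rewrite ge0_integral_distribution//.
  by case/integrableP : iY.
by apply: measurableT_comp => //; exact/measurable_EFinP.
Qed.

Let f (p : R * R) : \bar R := (p.1 * p.2)%:E.

Let mf : measurable_fun setT f.
Proof. by apply/measurable_EFinP; exact: measurable_funM. Qed.

Let fin2 : (\int[m2]_y `|y%:E|)%E \is a fin_num.
Proof.
rewrite ge0_fin_numE; last exact: integral_ge0.
by case/integrableP : id2.
Qed.

Let ifprod : (m1 \x m2)%E.-integrable setT f.
Proof.
apply/integrable12ltyP => //.
under eq_integral.
  move=> x _; under eq_integral do rewrite /f/= normrM EFinM.
  rewrite ge0_integralZl//; last first.
    by apply: measurableT_comp => //; exact/measurable_EFinP.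
  over.
rewrite /= -(fineK fin2) ge0_integralZr//=; last 2 first.
- by apply: measurableT_comp => //; exact/measurable_EFinP.
- by rewrite lee_fin fine_ge0// integral_ge0.
rewrite lte_mul_pinfty// ?integral_ge0//; last by rewrite fineK// -ge0_fin_numE// integral_ge0.
rewrite ge0_fin_numE ?integral_ge0//.
by case/integrableP : id1.
Qed.

Let integrable_Z : (distribution P Zm).-integrable setT f.
Proof.
apply/integrableP; split => //.
have -> : (\int[distribution P Zm]_x `|f x| = \int[m1 \x m2]_x `|f x|)%E.
  by apply: eq_measure_integral => A mA _; rewrite [RHS]jointE.
by case/integrableP : ifprod.
Qed.

Lemma indep_integrable_mul : P.-integrable setT (EFin \o (fun w => F w * Y w)).
Proof.
apply/integrableP; split; first by apply/measurable_EFinP; exact: measurable_funM.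
case/integrableP : integrable_Z => _.
rewrite ge0_integral_distribution//.
by apply: measurableT_comp => //.
Qed.

(** The joint law is the product of the laws, by uniqueness of product measures;
    then Fubini. *)
Lemma indep_Rintegral_mul :
  \int[P]_w (F w * Y w) = (\int[P]_w F w) * (\int[P]_w Y w).
Proof.
rewrite /Rintegral.
have -> : (\int[P]_w (F w * Y w)%:E = \int[distribution P Zm]_p f p)%E.
  by rewrite integral_distribution//; exact: indep_integrable_mul.
have -> : (\int[distribution P Zm]_p f p = \int[m1 \x m2]_p f p)%E.
  by apply: eq_measure_integral => A mA _; rewrite [RHS]jointE.
rewrite -integral12_prod_meas1// /fubini_F /f /=.
under eq_integral do under eq_integral do rewrite EFinM.
have e2 : (\int[m2]_y y%:E = \int[P]_w (Y w)%:E)%E by rewrite integral_distribution.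
have e1 : (\int[m1]_y y%:E = \int[P]_w (F w)%:E)%E by rewrite integral_distribution.
have f2 := integrable_fin_num measurableT id2.
have f1 := integrable_fin_num measurableT id1.
under eq_integral do rewrite integralZl//.
transitivity (fine ((\int[m1]_x x%:E) * (\int[m2]_y y%:E))%E).
  by congr fine; rewrite -(fineK f2) integralZr.
by rewrite fineM// e1 e2.
Qed.

End IndependentProduct.

Section OneAgainstTheRest.
Context d (T : measurableType d) (R : realType) (P : probability T R).
Variables (I : finType) (V : I -> {RV P >-> R}).
Hypothesis indV : mutually_independent P (fun i => sigma_RV (V i)).

(** Generates the sigma-algebra of all the variables but the one of index [u]. *)
Definition rest (u : I) : set (set T) :=
  [set A | exists v (S : set R), [/\ v != u, measurable S & A = V v @^-1` S]].

Let cylinder (u : I) : set (set T) :=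
  [set A | exists S : I -> set R, [/\ forall v, measurable (S v), S u = setT &
                        A = \bigcap_(v in [set: I]) (V v @^-1` S v)]].

Let indV' (S : I -> set R) : (forall v, measurable (S v)) ->
  P (\bigcap_(v in [set: I]) (V v @^-1` S v)) = (\prod_v P (V v @^-1` S v))%E.
Proof.
move=> mS; apply: (indV (E := fun v => V v @^-1` S v)) => v.
by exists (S v) => //; rewrite setTI.
Qed.

Let cylinderI u : setI_closed (cylinder u).
Proof.
move=> A B [S [mS Su ->]] [S' [mS' Su' ->]].
exists (fun v => S v `&` S' v); split; first by move=> v; exact: measurableI.
  by rewrite Su Su' setTI.
by rewrite -bigcapI; apply: eq_bigcapr => v _; rewrite preimage_setI.
Qed.

Let cylinder_measurable u : cylinder u `<=` measurable.
Proof.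
move=> A [S [mS _ ->]]; apply: fin_bigcap_measurable => // v _.
by rewrite -[X in measurable X]setTI; exact: measurable_funP.
Qed.

Let rest_cylinder u : rest u `<=` cylinder u.
Proof.
move=> A [v [S [vu mS ->]]].
exists (fun v' => if v' == v then S else setT); split.
- by move=> v'; case: ifP.
- by rewrite eq_sym (negbTE vu).
apply/seteqP; split => [w Sw v' _ /=|w /(_ v Logic.I)]; last by rewrite /= eqxx.
by case: eqP => // ->.
Qed.

(** Intersections of events on single variables form a pi-system, on which
    independence is the product rule; two finite measures that agree on it
    agree on the sigma-algebra it generates. *)
Lemma rest_indep u A S : <<s rest u >> A -> measurable S ->
  P (A `&` V u @^-1` S) = (P A * P (V u @^-1` S))%E.
Proof.
move=> rA mS.
have mB : measurable (V u @^-1` S).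
  by rewrite -[X in measurable X]setTI; exact: measurable_funP.
have k0 : 0 <= fine (P (V u @^-1` S)) by rewrite fine_ge0.
pose m1 := mrestr P mB.
pose m2 := mscale (NngNum k0) P.
have cA : <<s cylinder u >> A by apply: sub_smallest2r rA => //; exact: rest_cylinder.
have m2E C : m2 C = (P C * P (V u @^-1` S))%E.
  by rewrite /m2 /mscale/= fineK ?fin_num_measure// muleC.
suff: m1 A = m2 A by rewrite m2E.
apply: (@g_sigma_algebra_measure_unique _ R T (cylinder u)
  (@cylinder_measurable u) (fun=> setT) _ _ m1 m2 (@cylinderI u)) => //.
- move=> _; exists (fun=> setT); split => //.
  by apply/seteqP; split.
- by rewrite bigcup_const//; exists 0%N.
- move=> C [S' [mS' S'u ->]].
  pose S'' v := if v == u then S else S' v.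
  rewrite [RHS]m2E.
  change (P ((\bigcap_(v in [set: I]) V v @^-1` S' v) `&` V u @^-1` S) =
    P (\bigcap_(v in [set: I]) V v @^-1` S' v) * P (V u @^-1` S))%E.
  have -> : \bigcap_(v in [set: I]) V v @^-1` S' v `&` V u @^-1` S =
            \bigcap_(v in [set: I]) V v @^-1` S'' v.
    apply/seteqP; split => [w [h hS] v _|w h]; rewrite /S''.
      by have [->//|vu] := eqVneq v u; exact: h.
    split => [v _|]; last by have := h u Logic.I; rewrite /S'' eqxx.
    have := h v Logic.I; rewrite /S''; have [->|//] := eqVneq v u.
    by rewrite /= S'u.
  rewrite !indV'//; last by move=> v; rewrite /S''; case: ifP.
  rewrite (bigD1 u)//= [in RHS](bigD1 u)//= S'u preimage_setT probability_setT mul1e.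
  rewrite /S'' eqxx muleC; congr (_ * _)%E.
  by apply: eq_bigr => v /negbTE ->.
- move=> _; change (P ([set: T] `&` V u @^-1` S) < +oo)%E.
  by rewrite setTI (le_lt_trans (probability_le1 _ _))// ltry.
Qed.

Lemma rest_measurable u A : <<s rest u >> A -> measurable A.
Proof.
move=> rA; apply: (smallest_sub (@sigma_algebra_measurable _ T) _ rA).
by move=> B /rest_cylinder; exact: cylinder_measurable.
Qed.

Lemma rest_measurable_fun u (F : g_sigma_algebraType (rest u) -> R) :
  measurable_fun setT F -> measurable_fun setT (F : T -> R).
Proof. by move=> mF mT A mA; apply: (@rest_measurable u); exact: mF. Qed.

Lemma rest_measurable_RV u v : v != u ->
  measurable_fun setT (V v : g_sigma_algebraType (rest u) -> R).
Proof.
move=> vu _ A mA; rewrite setTI; apply: sub_sigma_algebra.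
by exists v, A.
Qed.

(** Taking [F] measurable for the sigma-algebra of the other variables lets it
    depend on all of them at once, as ridge weights depend on a whole design. *)
Lemma rest_expect u (F : g_sigma_algebraType (rest u) -> R) (g : R -> R) :
  measurable_fun setT F -> measurable_fun setT g ->
  P.-integrable setT (EFin \o (F : T -> R)) ->
  P.-integrable setT (EFin \o (g \o V u)) ->
  P.-integrable setT (EFin \o (fun w : T => F w * g (V u w))) /\
  \int[P]_w (F w * g (V u w)) = (\int[P]_w F w) * (\int[P]_w g (V u w)).
Proof.
move=> mF mg iF ig.
have mF' := rest_measurable_fun mF.
have mY : measurable_fun setT (g \o V u) by exact: measurableT_comp.
have ind (A B : set R) : measurable A -> measurable B ->
  P ((F : T -> R) @^-1` A `&` (g \o V u) @^-1` B) =
  (P ((F : T -> R) @^-1` A) * P ((g \o V u) @^-1` B))%E.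
  move=> mA mB; rewrite comp_preimage; apply: rest_indep.
    by have := mF measurableT A mA; rewrite setTI.
  by rewrite -[X in measurable X]setTI; exact: mg.
split; first exact: (indep_integrable_mul mF' mY ind iF ig).
exact: (indep_Rintegral_mul mF' mY ind iF ig).
Qed.

End OneAgainstTheRest.

(** * Basis, kernel and truth on the unit interval *)

Section UnitInterval.
Context {R : realType}.
Local Notation leb := (@lebesgue_measure R).
Local Notation I01 := (`[0%R : R, 1%R]%classic).

(** Integrals over the unit interval become expectations of functions extended
    by 0. *)
Definition unif : probability (measurableTypeR R) R := uniform_prob (@ltr01 R).

Lemma integral_unif_ge0 (f : R -> \bar R) : measurable_fun I01 f ->
  (forall x, 0 <= f x)%E ->
  (\int[unif]_x (f \_ I01) x = \int[leb]_(x in I01) f x)%E.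
Proof.
move=> mf f0.
have mr : measurable_fun setT (f \_ I01) by apply/(measurable_restrictT _ _).1.
rewrite integral_uniform//; last by move=> x; rewrite patchE; case: ifP.
rewrite subr0 invr1 mul1e; apply: eq_integral => x xI.
by rewrite patchE xI.
Qed.

Lemma sqnormL2E (f : R -> R) : measurable_fun I01 f ->
  sqnormL2 f = (\int[unif]_x (((f \_ I01) x) ^+ 2)%:E)%E.
Proof.
move=> mf; rewrite /sqnormL2 -(integral_unif_ge0 (f := fun x => (f x ^+ 2)%:E)).
- by apply: eq_integral => x _; rewrite !patchE; case: ifP => //; rewrite expr0n.
- by apply/measurable_EFinP; exact: measurable_funX.
- by move=> x; rewrite lee_fin sqr_ge0.
Qed.

Lemma innerL2E (f g : R -> R) : measurable_fun I01 f -> measurable_fun I01 g ->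
  innerL2 f g = \int[unif]_x ((f \_ I01) x * (g \_ I01) x).
Proof.
move=> mf mg; rewrite /innerL2 /Rintegral; congr fine.
have mfg : measurable_fun I01 (fun x => (f x * g x)%:E).
  by apply/measurable_EFinP; exact: measurable_funM.
rewrite integralE -(integral_unif_ge0 (measurable_funepos mfg))//.
rewrite -(integral_unif_ge0 (measurable_funeneg mfg))// [RHS]integralE.
congr (_ - _)%E; apply: eq_integral => x _; rewrite !patchE.
  rewrite !funeposE !patchE; case: ifP => //; rewrite mul0r //.
  by move=> _; rewrite maxxx.
rewrite !funenegE !patchE; case: ifP => //; rewrite mul0r //.
by move=> _; rewrite oppe0 maxxx.
Qed.

End UnitInterval.

Section Basis.
Context {R : realType}.
Local Notation I01 := (`[0%R : R, 1%R]%classic).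
Variables (psi : nat -> R -> R) (Cpsi : R).
Hypothesis onb : orthonormal_basis psi.
Hypothesis psiC : forall j (t : R), (0 < j)%N -> t \in `[0, 1] -> `|psi j t| <= Cpsi.

(** Extension by 0: nothing is known of [psi] outside the unit interval. *)
Definition phi j : measurableTypeR R -> R := psi j \_ I01.

Lemma phiE j (t : R) : t \in `[0, 1] -> phi j t = psi j t.
Proof. by move=> t01; rewrite /phi patchE ifT// inE. Qed.

Lemma phi_out j (t : R) : t \notin `[0, 1] -> phi j t = 0.
Proof. by move=> t01; rewrite /phi patchE ifF//; apply/negbTE; rewrite notin_setE; exact/negP. Qed.

Lemma measurable_phi j : (0 < j)%N -> measurable_fun setT (phi j).
Proof.
move=> j0; have [/(_ j j0)[mpsi _] _ _] := onb.
exact/(measurable_restrictT _ _).1.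
Qed.

Lemma phi_le j t : (0 < j)%N -> `|phi j t| <= Cpsi.
Proof.
move=> j0; have [t01|t01] := boolP (t \in `[0, 1]); first by rewrite phiE// psiC.
rewrite phi_out// normr0 (le_trans (normr_ge0 (psi j 0)))// psiC//.
by rewrite in_itv/= lexx ler01.
Qed.

Lemma phi_ortho i j : (0 < i)%N -> (0 < j)%N ->
  \int[unif]_x (phi i x * phi j x) = (i == j)%:R.
Proof.
move=> i0 j0; have [L2 ortho _] := onb.
by rewrite -ortho// innerL2E//; [have [] := L2 i i0 | have [] := L2 j j0].
Qed.

Lemma fseries_out c (t : R) : t \notin `[0, 1] -> fseries phi c t = 0.
Proof.
move=> t01; rewrite /fseries (_ : (fun _ => _) = fun=> 0) ?lim_cst//.
by apply/funext => J; rewrite big1// => j _; rewrite phi_out ?mulr0.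
Qed.

Lemma fseries_patch c : fseries phi c \_ I01 = fseries phi c.
Proof.
apply/funext => t; rewrite patchE; case: ifPn => // t01; rewrite fseries_out//.
by apply/negP => h; move/negP: t01; apply; rewrite inE.
Qed.

End Basis.

Section Kernel.
Context {R : realType}.
Variables (beta : R) (K : R -> R -> R) (mu : nat -> R) (psi : nat -> R -> R) (Cpsi C : R).
Hypothesis beta2 : 2 <= beta.
Hypothesis onb : orthonormal_basis psi.
Hypothesis Kexp : kernel_expansion K mu psi.
Hypothesis psiC : forall j (t : R), (0 < j)%N -> t \in `[0, 1] -> `|psi j t| <= Cpsi.
Hypothesis C0 : 0 < C.
Hypothesis muC : forall j, (0 < j)%N ->
     C^-1 * j%:R `^ (- 1 - 2 * beta) <= mu j <= C * j%:R `^ (- 1 - 2 * beta).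

Lemma mu_gt0 j : (0 < j)%N -> 0 < mu j.
Proof.
move=> j0; have /andP[h _] := muC j0; apply: lt_le_trans h.
by rewrite mulr_gt0 ?invr_gt0// powR_gt0 ?ltr0n.
Qed.

Lemma Cpsi_ge0 : 0 <= Cpsi.
Proof.
apply: le_trans (@psiC 1%N 0 isT _); first exact: normr_ge0.
by rewrite in_itv/= lexx ler01.
Qed.

Lemma mu_summable : exists2 S, 0 <= S & forall J, \sum_(1 <= j < J) mu j <= S.
Proof.
have b0 : 0 < 2 * beta by have := beta2; lra.
exists (C * (1 + 2 `^ (2 * beta) / (2 * beta) * 2%:R `^ (- (2 * beta)))).
  by rewrite mulr_ge0 ?addr_ge0 ?mulr_ge0 ?invr_ge0 ?powR_ge0 ?ltW.
move=> J; apply: (@le_trans _ _ (\sum_(1 <= j < J) C * j%:R `^ (- 1 - 2 * beta))).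
  by apply: ler_sum_nat => j /andP[j0 _]; have /andP[] := muC j0.
rewrite -mulr_sumr ler_pM2l//.
have [J1|J1] := leqP J 1.
  by rewrite big_geq// addr_ge0 ?mulr_ge0 ?invr_ge0 ?powR_ge0 ?ltW.
rewrite big_ltn// powR1 lerD2l; exact: powR_tail_sum.
Qed.

Lemma mupsi_summable S t : (forall J, \sum_(1 <= j < J) mu j <= S) ->
  t \in `[0, 1] -> forall J, \sum_(1 <= j < J) `|mu j * psi j t| <= S * Cpsi.
Proof.
move=> muS t01 J.
apply: (@le_trans _ _ (\sum_(1 <= j < J) mu j * Cpsi)).
  apply: ler_sum_nat => j /andP[j0 _].
  by rewrite normrM gtr0_norm ?mu_gt0// ler_pM2l ?mu_gt0// psiC.
by rewrite -mulr_suml ler_wpM2r ?Cpsi_ge0.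
Qed.

(** Kernel section at [t].  The series agrees with [K] on the unit interval, is
    bounded and measurable on the line, and displays the coefficients. *)
Definition kf (t : R) : measurableTypeR R -> R := fseries (phi psi) (fun j => mu j * psi j t).

Lemma kfE (s t : R) : s \in `[0, 1] -> t \in `[0, 1] -> kf t s = K s t.
Proof.
move=> s01 t01; apply/cvg_lim => //.
rewrite (_ : (fun _ => _) = fun J => \sum_(1 <= j < J) mu j * psi j s * psi j t).
  exact: Kexp.
by apply/funext => J; apply: eq_bigr => j _; rewrite phiE//; ring.
Qed.

Lemma kf_bounded t : t \in `[0, 1] -> bounded_mfun (kf t).
Proof.
move=> t01; have [S S0 muS] := mu_summable.
exact: (fseries_bounded (measurable_phi onb) (phi_le psiC) (mupsi_summable muS t01)).
Qed.

Lemma kf_block t B E : (0 < B)%N -> t \in `[0, 1] ->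
  \int[unif]_s (kf t s * block (phi psi) B E s) = \sum_(B <= j < E) mu j * psi j t.
Proof.
move=> B0 t01; have [S S0 muS] := mu_summable.
exact: (fseries_block (measurable_phi onb) (phi_le psiC) (phi_ortho onb) E B0 (mupsi_summable muS t01)).
Qed.

Lemma K_diag_le : exists2 M, 0 <= M & forall t, t \in `[0, 1] -> `|K t t| <= M.
Proof.
have [S S0 muS] := mu_summable.
exists (S * Cpsi * Cpsi); first by rewrite !mulr_ge0// Cpsi_ge0.
move=> t t01; rewrite -kfE//.
exact: (fseries_bound (phi_le psiC) (mupsi_summable muS t01)).
Qed.

Section Truth.

(** Coefficients of the truth when [cL = 1].  At [j = 1] the logarithm and its
    inverse are 0, so that sums over frequencies may start at 1. *)
Definition acoef (j : nat) : R := j%:R `^ (- (1 / 2) - beta) * (ln j%:R)^-1.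

Lemma acoef1 : acoef 1 = 0.
Proof. by rewrite /acoef ln1 invr0 mulr0. Qed.

Lemma acoef_ge0 j : 0 <= acoef j.
Proof.
rewrite /acoef mulr_ge0 ?powR_ge0// invr_ge0; case: j => [|j]; first by rewrite ln0.
by rewrite ln_ge0// ler1n.
Qed.

Lemma acoef_tail D J : (2 <= D)%N ->
  \sum_(D <= j < J) acoef j <=
  2 `^ (beta - 1 / 2) / (beta - 1 / 2) * D%:R `^ (- (beta - 1 / 2)) / ln D%:R.
Proof.
move=> D2; have lD : (0 : R) < ln D%:R by rewrite ln_gt0// ltr1n.
apply: (@le_trans _ _ (\sum_(D <= j < J) j%:R `^ (- 1 - (beta - 1 / 2)) / ln D%:R)).
  apply: ler_sum_nat => j /andP[Dj _]; rewrite /acoef.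
  rewrite (_ : - (1 / 2) - beta = - 1 - (beta - 1 / 2)); last by lra.
  have D0 : (0 : R) < D%:R by rewrite ltr0n (leq_trans _ D2).
  have Djr : (D%:R : R) <= j%:R by rewrite ler_nat.
  have lj : ln D%:R <= ln j%:R :> R by rewrite ler_ln ?posrE// (lt_le_trans D0).
  by rewrite ler_wpM2l ?powR_ge0// lef_pV2 ?posrE// (lt_le_trans lD).
rewrite -mulr_suml ler_wpM2r ?invr_ge0 ?(ltW lD)//.
by apply: powR_tail_sum => //; have := beta2; lra.
Qed.

Lemma acoef_sqr_tail D J : (2 <= D)%N ->
  \sum_(D <= j < J) acoef j ^+ 2 <=
  2 `^ (2 * beta) / (2 * beta) * D%:R `^ (- (2 * beta)) / ln D%:R ^+ 2.
Proof.
move=> D2; have lD : (0 : R) < ln D%:R by rewrite ln_gt0// ltr1n.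
apply: (@le_trans _ _ (\sum_(D <= j < J) j%:R `^ (- 1 - 2 * beta) / ln D%:R ^+ 2)).
  apply: ler_sum_nat => j /andP[Dj _]; rewrite /acoef.
  have D0 : (0 : R) < D%:R by rewrite ltr0n (leq_trans _ D2).
  have Djr : (D%:R : R) <= j%:R by rewrite ler_nat.
  have lj : ln D%:R <= ln j%:R :> R by rewrite ler_ln ?posrE// (lt_le_trans D0).
  rewrite exprMn exprVn -(@powR_mulrn _ (_ `^ _)) ?powR_ge0// -powRrM.
  rewrite (_ : (- (1 / 2) - beta) * 2 = - 1 - 2 * beta); last by lra.
  rewrite ler_wpM2l ?powR_ge0// lef_pV2 ?posrE ?exprn_gt0// ?(lt_le_trans lD)//.
  by rewrite lerXn2r ?nnegrE ?(ltW lD)// (le_trans (ltW lD)).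
rewrite -mulr_suml ler_wpM2r ?invr_ge0 ?sqr_ge0//.
by apply: powR_tail_sum => //; have := beta2; lra.
Qed.

Variable cL : R.
Hypothesis cL0 : 0 < cL.

Definition fcoef j := cL * acoef j.

Lemma fcoef_ge0 j : 0 <= fcoef j.
Proof. by rewrite mulr_ge0 ?acoef_ge0 ?ltW. Qed.

Lemma fcoef_summable : exists S, forall J, \sum_(1 <= j < J) `|fcoef j| <= S.
Proof.
exists (cL * (2 `^ (beta - 1 / 2) / (beta - 1 / 2) * 2%:R `^ (- (beta - 1 / 2)) / ln 2%:R)).
move=> J; under eq_bigr do rewrite ger0_norm ?fcoef_ge0//.
rewrite -mulr_sumr ler_pM2l//.
have [J1|J1] := leqP J 1.
  rewrite big_geq// !mulr_ge0 ?invr_ge0 ?powR_ge0 ?ln_ge0 ?ler1n//; have := beta2; lra.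
by rewrite big_ltn// acoef1 add0r acoef_tail.
Qed.

Lemma truthE (x : R) : x \in `[0, 1] ->
  truth psi beta cL x = fseries (phi psi) fcoef x.
Proof.
move=> x01; have [S fS] := fcoef_summable.
have cf := fseries_cvg (phi_le psiC) fS (x := x).
apply/esym/cvg_lim => //; rewrite /truth.
have cE : (fun J => \sum_(1 <= j < J) fcoef j * phi psi j x) =
  (fun J => cL * \sum_(2 <= j < J) j%:R `^ (- (1 / 2) - beta) / ln j%:R * psi j x).
  apply/funext => J; rewrite mulr_sumr; have [J1|J1] := leqP J 1.
    by rewrite !big_geq// (leq_trans J1).
  rewrite big_ltn// /fcoef acoef1 mulr0 mul0r add0r.
  by apply: eq_bigr => j _; rewrite phiE// -mulrA.
rewrite cE in cf *.
apply: cvgMr.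
have : (cL^-1 * (cL * \sum_(2 <= j < J) j%:R `^ (- (1 / 2) - beta) / ln j%:R * psi j x))
   @[J --> \oo] --> cL^-1 * fseries (phi psi) fcoef x by exact: cvgMr.
under eq_cvg do rewrite mulKf ?gt_eqF//.
by move=> h; apply/cvg_ex; eexists; exact: h.
Qed.

Lemma truth_patch : truth psi beta cL \_ `[0%R : R, 1%R]%classic = fseries (phi psi) fcoef.
Proof.
apply/funext => t; rewrite -fseries_patch !patchE; case: ifPn => //.
by rewrite inE => t01; rewrite truthE.
Qed.

Lemma truth_measurable : measurable_fun `[0%R : R, 1%R] (truth psi beta cL).
Proof.
apply/(measurable_restrictT _ _).2 => //; rewrite truth_patch.
have [S fS] := fcoef_summable.
by have [] := fseries_bounded (measurable_phi onb) (phi_le psiC) fS.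
Qed.

Lemma truth_inner j : (0 < j)%N -> innerL2 (truth psi beta cL) (psi j) = fcoef j.
Proof.
move=> j0; have [S fS] := fcoef_summable.
have [/(_ j j0)[mpsi _] _ _] := onb.
rewrite innerL2E ?truth_patch//; last exact: truth_measurable.
exact: (fseries_coef (measurable_phi onb) (phi_le psiC) (phi_ortho onb) fS j0).
Qed.

Lemma truth_in_L2 : in_L2 (truth psi beta cL).
Proof.
have [S fS] := fcoef_summable; have mt := truth_measurable.
split => //; rewrite sqnormL2E// truth_patch.
have bf := fseries_bounded (measurable_phi onb) (phi_le psiC) fS.
have /(bounded_mfun_integrable unif)/integrableP[_] := bounded_mfunX 2 bf.
by under eq_integral do rewrite /= ger0_norm ?sqr_ge0//.
Qed.

End Truth.

(** The [j]-th term of the Sobolev norm is [cL^2 / (j ln^2 j)], which is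
    summable. *)
Lemma truth_Sobolev L : 0 < L -> exists cbar : R, 0 < cbar /\
  forall cL, 0 < cL <= cbar -> Sobolev_ball psi beta L (truth psi beta cL).
Proof.
move=> L0; have [S0 S0le] := @sum_inv_mul_ln2_bounded R.
pose S := Num.max S0 1.
have S1 : 0 < S by rewrite lt_max ltr01 orbT.
have Sle J : \sum_(2 <= j < J) (j%:R * ln j%:R ^+ 2)^-1 <= S.
  by rewrite (le_trans (S0le J))// le_max lexx.
exists (L / Num.sqrt S); split; first by rewrite divr_gt0// sqrtr_gt0.
move=> cL /andP[cL0 cLle]; split; first exact: truth_in_L2.
apply: lime_le.
  by apply: is_cvg_nneseries => j _ _; rewrite lee_fin mulr_ge0 ?powR_ge0 ?sqr_ge0.
apply: nearW => J; rewrite sumEFin lee_fin.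
apply: (@le_trans _ _ (cL ^+ 2 * S)); last first.
  rewrite -(@sqr_sqrtr _ S) ?(ltW S1)// -exprMn lerXn2r ?nnegrE ?mulr_ge0 ?sqrtr_ge0 ?(ltW L0) ?(ltW cL0)//.
  by rewrite -ler_pdivlMr ?sqrtr_gt0.
rewrite (eq_big_nat _ _ (F2 := fun j => cL ^+ 2 * (if (j == 1)%N then 0 else (j%:R * ln j%:R ^+ 2)^-1))); last first.
  move=> j /andP[j0 _]; rewrite truth_inner//.
  have jr0 : (0 : R) < j%:R by rewrite ltr0n.
  rewrite /fcoef; case: eqP => [->|j1]; first by rewrite acoef1 !mulr0 expr0n mulr0.
  rewrite exprMn mulrCA; congr (_ * _); rewrite /acoef exprMn exprVn.
  rewrite -(@powR_mulrn _ (_ `^ _)) ?powR_ge0// -powRrM mulrA -powRD ?(gt_eqF jr0) ?implybT//.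
  rewrite (_ : _ + _ = - 1); last by lra.
  by rewrite powR_inv1 ?(ltW jr0)// [RHS]invfM.
rewrite -mulr_sumr ler_wpM2l ?sqr_ge0//.
have [J1|J1] := leqP J 1; first by rewrite big_geq// ltW.
rewrite big_ltn// eqxx add0r; apply: le_trans (Sle J).
by apply: ler_sum_nat => j /andP[j2 _]; rewrite gtn_eqF.
Qed.

End Kernel.

(** * Second moments and averages *)

Section SecondMoments.
Context d (T : measurableType d) (R : realType) (P : probability T R).

Lemma Rintegral_sum I (r : seq I) (F : I -> T -> R) :
  (forall i, P.-integrable setT (EFin \o F i)) ->
  P.-integrable setT (EFin \o (fun w => \sum_(i <- r) F i w)) /\
  \int[P]_w (\sum_(i <- r) F i w) = \sum_(i <- r) \int[P]_w F i w.
Proof.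
move=> iF; elim: r => [|i r [iS IH]].
  split; last first.
    by under eq_Rintegral do rewrite big_nil; rewrite big_nil Rintegral_cst// mul0r.
  apply: eq_integrable (finite_measure_integrable_cst P 0 measurableT) => // w _.
  by rewrite /= big_nil.
have e : (fun w => \sum_(j <- i :: r) F j w) = (fun w => F i w + \sum_(j <- r) F j w).
  by apply/funext => w; rewrite big_cons.
split; first by rewrite e; exact: (integrableD measurableT (iF i) iS).
by rewrite big_cons -IH -RintegralD//; apply: eq_Rintegral => w _; rewrite big_cons.
Qed.

Lemma measurable_norm_ge (Z : T -> R) (a : R) : measurable_fun setT Z ->
  measurable [set w | a <= `|Z w|].
Proof.
move=> mZ; have mn : measurable_fun setT (fun w => `|Z w|) by exact: measurableT_comp.
rewrite (_ : [set w | _] = (fun w => `|Z w|) @^-1` `[a, +oo[); last first.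
  by apply/seteqP; split => w /=; rewrite in_itv/= andbT.
by rewrite -[X in measurable X]setTI; exact: mn.
Qed.

Lemma sqr_chebyshev (Z : T -> R) (a e : R) : measurable_fun setT Z -> 0 < a ->
  (\int[P]_w (Z w ^+ 2)%:E <= e%:E)%E ->
  (P [set w | a <= `|Z w|]%R <= (e / a ^+ 2)%:E)%E.
Proof.
move=> mZ a0 Ze.
have mA := measurable_norm_ge a mZ.
have a2 : 0 < a ^+ 2 by rewrite exprn_gt0.
rewrite -(setIT [set w | _]) -integral_indic//.
apply: (@le_trans _ _ (\int[P]_w ((a ^+ 2)^-1%:E * (Z w ^+ 2)%:E))%E).
  apply: ge0_le_integral => //.
  - by apply/measurable_EFinP; exact: measurable_indic.
  - by apply: emeasurable_funM => //; apply/measurable_EFinP; exact: measurable_funX.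
  - move=> w _; rewrite -EFinM lee_fin indicE.
    have [/set_mem/= aZ|_] := boolP (w \in _); last by rewrite mulr_ge0 ?invr_ge0 ?sqr_ge0.
    by rewrite ler_pdivlMl// mulr1 -[leRHS]real_normK ?num_real// lerXn2r ?nnegrE ?(ltW a0).
rewrite ge0_integralZl//; last 3 first.
- by apply/measurable_EFinP; exact: measurable_funX.
- by move=> w _; rewrite lee_fin sqr_ge0.
- by rewrite lee_fin invr_ge0 ltW.
by rewrite mulrC EFinM lee_pmul2l// lte_fin invr_gt0.
Qed.

(** Discriminant of the nonnegative polynomial [t |-> \int (F - t h)^2]. *)
Lemma L2_CS (F h : T -> R) (r : R) : measurable_fun setT F -> bounded_mfun h ->
  (\int[P]_x (F x ^+ 2)%:E <= r%:E)%E ->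
  P.-integrable setT (fun x => (F x * h x)%:E) /\
  (\int[P]_x (F x * h x)) ^+ 2 <= r * \int[P]_x (h x ^+ 2).
Proof.
move=> mF bh Fr; have [mh [H hH]] := bh.
have I2 : P.-integrable setT (fun x => (F x ^+ 2)%:E).
  apply/integrableP; split; first by apply/measurable_EFinP; exact: measurable_funX.
  by under eq_integral do rewrite gee0_abs ?lee_fin ?sqr_ge0//; rewrite (le_lt_trans Fr)// ltry.
have Ih : P.-integrable setT (fun x => (h x ^+ 2)%:E).
  exact: (bounded_mfun_integrable P (bounded_mfunX 2 bh)).
have Is : P.-integrable setT (fun x => (F x ^+ 2 + h x ^+ 2)%:E).
  by have := integrableD measurableT I2 Ih.
have IFh : P.-integrable setT (fun x => (F x * h x)%:E).
  apply: (le_integrable measurableT _ _ Is).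
    by apply/measurable_EFinP; exact: measurable_funM.
  move=> x _; rewrite /= lee_fin (ger0_norm (addr_ge0 (sqr_ge0 _) (sqr_ge0 _))).
  rewrite ler_norml; apply/andP; split; nra.
split => //.
have F2 : \int[P]_x (F x ^+ 2) <= r.
  by rewrite /Rintegral -lee_fin fineK//; exact: (integrable_fin_num measurableT I2).
set b := \int[P]_x (F x * h x); set Bh := \int[P]_x (h x ^+ 2).
have key t : 0 <= \int[P]_x (F x ^+ 2) - 2 * t * b + t ^+ 2 * Bh.
  have I3 : P.-integrable setT (EFin \o (fun x => 2 * t * (F x * h x))).
    by have := integrableZl measurableT (2 * t) IFh.
  have I4 : P.-integrable setT (EFin \o (fun x => t ^+ 2 * h x ^+ 2)).
    by have := integrableZl measurableT (t ^+ 2) Ih.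
  have I5 : P.-integrable setT (EFin \o (fun x => F x ^+ 2 - 2 * t * (F x * h x))).
    exact: (integrableB measurableT I2 I3).
  rewrite -(RintegralZl _ measurableT IFh) -(RintegralZl _ measurableT Ih).
  rewrite -RintegralB// -RintegralD//.
  apply: Rintegral_ge0 => x _.
  by rewrite (_ : _ + _ = (F x - t * h x) ^+ 2) ?sqr_ge0//; ring.
have B0 : 0 <= Bh by apply: Rintegral_ge0 => x _; exact: sqr_ge0.
have F0 : 0 <= \int[P]_x (F x ^+ 2) by apply: Rintegral_ge0 => x _; exact: sqr_ge0.
apply: (@le_trans _ _ (\int[P]_x (F x ^+ 2) * Bh)); last exact: ler_wpM2r.
set A := \int[P]_x (F x ^+ 2) in key F0 *.
have [B00|B_neq0] := eqVneq Bh 0.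
  rewrite B00 mulr0.
  have [->|b0] := eqVneq b 0; first by rewrite expr0n.
  have := key ((A + 1) / (2 * b)); rewrite B00 mulr0 addr0.
  rewrite (_ : 2 * _ * b = A + 1); last by field.
  lra.
have {B_neq0}B1 : 0 < Bh by rewrite lt_neqAle eq_sym B_neq0.
have := key (b / Bh).
rewrite (_ : _ + _ = (A * Bh - b ^+ 2) / Bh); last by field; rewrite gt_eqF.
by rewrite pmulr_lge0 ?invr_gt0// subr_ge0.
Qed.

End SecondMoments.

Section Averages.
Context {R : realType} {m : nat}.
Hypothesis m0 : (0 < m)%N.

Let mR : (0 : R) < m%:R. Proof. by rewrite ltr0n. Qed.

Lemma sqr_avg_le (a : 'I_m -> R) :
  (m%:R^-1 * \sum_k a k) ^+ 2 <= m%:R^-1 * \sum_k a k ^+ 2.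
Proof.
rewrite exprMn expr2 -mulrA ler_pM2l ?invr_gt0// ler_pdivrMl//.
exact: sum_sqr_le_card.
Qed.

Lemma avg_sqr_bound (a : 'I_m -> R) r : (forall k, a k ^+ 2 <= r) ->
  (m%:R^-1 * \sum_k a k) ^+ 2 <= r.
Proof.
move=> ar; apply: (le_trans (sqr_avg_le a)); rewrite ler_pdivrMl//.
apply: (@le_trans _ _ (\sum_(k < m) r)); first exact: ler_sum.
by rewrite sumr_const card_ord mulr_natl.
Qed.

(** By convexity of the square an average over machines has no larger second
    moment than its terms, whatever their dependence. *)
Lemma avg_sqr_le d (T : measurableType d) (P : probability T R)
    (Z : 'I_m -> T -> R) r :
  (forall k, measurable_fun setT (Z k)) ->
  (forall k, \int[P]_w (Z k w ^+ 2)%:E <= r%:E)%E ->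
  (\int[P]_w ((m%:R^-1 * \sum_k Z k w) ^+ 2)%:E <= r%:E)%E.
Proof.
move=> mZ Zr.
have msq k : measurable_fun setT (fun w => (Z k w ^+ 2)%:E).
  by apply/measurable_EFinP; exact: measurable_funX.
apply: (@le_trans _ _ (\int[P]_w (m%:R^-1%:E * \sum_(k < m) (Z k w ^+ 2)%:E))%E).
  apply: ge0_le_integral => //.
  - by move=> w _; rewrite lee_fin sqr_ge0.
  - apply/measurable_EFinP; apply: measurable_funX; apply: measurable_funM => //.
    exact: measurable_sum.
  - by apply: emeasurable_funM => //; exact: emeasurable_sum.
  - by move=> w _; rewrite sumEFin -EFinM lee_fin sqr_avg_le.
rewrite ge0_integralZl//; last 2 first.
- exact: emeasurable_sum.
- by move=> w _; apply: sume_ge0 => k _; rewrite lee_fin sqr_ge0.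
rewrite ge0_integral_sum//; last by move=> k w _; rewrite lee_fin sqr_ge0.
apply: (@le_trans _ _ (m%:R^-1%:E * \sum_(k < m) r%:E)%E).
  by rewrite lee_pmul2l ?lte_fin ?invr_gt0//; exact: lee_sum.
rewrite sumEFin -EFinM lee_fin sumr_const card_ord -[X in _ * X]mulr_natl.
by rewrite mulrA mulVf ?mul1r// gt_eqF.
Qed.

End Averages.

(** * Local and aggregated posteriors along a block of frequencies *)
Section Posterior.
Context {R : realType}.
Local Notation I01 := (`[0%R : R, 1%R]%classic).
Variables (beta sigma : R) (K : R -> R -> R) (mu : nat -> R) (psi : nat -> R -> R) (Cpsi C : R).
Hypothesis beta2 : 2 <= beta.
Hypothesis sigma0 : 0 < sigma.
Hypothesis Kpd : positive_definite K.
Hypothesis onb : orthonormal_basis psi.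
Hypothesis Kexp : kernel_expansion K mu psi.
Hypothesis psiC : forall j (t : R), (0 < j)%N -> t \in `[0, 1] -> `|psi j t| <= Cpsi.
Hypothesis C0 : 0 < C.
Hypothesis muC : forall j, (0 < j)%N ->
     C^-1 * j%:R `^ (- 1 - 2 * beta) <= mu j <= C * j%:R `^ (- 1 - 2 * beta).

Let Ksym s s' : s \in `[0, 1] -> s' \in `[0, 1] -> K s s' = K s' s.
Proof. exact: Kpd.1. Qed.

Let mu0 j : (0 < j)%N -> 0 < mu j. Proof. exact: mu_gt0 C0 muC _. Qed.

Let sn0 : sigma != 0. Proof. by rewrite gt_eqF. Qed.

Variables (B E : nat).
Hypothesis B0 : (0 < B)%N.

Local Notation h := (block (phi psi) B E).

(** Prior variance of the component along the block. *)
Definition tau : R := \sum_(B <= j < E) mu j.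

Lemma tau_ge0 : 0 <= tau.
Proof.
rewrite /tau big_nat_cond sumr_ge0// => j /andP[/andP[Bj _] _].
by rewrite ltW// mu0// (leq_trans B0).
Qed.

Let bh : bounded_mfun h. Proof. exact: (block_bounded (measurable_phi onb) (phi_le psiC) E B0). Qed.

Let h_out s : s \notin `[0, 1] -> h s = 0.
Proof. by move=> s01; rewrite /block big1// => j _; exact: phi_out. Qed.

Section LocalData.
Variables (n : nat) (x : 'I_n -> R).
Hypothesis x01 : forall i, x i \in `[0, 1].
Local Notation G := (kernel_mx K x).
Local Notation Ginv := (invmx (G + (sigma ^+ 2)%:M)).

Lemma quad_kernel v : quad G v = kform K x v x v.
Proof. by apply: eq_bigr => i _; apply: eq_bigr => j _; rewrite mxE. Qed.

Let Gpsd v : 0 <= quad G v.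
Proof. by rewrite quad_kernel; exact: (kform_ge0 Kexp mu0). Qed.

Lemma kernel_unitmx : G + (sigma ^+ 2)%:M \in unitmx.
Proof. exact: ridge_unitmx. Qed.

(** Components along the block of the kernel sections at the design points. *)
Definition features : 'rV[R]_n := \row_i \sum_(B <= j < E) mu j * psi j (x i).
Definition weights : 'rV[R]_n := ridge_weights G sigma features.
Local Notation v := weights.

Lemma features_dual w : (\sum_i features 0 i * w i) ^+ 2 <= tau * quad G w.
Proof.
rewrite quad_kernel.
have := feature_dual Kexp mu0 w E mu x01 B0.
rewrite (eq_big_nat _ _ (F2 := mu)); last first.
  by move=> j /andP[Bj _]; rewrite expr2 mulfK// gt_eqF// mu0// (leq_trans B0).
by move=> le; under eq_bigr do rewrite mxE; exact: le.
Qed.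

Lemma weights_energy : 0 <= \sum_i features 0 i * v 0 i <= tau.
Proof.
rewrite ridge_energy_ge0//=; apply: ridge_energy_le => //; first exact: tau_ge0.
exact: features_dual.
Qed.

Lemma weights_quad_le : quad G (v 0) <= tau.
Proof.
have /andP[_] := weights_energy; apply: le_trans.
rewrite -ridge_energy// lerDl mulr_ge0 ?sqr_ge0// sumr_ge0// => i _; exact: sqr_ge0.
Qed.

Lemma weights_norm_le : sigma ^+ 2 * \sum_i v 0 i ^+ 2 <= tau.
Proof. by have /andP[_] := weights_energy; apply: le_trans; rewrite -ridge_energy// lerDr. Qed.

(** The combination of low frequencies lies in the reproducing kernel space, so
    that it is paired with the weights through the kernel form. *)
Lemma weights_low_le (f : nat -> R) D :
  (\sum_i (\sum_(1 <= j < D) f j * psi j (x i)) * v 0 i) ^+ 2 <=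
  (\sum_(1 <= j < D) f j ^+ 2 / mu j) * tau.
Proof.
apply: (le_trans (feature_dual Kexp mu0 (B := 1%N) (v 0) D f x01 isT)).
rewrite -quad_kernel ler_wpM2l ?weights_quad_le// big_nat_cond sumr_ge0//.
by move=> j /andP[/andP[j0 _] _]; rewrite divr_ge0 ?sqr_ge0// ltW// mu0.
Qed.

(** For values without regularity only the Euclidean norm of the weights is
    available. *)
Lemma weights_high_le (F : 'I_n -> R) :
  (\sum_i F i * v 0 i) ^+ 2 <= tau / sigma ^+ 2 * \sum_i F i ^+ 2.
Proof.
have s2 : 0 < sigma ^+ 2 by rewrite exprn_gt0.
apply: (le_trans (sum_CS _ xpredT F (v 0))); rewrite mulrC ler_wpM2r//.
  by rewrite sumr_ge0// => i _; exact: sqr_ge0.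
by rewrite ler_pdivlMr// mulrC weights_norm_le.
Qed.

Section Mean.
Variable y : 'I_n -> R.

Let pmE s : posterior_mean K sigma x y s = \sum_i K s (x i) * (Ginv *m \col_i y i) i 0.
Proof.
by rewrite /posterior_mean -mulmxA mxE; apply: eq_bigr => i _; rewrite mxE.
Qed.

(** Posterior mean, with kernel sections extended by 0. *)
Definition pmean (s : measurableTypeR R) : R :=
  \sum_i kf mu psi (x i) s * (Ginv *m \col_i y i) i 0.

Lemma pmeanE s : s \in `[0, 1] -> posterior_mean K sigma x y s = pmean s.
Proof.
by move=> s01; rewrite pmE; apply: eq_bigr => i _; rewrite (kfE Kexp s01 (x01 i)).
Qed.

Let bkf i : bounded_mfun (kf mu psi (x i)).
Proof. exact: (kf_bounded beta2 onb psiC C0 muC (x01 i)). Qed.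

Lemma pmean_bounded : bounded_mfun pmean.
Proof.
by apply: bounded_mfun_sum => i _; apply: bounded_mfunM => //; exact: bounded_mfun_cst.
Qed.

Lemma pmean_inner : \int[unif]_s (pmean s * h s) = \sum_i y i * v 0 i.
Proof.
have bk i : bounded_mfun (fun s => kf mu psi (x i) s * h s) by exact: bounded_mfunM.
pose w := Ginv *m \col_i y i.
transitivity (\sum_i (\int[unif]_s (kf mu psi (x i) s * h s)) * w i 0).
  under [RHS]eq_bigr do rewrite -(bounded_RintegralZr unif _ (bk _)).
  rewrite -bounded_Rintegral_sum; last first.
    by move=> i; apply: bounded_mfunM => //; exact: bounded_mfun_cst.
  apply: eq_Rintegral => s _; rewrite /pmean -/w mulr_suml.
  by apply: eq_bigr => i _; rewrite mulrAC.
under eq_bigr do rewrite (kf_block beta2 onb psiC C0 muC E B0 (x01 _)).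
transitivity ((features *m w) 0 0).
  by rewrite [RHS]mxE; apply: eq_bigr => i _; rewrite [features 0 i]mxE.
rewrite /w mulmxA -/(ridge_weights _ _ _) mxE; apply: eq_bigr => i _.
by rewrite [(\col_i y i) i 0]mxE mulrC.
Qed.

End Mean.

Section Covariance.

Local Notation c := (posterior_cov K sigma x).

Let covE s s' : c s s' =
  K s s' - \sum_i \sum_j K s (x i) * Ginv i j * K (x j) s'.
Proof.
rewrite /posterior_cov mxE; congr (_ - _); rewrite exchange_big/=.
apply: eq_bigr => j _; rewrite !mxE mulr_suml; apply: eq_bigr => i _.
by rewrite mxE.
Qed.

Lemma posterior_cov_sym s s' : s \in `[0, 1] -> s' \in `[0, 1] -> c s s' = c s' s.
Proof.
move=> s01 s01'; rewrite !covE Ksym//; congr (_ - _).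
rewrite exchange_big/=; apply: eq_bigr => i _; apply: eq_bigr => j _.
rewrite (Ksym (x01 i) s01') (Ksym s01 (x01 j)).
have -> : Ginv j i = Ginv i j.
  rewrite -[in LHS](trmxK Ginv) mxE trmx_inv; congr (invmx _ _ _).
  apply/matrixP => k l; rewrite !mxE Ksym//; congr (_ + _).
  by rewrite eq_sym.
ring.
Qed.

(** The design removes [b (G + sigma^2)^(-1) b^T] from the prior form, with [b] the
    kernel form between the points [t] and the design; by [ridge_energy_le] this
    is between 0 and the prior form. *)
Lemma posterior_cov_form r (t a : 'I_r -> R) : (forall i, t i \in `[0, 1]) ->
  0 <= \sum_i \sum_j a i * a j * c (t i) (t j) <= kform K t a t a.
Proof.
move=> t01.
pose b : 'rV[R]_n := \row_k \sum_i a i * K (t i) (x k).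
pose w := ridge_weights G sigma b.
have bw : \sum_k b 0 k * w 0 k = kform K t a x (w 0).
  rewrite /kform exchange_big/=; apply: eq_bigr => k _; rewrite mxE mulr_suml.
  by apply: eq_bigr => i _; rewrite mulrAC.
have -> : \sum_i \sum_j a i * a j * c (t i) (t j) =
    kform K t a t a - \sum_k b 0 k * w 0 k.
  rewrite /kform.
  transitivity (\sum_i \sum_j a i * a j * K (t i) (t j) -
     \sum_i \sum_j \sum_k \sum_l (a i * K (t i) (x k)) * Ginv k l * (a j * K (t j) (x l))).
    rewrite -sumrB; apply: eq_bigr => i _; rewrite -sumrB; apply: eq_bigr => j _.
    rewrite covE mulrBr mulr_sumr; congr (_ - _); apply: eq_bigr => k _.
    rewrite mulr_sumr; apply: eq_bigr => l _; rewrite (Ksym (x01 l) (t01 j)); ring.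
  congr (_ - _).
  transitivity ((b *m Ginv *m b^T) 0 0); last first.
    by rewrite mxE; apply: eq_bigr => k _; rewrite [b^T k 0]mxE mulrC.
  rewrite mxE.
  under [RHS]eq_bigr do rewrite mxE mulr_suml.
  under [LHS]eq_bigr do rewrite exchange_big/=.
  under [LHS]eq_bigr do under eq_bigr do rewrite exchange_big/=.
  rewrite [LHS]exchange_big/=.
  under [LHS]eq_bigr do rewrite exchange_big/=.
  rewrite [RHS]exchange_big/=.
  apply: eq_bigr => k _; apply: eq_bigr => l _.
  rewrite !mxE mulr_suml mulr_suml; apply: eq_bigr => i _.
  by rewrite mulr_sumr.
rewrite subr_ge0 gerBl ridge_energy_ge0 ?andbT//.
apply: ridge_energy_le => //; first exact: (kform_ge0 Kexp mu0).
by rewrite bw quad_kernel; exact: (kform_CS Kexp mu0).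
Qed.

Lemma posterior_cov_diag s : s \in `[0, 1] -> 0 <= c s s <= K s s.
Proof.
move=> s01; have := @posterior_cov_form 1 (fun=> s) (fun=> 1) (fun=> s01).
by rewrite /kform !big_ord1 !mul1r.
Qed.

(** What remains of the prior variance [tau] along the block after the design has
    explained its part.  The factor [q] makes room for [kappa]. *)
Lemma posterior_cov_block (q : R) :
  \int[unif]_s (\int[unif]_s' (h s * h s' * c s s' * q)) =
  (tau - \sum_i features 0 i * v 0 i) * q.
Proof.
have bkf i : bounded_mfun (kf mu psi (x i)) by exact: (kf_bounded beta2 onb psiC C0 muC (x01 i)).
have bk i : bounded_mfun (fun s => kf mu psi (x i) s * h s) by exact: bounded_mfunM.
pose Kh (s : measurableTypeR R) := \sum_(B <= j < E) mu j * phi psi j s.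
pose w := Ginv *m features^T.
have bKh : bounded_mfun Kh.
  by apply: bounded_mfun_sum_nat => j Bj; apply: bounded_mfunM; [exact: bounded_mfun_cst |
    split; [exact: (measurable_phi onb (leq_trans B0 Bj)) | exists Cpsi => z; exact: (phi_le psiC _ (leq_trans B0 Bj))]].
have bkc a (i : 'I_n) : bounded_mfun (fun s' => kf mu psi (x i) s' * h s' * a).
  by apply: bounded_mfunM => //; exact: bounded_mfun_cst.
have bX : bounded_mfun (fun s => h s * Kh s - \sum_i (kf mu psi (x i) s * h s) * w i 0).
  by apply: bounded_mfunB; [exact: bounded_mfunM | exact: bounded_mfun_sum].
transitivity (\int[unif]_s ((h s * Kh s - \sum_i (kf mu psi (x i) s * h s) * w i 0) * q)).
  apply: eq_Rintegral => s _.
  have [s01|s01] := boolP (s \in `[0, 1]); last first.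
    under eq_Rintegral do rewrite h_out// !mul0r.
    rewrite Rintegral_cst// mul0r h_out// mul0r big1 ?subr0 ?mul0r// => i _.
    by rewrite mulr0 mul0r.
  have bks : bounded_mfun (fun s' => kf mu psi s s' * h s').
    by apply: bounded_mfunM => //; exact: (kf_bounded beta2 onb psiC C0 muC s01).
  have bY : bounded_mfun (fun s' => (kf mu psi s s' * h s') * h s -
      \sum_j (kf mu psi (x j) s' * h s') * (h s * \sum_i K s (x i) * Ginv i j)).
    apply: bounded_mfunB; last exact: bounded_mfun_sum.
    by apply: bounded_mfunM => //; exact: bounded_mfun_cst.
  transitivity (\int[unif]_s' (((kf mu psi s s' * h s') * h s -
      \sum_j (kf mu psi (x j) s' * h s') * (h s * \sum_i K s (x i) * Ginv i j)) * q)).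
    apply: eq_Rintegral => s' _; congr (_ * _).
    have [s01'|s01'] := boolP (s' \in `[0, 1]); last first.
      rewrite (h_out s01') !mulr0 !mul0r sub0r big1 ?oppr0// => j _.
      by rewrite mulr0 mul0r.
    rewrite covE (kfE Kexp s01' s01) (Ksym s01' s01) mulrBr; congr (_ - _); first ring.
    move: (h s) (h s') => a b.
    rewrite exchange_big/= mulr_sumr; apply: eq_bigr => j _.
    rewrite (kfE Kexp s01' (x01 j)) (Ksym s01' (x01 j)) !mulr_sumr.
    by apply: eq_bigr => i _; ring.
  rewrite (bounded_RintegralZr unif _ bY); congr (_ * _).
  rewrite RintegralB//; last 2 first.
  - apply: (bounded_mfun_integrable unif); apply: bounded_mfunM => //.
    exact: bounded_mfun_cst.
  - by apply: (bounded_mfun_integrable unif); exact: bounded_mfun_sum.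
  rewrite bounded_Rintegral_sum// (bounded_RintegralZr unif _ bks).
  rewrite (kf_block beta2 onb psiC C0 muC E B0 s01) mulrC; congr (_ * _ - _).
    by apply: eq_bigr => j _; rewrite phiE.
  under eq_bigr do rewrite (bounded_RintegralZr unif _ (bk _)) (kf_block beta2 onb psiC C0 muC E B0 (x01 _)).
  move: (h s) => a.
  under eq_bigr do rewrite mulrCA mulr_sumr mulr_sumr.
  rewrite exchange_big/=; apply: eq_bigr => i _.
  rewrite (kfE Kexp s01 (x01 i)) mxE mulr_sumr; apply: eq_bigr => j _.
  by rewrite !mxE; ring.
rewrite (bounded_RintegralZr unif _ bX); congr (_ * _).
rewrite RintegralB//; last 2 first.
- by apply: (bounded_mfun_integrable unif); exact: bounded_mfunM.
- by apply: (bounded_mfun_integrable unif); exact: bounded_mfun_sum.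
rewrite bounded_Rintegral_sum//; congr (_ - _).
  have bp j : (B <= j)%N -> bounded_mfun (fun s => phi psi j s * h s).
    move=> Bj; apply: bounded_mfunM => //; have j0 := leq_trans B0 Bj.
    by split; [exact: (measurable_phi onb j0) | exists Cpsi => z; exact: (phi_le psiC)].
  transitivity (\int[unif]_s (\sum_(B <= j < E) phi psi j s * h s * mu j)).
    apply: eq_Rintegral => s _; rewrite /Kh; move: (h s) => a.
    by rewrite mulr_sumr; apply: eq_bigr => j _; ring.
  rewrite bounded_Rintegral_sum_nat; last first.
    by move=> j Bj; apply: bounded_mfunM; [exact: bp | exact: bounded_mfun_cst].
  apply: eq_big_nat => j /andP[Bj jE]; rewrite (bounded_RintegralZr unif _ (bp _ Bj)).
  by rewrite (phi_block (measurable_phi onb) (phi_le psiC) (phi_ortho onb))// ?mul1r// Bj.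
under eq_bigr do rewrite (bounded_RintegralZr unif _ (bk _)) (kf_block beta2 onb psiC C0 muC E B0 (x01 _)).
rewrite /v /ridge_weights.
transitivity ((features *m (Ginv *m features^T)) 0 0).
  by rewrite mxE; apply: eq_bigr => i _; rewrite !mxE.
rewrite mulmxA mxE; apply: eq_bigr => i _.
by rewrite [_^T i 0]mxE mulrC.
Qed.

End Covariance.
End LocalData.
Section GaussianDraw.
Context d (T : measurableType d) (Q : probability T R).
Variables (n : nat) (x y : 'I_n -> R).
Hypothesis x01 : forall i, x i \in `[0, 1].
Variable f : R -> T -> R.
Local Notation m := (posterior_mean K sigma x y).
Local Notation c := (posterior_cov K sigma x).
Hypothesis Hf : gaussian_process Q f m c.

Local Notation IT := ((I01 : set (measurableTypeR R)) `*` [set: T]).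

Let mIT : measurable IT.
Proof. by apply: measurableX. Qed.

(** A draw is jointly measurable on the unit interval only; its extension by 0 is
    so on the whole product space. *)
Definition draw_patch (p : measurableTypeR R * T) : R :=
  ((fun p => f p.1 p.2) \_ IT) p.

Lemma draw_patchE s w : s \in `[0, 1] -> draw_patch (s, w) = f s w.
Proof. by move=> s01; rewrite /draw_patch patchE ifT// inE; split. Qed.

Lemma draw_patch_out s w : s \notin `[0, 1] -> draw_patch (s, w) = 0.
Proof.
move=> s01; rewrite /draw_patch patchE ifF//; apply/negbTE; rewrite notin_setE => -[/= s01' _].
by move/negP: s01; exact.
Qed.

Lemma measurable_draw_patch : measurable_fun setT draw_patch.
Proof. by have [mf _] := Hf; exact/(measurable_restrictT _ _).1. Qed.

Lemma measurable_draw s : s \in `[0, 1] -> measurable_fun setT (f s).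
Proof.
move=> s01; rewrite (_ : f s = fun w => draw_patch (s, w)); last first.
  by apply/funext => w; rewrite draw_patchE.
by apply: (measurable_fun_pair2 (f := draw_patch)); exact: measurable_draw_patch.
Qed.

Section Combination.
Variables (r : nat) (t a : 'I_r -> R).
Hypothesis t01 : forall i, t i \in `[0, 1].

Let Z w := \sum_(i < r) a i * f (t i) w.

Let mZ : measurable_fun setT Z.
Proof.
apply: measurable_sum => i; apply: measurable_funM => //.
by apply: measurable_draw; exact: t01.
Qed.

Let v0 : 0 <= \sum_(i < r) \sum_(j < r) a i * a j * c (t i) (t j).
Proof. by have /andP[] := posterior_cov_form x01 a t01. Qed.

Let lawZ (A : set R) : measurable A ->
  Q [set w | A (Z w)] = gaussian_law (\sum_(i < r) a i * m (t i))
      (\sum_(i < r) \sum_(j < r) a i * a j * c (t i) (t j)) A.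
Proof. by have [_ law] := Hf; exact: law. Qed.

Lemma draw_variance :
  (\int[Q]_w ((\sum_(i < r) a i * (f (t i) w - m (t i))) ^+ 2)%:E =
   (kappa * \sum_(i < r) \sum_(j < r) a i * a j * c (t i) (t j))%:E)%E.
Proof.
rewrite -(gaussian_variance mZ v0 lawZ); apply: eq_integral => w _.
by congr ((_ ^+ 2)%:E); rewrite /Z -sumrB; apply: eq_bigr => i _; rewrite mulrBr.
Qed.

Lemma draw_mean : Q.-integrable setT (fun w => (Z w - \sum_(i < r) a i * m (t i))%:E) /\
  (\int[Q]_w (Z w - \sum_(i < r) a i * m (t i))%:E = 0)%E.
Proof.
by split; [exact: (gaussian_integrable_centered mZ v0 lawZ) |
  exact: (gaussian_mean_centered mZ v0 lawZ)].
Qed.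

End Combination.

Lemma draw_expectation s : s \in `[0, 1] ->
  Q.-integrable setT (fun w => (f s w)%:E) /\ \int[Q]_w f s w = m s.
Proof.
move=> s01; have [I0 E0] := @draw_mean 1 (fun=> s) (fun=> 1) (fun=> s01).
have I1 : Q.-integrable setT (EFin \o (fun w => f s w - m s)).
  apply: eq_integrable I0 => // w _; by rewrite !big_ord1 !mul1r.
have Ic := finite_measure_integrable_cst Q (m s) measurableT.
split.
  by apply: eq_integrable (integrableD measurableT I1 Ic) => // w _; rewrite /= -EFinD subrK.
transitivity (\int[Q]_w ((f s w - m s) + m s)).
  by apply: eq_Rintegral => w _; rewrite subrK.
rewrite RintegralD// Rintegral_cst//.
have -> : fine (Q setT) = 1 by rewrite (probability_setT Q).
rewrite mulr1 (_ : \int[Q]_w (f s w - m s) = 0) ?add0r//.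
rewrite /Rintegral (_ : (\int[Q]_x (f s x - m s)%:E = 0)%E)// -E0.
by apply: eq_integral => w _; rewrite !big_ord1 !mul1r.
Qed.

Let e (s : R) w := f s w - m s.

Let me s : s \in `[0, 1] -> measurable_fun setT (e s).
Proof. by move=> s01; apply: measurable_funB => //; exact: measurable_draw. Qed.

Let e_sqr s : s \in `[0, 1] -> (\int[Q]_w (e s w ^+ 2)%:E = (kappa * c s s)%:E)%E.
Proof.
move=> s01; have := @draw_variance 1 (fun=> s) (fun=> 1) (fun=> s01).
rewrite !big_ord1 !mul1r => <-; apply: eq_integral => w _.
by rewrite big_ord1 mul1r.
Qed.

Let e_sqrD s s' : s \in `[0, 1] -> s' \in `[0, 1] ->
  (\int[Q]_w ((e s w + e s' w) ^+ 2)%:E = (kappa * (c s s + 2 * c s s' + c s' s'))%:E)%E.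
Proof.
move=> s01 s01'.
pose t (i : 'I_2) := if i == ord0 then s else s'.
have t01 i : t i \in `[0, 1] by rewrite /t; case: ifP.
have := draw_variance (fun=> 1) t01.
rewrite !big_ord_recr !big_ord0/= !add0r !mul1r /t/=.
rewrite (posterior_cov_sym x01 s01' s01) => E0.
transitivity (kappa * (c s s + c s s' + (c s s' + c s' s')))%:E; last by congr EFin; ring.
rewrite -E0; apply: eq_integral => w _.
by rewrite !big_ord_recr !big_ord0/= !add0r !mul1r.
Qed.

(** Polarization, since the law of the draw is given for linear combinations of
    its values. *)
Let e_mul s s' : s \in `[0, 1] -> s' \in `[0, 1] ->
  Q.-integrable setT (EFin \o (fun w => e s w * e s' w)) /\
  \int[Q]_w (e s w * e s' w) = kappa * c s s'.
Proof.
move=> s01 s01'.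
have isq (F : T -> R) v : measurable_fun setT F ->
    (\int[Q]_w (F w ^+ 2)%:E = v%:E)%E ->
    Q.-integrable setT (EFin \o (fun w => F w ^+ 2)) /\ \int[Q]_w (F w ^+ 2) = v.
  move=> mF Fv; split; last by rewrite /Rintegral Fv.
  apply/integrableP; split; first by apply/measurable_EFinP; exact: measurable_funX.
  by under eq_integral do rewrite /= ger0_norm ?sqr_ge0//; rewrite Fv ltry.
have [I1 E1] := isq _ _ (me s01) (e_sqr s01).
have [I2 E2] := isq _ _ (me s01') (e_sqr s01').
have [I3 E3] := isq _ _ (measurable_funD (me s01) (me s01')) (e_sqrD s01 s01').
have I4 := integrableB measurableT I3 I1.
have I5 := integrableB measurableT I4 I2.
have I6 := integrableZl measurableT (2^-1) I5.
have eE w : e s w * e s' w = 2^-1 * ((e s w + e s' w) ^+ 2 - e s w ^+ 2 - e s' w ^+ 2).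
  by field.
split.
  by apply: eq_integrable I6 => // w _; rewrite /= eE.
under eq_Rintegral do rewrite eE.
rewrite RintegralZl// RintegralB// RintegralB// E1 E2 E3.
by field.
Qed.

(** The integral of [fluct] in its first argument is the component along the block
    of the draw minus its mean. *)
Definition fluct (p : measurableTypeR R * T) : R :=
  (draw_patch p - pmean x y p.1) * h p.1.

Let mfluct : measurable_fun setT fluct.
Proof.
have mh : measurable_fun setT h by have [] := bh.
have mp : measurable_fun setT (pmean x y) by have [] := pmean_bounded x01 y.
apply: measurable_funM; last exact: measurableT_comp.
by apply: measurable_funB; [exact: measurable_draw_patch | exact: measurableT_comp].
Qed.

Let fluctE s w : s \in `[0, 1] -> fluct (s, w) = e s w * h s.
Proof. by move=> s01; rewrite /fluct draw_patchE// /e pmeanE. Qed.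

Let fluct_out s w : s \notin `[0, 1] -> fluct (s, w) = 0.
Proof. by move=> s01; rewrite /fluct h_out ?mulr0. Qed.

Let fluct_mul s s' :
  \int[Q]_w (fluct (s, w) * fluct (s', w)) = h s * h s' * c s s' * kappa.
Proof.
have [s01|s01] := boolP (s \in `[0, 1]); last first.
  under eq_Rintegral do rewrite fluct_out// mul0r.
  by rewrite Rintegral_cst// mul0r h_out// !mul0r.
have [s01'|s01'] := boolP (s' \in `[0, 1]); last first.
  under eq_Rintegral do rewrite [fluct (s', _)]fluct_out// mulr0.
  by rewrite Rintegral_cst// mul0r (h_out s01') mulr0 !mul0r.
have [I1 E1] := e_mul s01 s01'.
transitivity (\int[Q]_w ((h s * h s') * (e s w * e s' w))).
  by apply: eq_Rintegral => w _; rewrite !fluctE//; ring.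
by rewrite RintegralZl// E1; ring.
Qed.

Let fluct_sqr : exists M, forall s, (\int[Q]_w (fluct (s, w) ^+ 2)%:E <= M%:E)%E.
Proof.
have [_ [H hH]] := bh.
have [M M0 KM] := K_diag_le beta2 Kexp psiC C0 muC.
have H0 : 0 <= H by apply: le_trans (hH 0); exact: normr_ge0.
exists (H ^+ 2 * (kappa * M)) => s.
have [s01|s01] := boolP (s \in `[0, 1]); last first.
  under eq_integral do rewrite fluct_out// expr0n.
  by rewrite integral0 lee_fin mulr_ge0 ?sqr_ge0// mulr_ge0// kappa_ge0.
under eq_integral do rewrite fluctE// exprMn mulrC EFinM.
rewrite ge0_integralZl//; last 3 first.
- by apply/measurable_EFinP; apply: measurable_funX; exact: me.
- by move=> w _; rewrite lee_fin sqr_ge0.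
- by rewrite lee_fin sqr_ge0.
have /andP[c0 cK] := posterior_cov_diag x01 s01.
rewrite e_sqr// -EFinM lee_fin ler_pM ?sqr_ge0 ?mulr_ge0 ?kappa_ge0//.
  by rewrite -[leLHS]real_normK ?num_real// lerXn2r ?nnegrE.
by rewrite ler_wpM2l ?kappa_ge0// (le_trans cK)// (le_trans (ler_norm _))// KM.
Qed.

Definition fluct_int : T -> R := pathint unif fluct.

Lemma measurable_fluct_int : measurable_fun setT fluct_int.
Proof. by have [M fM] := fluct_sqr; exact: (measurable_pathint unif mfluct fM). Qed.

(** The posterior covariance integrated twice against the block is at most the
    prior variance. *)
Lemma fluct_int_variance : (\int[Q]_w (fluct_int w ^+ 2)%:E <= (kappa * tau)%:E)%E.
Proof.
have [M fM] := fluct_sqr.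
have Iq := pathint_sqr_integrable unif mfluct fM.
have := pathint_second_moment unif mfluct fM fluct_mul.
rewrite (posterior_cov_block x01) => E0.
rewrite -[leLHS]fineK; last exact: (integrable_fin_num measurableT Iq).
rewrite lee_fin [leLHS](_ : _ = \int[Q]_w (fluct_int w ^+ 2))// E0 mulrC.
rewrite ler_wpM2l ?kappa_ge0// gerBl.
by have /andP[] := weights_energy x01.
Qed.

Lemma fluct_ae : {ae Q, forall w, unif.-integrable setT (fun s => (fluct (s, w))%:E)}.
Proof.
have [M fM] := fluct_sqr.
have [mN N0] := pathsq_null unif mfluct fM.
exists [set w | pathsq unif fluct w = +oo%E]; split => // w /= nw.
apply: contrapT => h0; apply: nw.
apply: (sq_integrable_integrable mfluct).
by rewrite ltey; exact/eqP.
Qed.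

End GaussianDraw.

Section AggregatedDraw.
Context d (T : measurableType d) (Q : probability T R).
Variables (m n : nat) (x y : 'I_m -> 'I_n -> R).
Hypothesis x01 : forall k i, x k i \in `[0, 1].
Variable f : 'I_m -> R -> T -> R.
Hypothesis Hf : forall k, gaussian_process Q (f k)
  (posterior_mean K sigma (x k) (y k)) (posterior_cov K sigma (x k)).
Hypothesis m0 : (0 < m)%N.
Hypothesis BE : (B < E)%N.
Variable cL : R.
Hypothesis cL0 : 0 < cL.

Local Notation f0 := (truth psi beta cL).
Local Notation f0s := (fseries (phi psi) (fcoef beta cL)).

(** Component of the truth along the block. *)
Definition signal : R := \sum_(B <= j < E) fcoef beta cL j.
(** Component of the averaged posterior mean along the block. *)
Definition mean_component : R :=
  m%:R^-1 * \sum_k \sum_i y k i * weights (x k) 0 i.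

Hypothesis signal0 : 0 < signal.
Hypothesis mean_small : `|mean_component| <= signal / 4.

Let bf0 : bounded_mfun f0s.
Proof.
have [S fS] := fcoef_summable beta2 cL0.
exact: (fseries_bounded (measurable_phi onb) (phi_le psiC) fS).
Qed.

Let f0_block : \int[unif]_s (f0s s * h s) = signal.
Proof.
have [S fS] := fcoef_summable beta2 cL0.
exact: (fseries_block (measurable_phi onb) (phi_le psiC) (phi_ortho onb) E B0 fS).
Qed.

Let avg_mean (s : measurableTypeR R) : R := m%:R^-1 * \sum_k pmean (x k) (y k) s.

Let bavg : bounded_mfun avg_mean.
Proof.
apply: bounded_mfunM; first exact: bounded_mfun_cst.
by apply: bounded_mfun_sum => k _; exact: pmean_bounded.
Qed.

Let avg_block : \int[unif]_s (avg_mean s * h s) = mean_component.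
Proof.
have bph k : bounded_mfun (fun s => pmean (x k) (y k) s * h s).
  by apply: bounded_mfunM => //; exact: pmean_bounded.
transitivity (\int[unif]_s ((\sum_k pmean (x k) (y k) s * h s) * m%:R^-1)).
  by apply: eq_Rintegral => s _; rewrite /avg_mean -mulr_suml; ring.
rewrite bounded_RintegralZr; last exact: bounded_mfun_sum.
rewrite bounded_Rintegral_sum// mulrC; congr (_ * _).
by apply: eq_bigr => k _; exact: pmean_inner.
Qed.

Let h_sqr : \int[unif]_s (h s ^+ 2) = (E - B)%:R.
Proof. exact: (block_sqr (measurable_phi onb) (phi_le psiC) (phi_ortho onb) E B0). Qed.

Let EB0 : (0 : R) < (E - B)%:R. Proof. by rewrite ltr0n subn_gt0. Qed.

Lemma aggregated_meanE s : s \in `[0, 1] ->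
  aggregated_mean Q f s = avg_mean s.
Proof.
move=> s01; rewrite /aggregated_mean unlock /aggregated_draw.
rewrite -/(Rintegral Q setT (fun w => m%:R^-1 * \sum_k f k s w)).
have iF k : Q.-integrable setT (EFin \o (fun w => f k s w)).
  by have [] := draw_expectation (x01 k) (Hf k) s01.
have [iS ES] := Rintegral_sum (index_enum 'I_m) iF.
rewrite RintegralZl//; congr (_ * _); rewrite ES; apply: eq_bigr => k _.
by have [_ ->] := draw_expectation (x01 k) (Hf k) s01; rewrite pmeanE.
Qed.

(** Cauchy-Schwarz against the block: the component of the error is at least
    [3 / 4 * signal] in absolute value. *)
Lemma aggregated_mean_risk_ge :
  (((3 / 4 * signal) ^+ 2 / (E - B)%:R)%:E <=
   sqnormL2 (fun s => aggregated_mean Q f s - f0 s)%R)%E.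
Proof.
pose F (s : measurableTypeR R) := ((avg_mean s - f0s s) * \1_I01 s).
have bI : bounded_mfun (\1_I01 : measurableTypeR R -> R).
  split; first exact: measurable_indic.
  by exists 1 => s; rewrite indicE; case: (s \in _); rewrite ?normr0 ?normr1 ?ler01.
have bF : bounded_mfun F by apply: bounded_mfunM => //; exact: bounded_mfunB.
have patchF : (fun s => aggregated_mean Q f s - f0 s) \_ I01 = F.
  apply/funext => s; rewrite patchE /F indicE; case: ifPn => [|_]; last by rewrite mulr0.
  rewrite inE => s01; rewrite aggregated_meanE// (truthE beta2 psiC cL0 s01).
  by rewrite mulr1.
have mD : measurable_fun I01 (fun s => aggregated_mean Q f s - f0 s).
  by apply/(measurable_restrictT _ _).2 => //; rewrite patchF; have [] := bF.
rewrite (sqnormL2E mD) patchF.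
have IF2 := bounded_mfun_integrable unif (bounded_mfunX 2 bF).
have F2 : (\int[unif]_s (F s ^+ 2)%:E = (\int[unif]_s (F s ^+ 2))%:E)%E.
  by rewrite /Rintegral fineK//; exact: (integrable_fin_num measurableT IF2).
rewrite F2 lee_fin.
have [|_] := @L2_CS _ _ _ unif F h _ (proj1 bF) bh (_ : _ <= (\int[unif]_s (F s ^+ 2))%:E)%E.
  by rewrite F2.
rewrite h_sqr -ler_pdivrMr//; apply: le_trans.
rewrite ler_pM2r ?invr_gt0//.
have -> : \int[unif]_s (F s * h s) = mean_component - signal.
  rewrite -avg_block -f0_block -RintegralB//; last 2 first.
  - by apply: (bounded_mfun_integrable unif); exact: bounded_mfunM.
  - by apply: (bounded_mfun_integrable unif); exact: bounded_mfunM.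
  apply: eq_Rintegral => s _; rewrite /F indicE.
  have [sI|sI] := boolP (s \in _); first by rewrite mulr1 mulrBl.
  rewrite (_ : h s = 0) ?mulr0 ?subr0//; apply: h_out.
  by apply: contra sI => s01; exact/mem_set.
have := signal0; move: mean_small; rewrite ler_norml => /andP[h1 h2] h3.
nra.
Qed.

Let Dp (p : measurableTypeR R * T) : R :=
  m%:R^-1 * \sum_k draw_patch (f k) p - f0s p.1.

Let mDp : measurable_fun setT Dp.
Proof.
apply: measurable_funB; last by apply: measurableT_comp => //; have [] := bf0.
apply: measurable_funM => //; apply: measurable_sum => k.
exact: (measurable_draw_patch (Hf k)).
Qed.

Let patchDp w : (fun s => aggregated_draw f w s - f0 s) \_ I01 = fun s => Dp (s, w).
Proof.
apply/funext => s; rewrite patchE /Dp /=; case: ifPn => [|sI].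
  rewrite inE => s01; rewrite (truthE beta2 psiC cL0 s01) /aggregated_draw.
  by congr (_ * _ - _); apply: eq_bigr => k _; rewrite draw_patchE.
have s01 : s \notin `[0, 1] by apply: contra sI; rewrite inE.
rewrite fseries_out// big1 ?mulr0 ?subr0// => k _.
exact: draw_patch_out.
Qed.

Let sqnormDp w :
  sqnormL2 (fun s => aggregated_draw f w s - f0 s) = (\int[unif]_s (Dp (s, w) ^+ 2)%:E)%E.
Proof.
rewrite sqnormL2E ?patchDp//.
apply/(measurable_restrictT _ _).2 => //; rewrite patchDp.
exact: (measurable_fun_pair1 (f := Dp)).
Qed.

Let avgZ w : R := m%:R^-1 * \sum_k fluct_int (x k) (y k) (f k) w.

Let mfl k : measurable_fun setT (fluct_int (x k) (y k) (f k)).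
Proof. exact: (measurable_fluct_int (x01 k) (Hf k)). Qed.

Let mavgZ : measurable_fun setT avgZ.
Proof. by apply: measurable_funM => //; exact: measurable_sum. Qed.

Let avgZ_variance : (\int[Q]_w (avgZ w ^+ 2)%:E <= (kappa * tau)%:E)%E.
Proof.
by apply: (avg_sqr_le m0) => // k; exact: (fluct_int_variance (x01 k) (Hf k)).
Qed.

Let mDp2 : measurable_fun setT (fun p => (Dp p ^+ 2)%:E).
Proof. by apply/measurable_EFinP; exact: measurable_funX. Qed.

Let ballE r : [set w | (sqnormL2 (fun s => aggregated_draw f w s - f0 s)%R <= r%:E)%E] =
  [set w | (pathsq unif Dp w <= r%:E)%E].
Proof. by apply/seteqP; split => w /=; rewrite /pathsq sqnormDp. Qed.

Lemma measurable_posterior_ball r :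
  measurable [set w | (sqnormL2 (fun s => aggregated_draw f w s - f0 s)%R <= r%:E)%E].
Proof.
have mpath : measurable_fun setT (pathsq unif Dp).
  by apply: (measurable_fun_fubini_tonelli_G _ mDp2) => p; rewrite lee_fin sqr_ge0.
rewrite ballE (_ : [set w | _] = pathsq unif Dp @^-1` `]-oo, r%:E]); last first.
  by apply/seteqP; split => w /=; rewrite in_itv.
by rewrite -[X in measurable X]setTI; apply: mpath => //; exact: emeasurable_itv.
Qed.

Lemma aggregated_posterior_le1 r : (aggregated_posterior Q f
  [set g | sqnormL2 (fun s => g s - f0 s)%R <= r%:E] <= 1)%E.
Proof. by apply: probability_le1; exact: measurable_posterior_ball. Qed.

(** By Cauchy-Schwarz the component of a draw in the ball is at least
    [3 / 4 * signal], of which the mean provides at most [signal / 4]; the rest is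
    a fluctuation of size at least [signal / 2], to which Chebyshev's inequality
    applies. *)
Lemma aggregated_posterior_le r : r * (E - B)%:R <= signal ^+ 2 / 16 ->
  (aggregated_posterior Q f
     [set g | sqnormL2 (fun s => g s - f0 s)%R <= r%:E]
   <= ((kappa * tau) / (signal / 2) ^+ 2)%:E)%E.
Proof.
move=> rle; rewrite /aggregated_posterior.
pose S1 := [set w | (pathsq unif Dp w <= r%:E)%E].
have mS1 : measurable S1 by rewrite /S1 -ballE; exact: measurable_posterior_ball.
rewrite (_ : [set w | _] = S1); last exact: ballE.
pose S2 := [set w | signal / 2 <= `|avgZ w|]%R.
have mS2 : measurable S2 by exact: measurable_norm_ge.
have /filter_forall ae : forall k, {ae Q, forall w,
    unif.-integrable setT (fun s => (fluct (x k) (y k) (f k) (s, w))%:E)}.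
  by move=> k; exact: (fluct_ae (x01 k) (Hf k)).
have [N [mN N0 subN]] := ae.
have signal2 : 0 < signal / 2 by rewrite divr_gt0.
apply: le_trans (sqr_chebyshev mavgZ signal2 avgZ_variance).
apply: (@le_trans _ _ (Q (S2 `|` N))); last first.
  apply: (le_trans (measureU2 _ mS2 mN)).
  by rewrite [X in (_ + X)%E](_ : _ = 0%E) ?adde0.
rewrite le_measure ?inE//; first exact: measurableU.
move=> w Sw; have [Nw|Nw] := pselect (N w); [by right | left].
have {subN}Iw k : unif.-integrable setT (fun s => (fluct (x k) (y k) (f k) (s, w))%:E).
  by apply: contrapT => h0; apply: Nw; apply: subN => /= /(_ k).
have mDpw : measurable_fun setT (fun s => Dp (s, w)).
  exact: (measurable_fun_pair1 (f := Dp)).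
have [_] := L2_CS mDpw bh Sw.
rewrite h_sqr => /le_trans/(_ rle).
have -> : \int[unif]_s (Dp (s, w) * h s) = avgZ w + mean_component - signal.
  have [IS ES] := Rintegral_sum (index_enum 'I_m) Iw.
  have IZ : unif.-integrable setT (EFin \o (fun s => m%:R^-1 * \sum_k fluct (x k) (y k) (f k) (s, w))).
    by have := integrableZl measurableT m%:R^-1 IS.
  have IM : unif.-integrable setT (EFin \o (fun s => avg_mean s * h s)).
    by apply: (bounded_mfun_integrable unif); exact: bounded_mfunM.
  have IF0 : unif.-integrable setT (EFin \o (fun s => f0s s * h s)).
    by apply: (bounded_mfun_integrable unif); exact: bounded_mfunM.
  have ISM : unif.-integrable setT (EFin \o (fun s => m%:R^-1 * \sum_k fluct (x k) (y k) (f k) (s, w) + avg_mean s * h s)).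
    exact: (integrableD measurableT IZ IM).
  transitivity (\int[unif]_s (m%:R^-1 * \sum_k fluct (x k) (y k) (f k) (s, w)
      + avg_mean s * h s - f0s s * h s)).
    apply: eq_Rintegral => s _; rewrite /Dp /= /avg_mean /fluct -mulr_suml sumrB.
    move: (h s) => a; ring.
  rewrite RintegralB// RintegralD// RintegralZl// ES avg_block f0_block.
  by [].
move=> le; rewrite /S2 /=; have := signal0.
move: mean_small; rewrite ler_norml => /andP[h1 h2] h3.
have h4 : `|avgZ w + mean_component - signal| <= signal / 4.
  rewrite -(@ler_sqr _ `|_|) ?nnegrE ?divr_ge0 ?(ltW h3)//.
  by rewrite real_normK ?num_real//; lra.
move: h4; rewrite ler_norml => /andP[h4 h5].
rewrite ler_normr; apply/orP; left; lra.
Qed.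

End AggregatedDraw.

End Posterior.

(** * Random design and noise *)

Lemma Rintegral_prob_cst d (T : measurableType d) (R : realType)
  (P : probability T R) (a : R) : \int[P]_w a = a.
Proof.
rewrite Rintegral_cst// [X in _ * fine X](_ : _ = 1%E) ?mulr1//.
exact: probability_setT.
Qed.

Lemma uniform_expectation d (T : measurableType d) (R : realType)
    (P : probability T R) (Z : T -> R) (g : measurableTypeR R -> R) :
  measurable_fun setT Z ->
  (forall A, measurable A -> P (Z @^-1` A) = uniform_prob (@ltr01 R) A) ->
  bounded_mfun g -> \int[P]_w g (Z w) = \int[unif]_s g s.
Proof.
move=> mZ lawZ bg; have [mg [M gM]] := bg.
pose Zm : {RV P >-> measurableTypeR R} :=
  HB.pack (Z : T -> measurableTypeR R) (isMeasurableFun.Build _ _ _ (measurableTypeR R) Z mZ).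
have igZ : P.-integrable setT ((EFin \o g) \o Zm).
  apply: (bounded_mfun_integrable P); split; first exact: measurableT_comp.
  by exists M => w; exact: gM.
rewrite /Rintegral; congr fine.
transitivity (\int[distribution P Zm]_s (EFin \o g) s)%E.
  by rewrite integral_distribution//; exact/measurable_EFinP.
by apply: eq_measure_integral => A mA _; exact: lawZ.
Qed.

Section MeasurableMatrix.
Context d (T : measurableType d) (R : realType).

(** [x^-1 = x * (x^2)^(-1)] reduces inverses to powers of nonnegative reals. *)
Lemma measurable_inv_comp (f : T -> R) : measurable_fun setT f ->
  measurable_fun setT (fun w => (f w)^-1).
Proof.
move=> mf.
have -> : (fun w => (f w)^-1) = fun w => f w * (f w ^+ 2) `^ (- 1).
  apply/funext => w; have [->|fw0] := eqVneq (f w) 0; first by rewrite invr0 mul0r.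
  by rewrite powR_inv1 ?sqr_ge0// expr2 invfM mulrA divff// mul1r.
apply: measurable_funM => //.
apply: (measurableT_comp (measurable_powR (- 1))).
exact: measurable_funX.
Qed.

Lemma measurable_det n (A : T -> 'M[R]_n) :
  (forall i j, measurable_fun setT (fun w => A w i j)) ->
  measurable_fun setT (fun w => \det (A w)).
Proof.
move=> mA; rewrite /determinant; apply: measurable_sum => s.
apply: measurable_funM => //; apply: measurable_prod => i _; exact: mA.
Qed.

Lemma measurable_invmx n (A : T -> 'M[R]_n) :
  (forall i j, measurable_fun setT (fun w => A w i j)) ->
  (forall w, A w \in unitmx) ->
  forall i j, measurable_fun setT (fun w => invmx (A w) i j).
Proof.
move=> mA uA i j.
have -> : (fun w => invmx (A w) i j) =
    fun w => (\det (A w))^-1 * ((-1) ^+ (j + i) * \det (row' j (col' i (A w)))).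
  by apply/funext => w; rewrite /invmx uA !mxE.
apply: measurable_funM.
  by apply: measurable_inv_comp; exact: measurable_det.
apply: measurable_funM => //; apply: measurable_det => k l.
under eq_fun do rewrite !mxE; exact: mA.
Qed.

Lemma measurable_sum_nat (B E : nat) (F : nat -> T -> R) :
  (forall j, (B <= j)%N -> measurable_fun setT (F j)) ->
  measurable_fun setT (fun w => \sum_(B <= j < E) F j w).
Proof.
move=> mF; under eq_fun do rewrite big_nat_cond.
rewrite (_ : (fun _ => _) = fun w => \sum_(j <- index_iota B E)
    (fun j => if (B <= j)%N then F j else fun=> 0) j w); last first.
  apply/funext => w; rewrite [RHS]big_nat_cond; apply: eq_bigr => j /andP[/andP[-> _] _] //.
by apply: measurable_sum => j; case: ifP => // /mF.
Qed.

End MeasurableMatrix.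

Section OrthogonalSum.
Context d (T : measurableType d) (R : realType) (P : probability T R).
Variables (I : finType) (F : I -> T -> R) (v : I -> R).
Hypothesis intF : forall i j, P.-integrable setT (EFin \o (fun w => F i w * F j w)).
Hypothesis orthF : forall i j, i != j -> \int[P]_w (F i w * F j w) = 0.
Hypothesis varF : forall i, \int[P]_w (F i w * F i w) = v i.

Lemma orthogonal_sum_sqr :
  (\int[P]_w ((\sum_i F i w) ^+ 2)%:E = (\sum_i v i)%:E)%E.
Proof.
have eF w : (\sum_i F i w) ^+ 2 = \sum_(p : I * I) F p.1 w * F p.2 w.
  rewrite expr2 mulr_suml; under eq_bigr do rewrite mulr_sumr.
  by rewrite pair_big.
have [IS ES] := Rintegral_sum (P := P) (index_enum _) (fun p : I * I => intF p.1 p.2).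
have fS := integrable_fin_num measurableT IS.
under eq_integral do rewrite eF.
rewrite -(fineK fS); congr EFin; rewrite -/(Rintegral P setT _) ES.
rewrite -(pair_big xpredT xpredT (fun i j => \int[P]_w (F i w * F j w)))/=.
apply: eq_bigr => i _; rewrite (bigD1 i)//= varF big1 ?addr0// => j ji.
by rewrite orthF// eq_sym.
Qed.

End OrthogonalSum.

Section TailCoefficients.
Context {R : realType}.

Definition tail_coef (D : nat) (c : nat -> R) j : R := if (j < D)%N then 0 else c j.

Lemma tail_coef_sum (G : R -> R) D c J : G 0 = 0 -> (0 < D)%N ->
  \sum_(1 <= j < J) G (tail_coef D c j) = \sum_(D <= j < J) G (c j).
Proof.
move=> G0 D0; have [JD|DJ] := leqP J D.
  rewrite [RHS]big_geq// big_nat_cond big1// => j /andP[/andP[_ jJ] _].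
  by rewrite /tail_coef (leq_trans jJ JD).
rewrite (big_cat_nat D0 (ltnW DJ))/= [X in X + _]big_nat_cond big1 ?add0r; last first.
  by move=> j /andP[/andP[_ jD] _]; rewrite /tail_coef jD.
by apply: eq_big_nat => j /andP[Dj _]; rewrite /tail_coef ltnNge Dj.
Qed.

Lemma fseries_split (psi : nat -> R -> R) (Cpsi : R) (c : nat -> R) S S' D x :
  (forall j (t : R), (0 < j)%N -> t \in `[0, 1] -> `|psi j t| <= Cpsi) ->
  (forall J, \sum_(1 <= j < J) `|c j| <= S) ->
  (forall J, \sum_(1 <= j < J) `|tail_coef D c j| <= S') -> (0 < D)%N ->
  fseries (phi psi) c x =
  \sum_(1 <= j < D) c j * phi psi j x + fseries (phi psi) (tail_coef D c) x.
Proof.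
move=> psiC cS tS D0; apply/cvg_lim => //.
have ct := fseries_cvg (phi_le psiC) tS (x := x).
apply: (@cvg_trans _ ((fun J => \sum_(1 <= j < D) c j * phi psi j x +
    \sum_(1 <= j < J) tail_coef D c j * phi psi j x) @ \oo)); last first.
  by apply: cvgD => //; exact: cvg_cst.
apply: near_eq_cvg; exists D => // J /= DJ.
have z : \sum_(1 <= j < D) tail_coef D c j * phi psi j x = 0.
  by rewrite big_nat_cond big1// => j /andP[/andP[_ jD] _]; rewrite /tail_coef jD mul0r.
rewrite [X in _ + X](big_cat_nat D0 DJ)/= [RHS](big_cat_nat D0 DJ)/= z add0r.
by congr (_ + _); apply: eq_big_nat => j /andP[Dj _]; rewrite /tail_coef ltnNge Dj.
Qed.

End TailCoefficients.

Section Design.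
Context {R : realType}.
Variables (beta sigma : R) (K : R -> R -> R) (mu : nat -> R) (psi : nat -> R -> R) (Cpsi C : R).
Hypothesis beta2 : 2 <= beta.
Hypothesis sigma0 : 0 < sigma.
Hypothesis onb : orthonormal_basis psi.
Hypothesis Kexp : kernel_expansion K mu psi.
Hypothesis psiC : forall j (t : R), (0 < j)%N -> t \in `[0, 1] -> `|psi j t| <= Cpsi.
Hypothesis C0 : 0 < C.
Hypothesis muC : forall j, (0 < j)%N ->
     C^-1 * j%:R `^ (- 1 - 2 * beta) <= mu j <= C * j%:R `^ (- 1 - 2 * beta).
Variables (B E : nat).
Hypothesis B0 : (0 < B)%N.

Section Weights.
Context d (T : measurableType d) (n : nat) (x : T -> 'I_n -> R).
Hypothesis x01 : forall w i, x w i \in `[0, 1].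
Hypothesis mx : forall i, measurable_fun setT (fun w => x w i).

Let mphix j i : (0 < j)%N -> measurable_fun setT (fun w => phi psi j (x w i)).
Proof.
move=> j0; apply: (measurableT_comp (f := phi psi j)); first exact: (measurable_phi onb).
exact: mx.
Qed.

Let mK i j : measurable_fun setT (fun w => K (x w i) (x w j)).
Proof.
apply: (@measurable_fun_cvg _ _ _ setT
  (fun J w => \sum_(1 <= l < J) mu l * phi psi l (x w i) * phi psi l (x w j))).
  move=> J; apply: measurable_sum_nat => l l0.
  apply: measurable_funM; last exact: mphix.
  by apply: measurable_funM => //; exact: mphix.
move=> w _; rewrite (_ : (fun _ => _) = (fun J => \sum_(1 <= l < J) mu l * psi l (x w i) * psi l (x w j))).
  exact: Kexp.
by apply/funext => J; apply: eq_bigr => l _; rewrite !phiE.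
Qed.

(** The sigma-algebra is arbitrary, in order to apply this to the one generated by
    all the variables but one. *)
Lemma measurable_weights i : measurable_fun setT (fun w => weights sigma K mu psi B E (x w) 0 i).
Proof.
rewrite /weights /ridge_weights; under eq_fun do rewrite mxE.
apply: measurable_sum => j; apply: measurable_funM; last first.
  apply: (measurable_invmx (A := fun w => kernel_mx K (x w) + (sigma ^+ 2)%:M)).
    move=> k l; under eq_fun do rewrite !mxE.
    by apply: measurable_funD; [exact: mK | exact: measurable_cst].
  by move=> w; exact: (kernel_unitmx sigma0 Kexp C0 muC (x01 w)).
rewrite /features; under eq_fun do rewrite mxE.
rewrite (_ : (fun _ => _) = fun w => \sum_(B <= l < E) mu l * phi psi l (x w j)); last first.
  by apply/funext => w; apply: eq_bigr => l _; rewrite phiE.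
apply: measurable_sum_nat => l Bl; apply: measurable_funM => //.
by apply: mphix; exact: leq_trans Bl.
Qed.

End Weights.

Section Experiment.
Context d (T : measurableType d) (P : probability T R) (m n : nat)
  (X eps : 'I_m -> 'I_n -> {RV P >-> R}).
Hypothesis model : regression_model sigma X eps.

Local Notation v k w i := (weights sigma K mu psi B E (design X w k) 0 i).
Local Notation V := (design_noise_family X eps).

Let X01 w k i : design X w k i \in `[0, 1]. Proof. by have [+ _ _ _] := model; exact. Qed.

Let indV : mutually_independent P (fun u => sigma_RV (V u)). Proof. by case: model. Qed.

Let mv k i : measurable_fun setT (fun w => v k w i).
Proof. by apply: measurable_weights => // j; exact: measurable_funP. Qed.

Let mv_rest u k i : (forall j, inl (k, j) != u) ->
  measurable_fun setT ((fun w => v k w i) : g_sigma_algebraType (rest V u) -> R).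
Proof.
move=> ku; apply: (measurable_weights (T := g_sigma_algebraType (rest V u))
  (x := fun w => design X w k)) => // j.
exact: (rest_measurable_RV (V := V) (ku j)).
Qed.

Let v_bounded : exists M, forall k i w, `|v k w i| <= M.
Proof.
have s2 : 0 < sigma ^+ 2 by rewrite exprn_gt0.
exists (1 + tau mu B E / sigma ^+ 2) => k i w.
have := weights_norm_le sigma0 Kexp C0 muC E B0 (X01 w k).
rewrite mulrC -ler_pdivlMr// => h.
have h1 : v k w i ^+ 2 <= tau mu B E / sigma ^+ 2.
  apply: le_trans h; rewrite (bigD1 i)//= lerDl sumr_ge0// => j _; exact: sqr_ge0.
apply: (@le_trans _ _ (1 + v k w i ^+ 2)); last by rewrite lerD2l.
rewrite ler_norml; apply/andP; split; nra.
Qed.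

Let bv k i : bounded_mfun (fun w => v k w i).
Proof. by split => //; have [M vM] := v_bounded; exists M. Qed.

Let law_eps k i (A : set R) : measurable A ->
  P [set w | A (eps k i w)] = gaussian_law 0 (sigma ^+ 2) A.
Proof.
move=> mA; have [_ _ /(_ k i A mA) h _] := model.
have s2 : sigma ^+ 2 == 0 = false by rewrite sqrf_eq0 gt_eqF.
by rewrite /gaussian_law s2 sqrtr_sqr (gtr0_norm sigma0) -h.
Qed.

Let meps k i : measurable_fun setT (eps k i). Proof. exact: measurable_funP. Qed.

Let ieps k i : P.-integrable setT (EFin \o eps k i).
Proof.
have := gaussian_integrable_centered (meps k i) (sqr_ge0 sigma) (law_eps k i).
by apply: eq_integrable => // w _; rewrite /= subr0.
Qed.

Let Eeps k i : \int[P]_w eps k i w = 0.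
Proof.
have := gaussian_mean_centered (meps k i) (sqr_ge0 sigma) (law_eps k i).
move=> h; transitivity (fine (\int[P]_w (eps k i w - 0)%:E)%E); last by rewrite h.
by rewrite /Rintegral; congr fine; apply: eq_integral => w _; rewrite subr0.
Qed.

Let Veps k i : (\int[P]_w (eps k i w ^+ 2)%:E = (kappa * sigma ^+ 2)%:E)%E.
Proof.
have := gaussian_variance (meps k i) (sqr_ge0 sigma) (law_eps k i).
by under eq_integral do rewrite subr0.
Qed.

Let ieps2 k i : P.-integrable setT (EFin \o (fun w => eps k i w ^+ 2)).
Proof.
apply/integrableP; split; first by apply/measurable_EFinP; exact: measurable_funX.
by under eq_integral do rewrite /= ger0_norm ?sqr_ge0//; rewrite Veps ltry.
Qed.

Definition noise k w : R := \sum_i v k w i * eps k i w.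

Lemma measurable_noise k : measurable_fun setT (noise k).
Proof. by apply: measurable_sum => i; apply: measurable_funM. Qed.

Let noise_diag k i :
  P.-integrable setT (EFin \o (fun w => v k w i * eps k i w * (v k w i * eps k i w))) /\
  \int[P]_w (v k w i * eps k i w * (v k w i * eps k i w)) =
    (\int[P]_w (v k w i ^+ 2)) * (kappa * sigma ^+ 2).
Proof.
have e w : v k w i * eps k i w * (v k w i * eps k i w) = v k w i ^+ 2 * eps k i w ^+ 2 by ring.
have := rest_expect indV (u := inr (k, i)) (F := fun w => v k w i ^+ 2) (g := fun x => x ^+ 2).
case.
- by apply: measurable_funX; exact: mv_rest.
- exact: measurable_funX.
- exact: (bounded_mfun_integrable P (bounded_mfunX 2 (bv k i))).
- exact: ieps2.
move=> I1 E1; split.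
  by apply: eq_integrable I1 => // w _; rewrite /= e.
under eq_Rintegral do rewrite e.
by rewrite E1; congr (_ * _); rewrite /Rintegral Veps.
Qed.

Let noise_off k i j : i != j ->
  P.-integrable setT (EFin \o (fun w => v k w i * eps k i w * (v k w j * eps k j w))) /\
  \int[P]_w (v k w i * eps k i w * (v k w j * eps k j w)) = 0.
Proof.
move=> ij.
have e w : v k w i * eps k i w * (v k w j * eps k j w) = (v k w i * v k w j * eps k i w) * eps k j w by ring.
have bvv : bounded_mfun (fun w => v k w i * v k w j) by exact: bounded_mfunM.
have := rest_expect indV (u := inr (k, j)) (F := fun w => v k w i * v k w j * eps k i w) (g := id).
case.
- apply: measurable_funM; first by apply: measurable_funM; exact: mv_rest.
  apply: (rest_measurable_RV (V := V) (u := inr (k, j)) (v := inr (k, i))).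
  by apply: contra ij => /eqP[->].
- exact: measurable_id.
- have [mvv [M vvM]] := bvv.
  have IM : P.-integrable setT (EFin \o (fun w => M * eps k i w)).
    by have := integrableZl measurableT M (ieps k i).
  apply: (le_integrable measurableT _ _ IM).
    by apply/measurable_EFinP; exact: measurable_funM.
  move=> w _; rewrite /= lee_fin !normrM ler_wpM2r//.
  by rewrite -normrM (le_trans (vvM w))// ler_norm.
- exact: ieps.
move=> I1 E1; split.
  by apply: eq_integrable I1 => // w _; rewrite /= e.
under eq_Rintegral do rewrite e.
by rewrite E1 [X in _ * X]Eeps mulr0.
Qed.

(** The weights depend on the design only, so that distinct noise terms stay
    uncorrelated; the diagonal terms sum to the expectation of
    [kappa sigma^2 |v|^2], bounded by [weights_norm_le]. *)
Lemma noise_variance k : (\int[P]_w (noise k w ^+ 2)%:E <= (kappa * tau mu B E)%:E)%E.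
Proof.
rewrite (@orthogonal_sum_sqr _ _ _ P _ (fun i w => v k w i * eps k i w)
  (fun i => (\int[P]_w (v k w i ^+ 2)) * (kappa * sigma ^+ 2))).
- rewrite lee_fin -mulr_suml -bounded_Rintegral_sum; last by move=> i; exact: bounded_mfunX.
  rewrite mulrC -mulrA ler_wpM2l ?kappa_ge0// mulrC -bounded_RintegralZr; last first.
    by apply: bounded_mfun_sum => i _; exact: bounded_mfunX.
  rewrite -[leRHS](_ : \int[P]_w (tau mu B E) = _); last first.
    by rewrite Rintegral_prob_cst.
  apply: le_Rintegral => //.
  + apply: (bounded_mfun_integrable P); apply: bounded_mfunM; last exact: bounded_mfun_cst.
    by apply: bounded_mfun_sum => i _; exact: bounded_mfunX.
  + by apply: (bounded_mfun_integrable P); exact: bounded_mfun_cst.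
  + move=> w _; rewrite mulrC.
    exact: (weights_norm_le sigma0 Kexp C0 muC E B0 (X01 w k)).
- move=> i j; have [->|ij] := eqVneq i j; first exact: (noise_diag k j).1.
  exact: (noise_off k ij).1.
- by move=> i j ij; exact: (noise_off k ij).2.
- by move=> i; exact: (noise_diag k i).2.
Qed.

Lemma design_expectation k i (g : measurableTypeR R -> R) : bounded_mfun g ->
  \int[P]_w g (X k i w) = \int[unif]_s g s.
Proof.
apply: uniform_expectation; first exact: measurable_funP.
by move=> A mA; have [_ /(_ k i A mA) + _ _] := model.
Qed.

Section HighFrequency.
Variables (c : nat -> R) (S q : R).
Hypothesis cS : forall J, \sum_(1 <= j < J) `|c j| <= S.
Hypothesis cq : forall J, \sum_(1 <= j < J) c j ^+ 2 <= q.
Hypothesis q0 : 0 < q.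
Hypotheses (m0 : (0 < m)%N) (n0 : (0 < n)%N).

Local Notation fs := (fseries (phi psi) c).

Let bfs : bounded_mfun fs. Proof. exact: (fseries_bounded (measurable_phi onb) (phi_le psiC) cS). Qed.

Let e := \int[unif]_s (fs s ^+ 2).

Let e_le : e <= q.
Proof. exact: (fseries_sqr (measurable_phi onb) (phi_le psiC) (phi_ortho onb) cS cq). Qed.

Let dev (s : measurableTypeR R) : R := fs s ^+ 2 - e.

Let bdev : bounded_mfun dev.
Proof. by apply: bounded_mfunB; [exact: bounded_mfunX | exact: bounded_mfun_cst]. Qed.

Let int_dev : \int[unif]_s dev s = 0.
Proof.
rewrite RintegralB//; last 2 first.
- exact: (bounded_mfun_integrable unif (bounded_mfunX 2 bfs)).
- by apply: (bounded_mfun_integrable unif); exact: bounded_mfun_cst.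
by rewrite Rintegral_prob_cst subrr.
Qed.

Let int_dev2 : \int[unif]_s (dev s * dev s) <= (S * Cpsi) ^+ 2 * q.
Proof.
have fsM s : `|fs s| <= S * Cpsi by exact: (fseries_bound (phi_le psiC) cS).
have bE : bounded_mfun (fun s => ((S * Cpsi) ^+ 2 - 2 * e) * fs s ^+ 2 + e ^+ 2).
  by apply: bounded_mfunD; [apply: bounded_mfunM|]; try exact: bounded_mfun_cst; exact: bounded_mfunX.
apply: (@le_trans _ _ (\int[unif]_s (((S * Cpsi) ^+ 2 - 2 * e) * fs s ^+ 2 + e ^+ 2))).
  apply: le_Rintegral => //.
  - exact: (bounded_mfun_integrable unif (bounded_mfunM bdev bdev)).
  - exact: (bounded_mfun_integrable unif bE).
  - move=> s _; have : fs s ^+ 2 <= (S * Cpsi) ^+ 2.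
      rewrite -[leLHS]real_normK ?num_real// lerXn2r ?nnegrE//.
      by rewrite (le_trans _ (fsM s)).
    rewrite /dev => h; have f0 := sqr_ge0 (fs s).
    have := ler_wpM2r f0 h; lra.
have I2 := bounded_mfun_integrable unif (bounded_mfunX 2 bfs).
rewrite RintegralD//; last 2 first.
- by apply: (bounded_mfun_integrable unif); apply: bounded_mfunM; [exact: bounded_mfun_cst | exact: bounded_mfunX].
- by apply: (bounded_mfun_integrable unif); exact: bounded_mfun_cst.
rewrite RintegralZl// -/e Rintegral_prob_cst.
have := ler_wpM2l (sqr_ge0 (S * Cpsi)) e_le; have := sqr_ge0 e; lra.
Qed.

Definition high_deviation w : R := \sum_(p : 'I_m * 'I_n) (fs (X p.1 p.2 w) ^+ 2 - e).

Let bdevX (p : 'I_m * 'I_n) : bounded_mfun (fun w => dev (X p.1 p.2 w)).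
Proof.
have [mdev [M devM]] := bdev; split; last by exists M.
by apply: measurableT_comp => //; exact: (@measurable_funP _ _ _ _ (X p.1 p.2)).
Qed.

Lemma measurable_high_deviation : measurable_fun setT high_deviation.
Proof. by apply: measurable_sum => p; have [] := bdevX p. Qed.

Let dev_off p p' : p != p' ->
  \int[P]_w (dev (X p.1 p.2 w) * dev (X p'.1 p'.2 w)) = 0.
Proof.
move=> pp'; have [mdev _] := bdev.
have := rest_expect indV (u := inl p') (F := fun w => dev (X p.1 p.2 w)) (g := dev).
case.
- apply: measurableT_comp => //.
  by apply: (rest_measurable_RV (V := V) (u := inl p') (v := inl p)).
- exact: mdev.
- exact: (bounded_mfun_integrable P (bdevX p)).
- exact: (bounded_mfun_integrable P (bdevX p')).
move=> _ ->; rewrite [X in _ * X](_ : _ = 0) ?mulr0//.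
exact: (etrans (design_expectation p'.1 p'.2 bdev) int_dev).
Qed.

(** The summands are centered, pairwise uncorrelated, and of variance at most
    [(S Cpsi)^2 q] because [fs^2] is at most [(S Cpsi)^2] with mean at most [q]. *)
Lemma high_deviation_prob :
  (P [set w | (m * n)%:R * q <= `|high_deviation w|]%R <=
   ((S * Cpsi) ^+ 2 / ((m * n)%:R * q))%:E)%E.
Proof.
have mn0 : (0 : R) < (m * n)%:R by rewrite ltr0n muln_gt0 m0.
have -> : (S * Cpsi) ^+ 2 / ((m * n)%:R * q) =
    ((m * n)%:R * ((S * Cpsi) ^+ 2 * q)) / ((m * n)%:R * q) ^+ 2.
  have fl (a N r : R) : 0 < N -> 0 < r -> a / (N * r) = (N * (a * r)) / (N * r) ^+ 2.
    by move=> N0 r0; field; rewrite !gt_eqF.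
  exact: fl.
apply: sqr_chebyshev; [exact: measurable_high_deviation | by rewrite mulr_gt0 |].
rewrite (@orthogonal_sum_sqr _ _ _ P _ (fun p w => dev (X p.1 p.2 w))
  (fun p => \int[unif]_s (dev s * dev s))).
- rewrite lee_fin sumr_const card_prod !card_ord -[leLHS]mulr_natl.
  by rewrite ler_wpM2l// ltW.
- by move=> p p'; exact: (bounded_mfun_integrable P (bounded_mfunM (bdevX p) (bdevX p'))).
- exact: dev_off.
- by move=> p; exact: (design_expectation p.1 p.2 (bounded_mfunM bdev bdev)).
Qed.

Lemma high_deviation_sum w : `|high_deviation w| < (m * n)%:R * q ->
  \sum_k \sum_i fs (X k i w) ^+ 2 <= 2 * ((m * n)%:R * q).
Proof.
rewrite ltr_norml => /andP[_]; rewrite /high_deviation sumrB sumr_const card_prod !card_ord.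
rewrite (pair_big xpredT xpredT (fun k i => fs (X k i w) ^+ 2))/= -[_ *+ _]mulr_natl => h.
have : (m * n)%:R * e <= (m * n)%:R * q by rewrite ler_wpM2l.
lra.
Qed.

End HighFrequency.

Section GoodEvent.
Variables (cL : R) (D : nat).
Hypotheses (cL0 : 0 < cL) (D2 : (2 <= D)%N) (m0 : (0 < m)%N) (n0 : (0 < n)%N).

Local Notation f0 := (truth psi beta cL).
Local Notation s0 := (signal beta B E cL).
Local Notation fhi := (fseries (phi psi) (tail_coef D (fcoef beta cL))).

Let D0 : (0 < D)%N. Proof. exact: leq_trans D2. Qed.

(** With [tail_l2], bounds on the l1 norm and the squared l2 norm of the
    coefficients from [D] on: they control the supremum (up to [Cpsi]) and the
    squared norm of the high frequency part. *)
Definition tail_l1 : R :=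
  cL * (2 `^ (beta - 1 / 2) / (beta - 1 / 2) * D%:R `^ (- (beta - 1 / 2)) / ln D%:R).

Definition tail_l2 : R :=
  cL ^+ 2 * (2 `^ (2 * beta) / (2 * beta) * D%:R `^ (- (2 * beta)) / ln D%:R ^+ 2).

Let tail1 J : \sum_(1 <= j < J) `|tail_coef D (fcoef beta cL) j| <= tail_l1.
Proof.
rewrite (tail_coef_sum (G := fun x => `|x|)) ?normr0//.
under eq_bigr do rewrite ger0_norm ?fcoef_ge0//.
by rewrite -mulr_sumr ler_pM2l// acoef_tail.
Qed.

Let tail2 J : \sum_(1 <= j < J) tail_coef D (fcoef beta cL) j ^+ 2 <= tail_l2.
Proof.
rewrite (tail_coef_sum (G := fun x => x ^+ 2)) ?expr0n//.
under eq_bigr do rewrite exprMn.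
by rewrite -mulr_sumr ler_pM2l ?exprn_gt0// acoef_sqr_tail.
Qed.

Lemma tail_l2_gt0 : 0 < tail_l2.
Proof.
have b := beta2; have lD : (0 : R) < ln D%:R by rewrite ln_gt0// ltr1n.
have DR : (0 : R) < D%:R by rewrite ltr0n.
by rewrite /tail_l2 !mulr_gt0 ?exprn_gt0 ?invr_gt0 ?powR_gt0 ?exprn_gt0//; lra.
Qed.

Hypothesis signal0 : 0 < s0.
Hypothesis low_small :
  (\sum_(1 <= j < D) fcoef beta cL j ^+ 2 / mu j) * tau mu B E <= (s0 / 12) ^+ 2.
Hypothesis high_small :
  tau mu B E / sigma ^+ 2 * (2 * (n%:R * tail_l2)) <= (s0 / 12) ^+ 2.

(** Each of the three parts of the mean component is at most [signal / 12] on [G]: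
    the low frequencies surely, the high frequencies and the noise outside of two
    events controlled by Chebyshev's inequality. *)
Lemma good_event : exists2 G : set T, measurable G &
  (P (~` G) <= ((kappa * tau mu B E) / (s0 / 12) ^+ 2 +
               (tail_l1 * Cpsi) ^+ 2 / ((m * n)%:R * tail_l2))%:E)%E /\
  forall w, G w ->
    `|mean_component sigma K mu psi B E (design X w) (response X eps f0 w)| <= s0 / 4.
Proof.
have mR : (0 : R) < m%:R by rewrite ltr0n.
pose avg_noise w := m%:R^-1 * \sum_k noise k w.
have mnoise : measurable_fun setT avg_noise.
  by apply: measurable_funM => //; apply: measurable_sum => k; exact: measurable_noise.
have noise2 : (\int[P]_w (avg_noise w ^+ 2)%:E <= (kappa * tau mu B E)%:E)%E.
  apply: (avg_sqr_le m0) => k; [exact: measurable_noise | exact: noise_variance].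
have s12 : 0 < s0 / 12 by rewrite divr_gt0.
pose N1 := [set w | s0 / 12 <= `|avg_noise w|].
pose dv := high_deviation (tail_coef D (fcoef beta cL)).
have mdv : measurable_fun setT dv by exact: (measurable_high_deviation tail1).
pose N2 := [set w | (m * n)%:R * tail_l2 <= `|dv w|].
have mN1 : measurable N1 by exact: measurable_norm_ge.
have mN2 : measurable N2 by exact: measurable_norm_ge.
exists (~` (N1 `|` N2)); first by apply: measurableC; exact: measurableU.
split.
  rewrite setCK EFinD; apply: (le_trans (measureU2 _ mN1 mN2)); apply: leeD.
    exact: sqr_chebyshev.
  exact: (high_deviation_prob tail1 tail2 tail_l2_gt0 m0 n0).
move=> w /not_orP[/negP]; rewrite -ltNge => nz /negP; rewrite -ltNge => hi.
have hisum := high_deviation_sum tail1 tail2 hi.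
have [S fS] := fcoef_summable beta2 cL0.
pose low k := \sum_i (\sum_(1 <= j < D) fcoef beta cL j * psi j (X k i w)) * v k w i.
pose high k := \sum_i fhi (X k i w) * v k w i.
have -> : mean_component sigma K mu psi B E (design X w) (response X eps f0 w) =
    m%:R^-1 * \sum_k low k + m%:R^-1 * \sum_k high k + avg_noise w.
  rewrite /mean_component /avg_noise -!mulrDr -!big_split/=; congr (_ * _).
  apply: eq_bigr => k _; rewrite /low /high /noise -!big_split/=; apply: eq_bigr => i _.
  rewrite -mulrDl [v k w i * _]mulrC -mulrDl /response; congr ((_ + _) * _).
  have x01 : X k i w \in `[0, 1] by exact: (X01 w k i).
  rewrite (truthE beta2 psiC cL0 x01) (fseries_split _ psiC fS tail1 D0).
  by congr (_ + _); apply: eq_bigr => j _; rewrite phiE.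
have s12' := ltW s12.
have lowb : `|m%:R^-1 * \sum_k low k| <= s0 / 12.
  rewrite -(@ler_sqr _ `|_|) ?nnegrE// real_normK ?num_real//.
  apply: (avg_sqr_bound m0) => k; apply: le_trans low_small.
  exact: (weights_low_le sigma0 Kexp C0 muC E B0 (X01 w k)).
have highb : `|m%:R^-1 * \sum_k high k| <= s0 / 12.
  rewrite -(@ler_sqr _ `|_|) ?nnegrE// real_normK ?num_real//.
  apply: le_trans high_small.
  apply: (@le_trans _ _ (m%:R^-1 * \sum_k (tau mu B E / sigma ^+ 2 * \sum_i fhi (X k i w) ^+ 2))).
    apply: (le_trans (sqr_avg_le m0 _)); rewrite ler_pM2l ?invr_gt0//.
    apply: ler_sum => k _.
    exact: (weights_high_le sigma0 Kexp C0 muC E B0 (X01 w k)).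
  rewrite -mulr_sumr mulrCA ler_wpM2l ?divr_ge0 ?sqr_ge0 ?(tau_ge0 C0 muC)//.
  by rewrite ler_pdivrMl// (le_trans hisum)// natrM; rewrite le_eqVlt; apply/orP; left; apply/eqP; ring.
apply: (le_trans (ler_normD _ _)); apply: (le_trans (lerD (ler_normD _ _) (lexx _))).
have := nz; have := lowb; have := highb; have := s12; lra.
Qed.

End GoodEvent.

End Experiment.

End Design.

(** * Integrals of possibly nonmeasurable functions *)

Section LowerIntegral.
Context d (T : measurableType d) (R : realType) (P : probability T R).

(** The integral of a nonnegative function is a supremum over the simple functions
    below it, hence monotone even if the functions are not measurable.  This
    matters because the space carrying the posterior draws is an arbitrary
    function of the data. *)
Lemma lower_integral_mono (f g : T -> \bar R) :
  (forall w, 0 <= f w)%E -> (forall w, f w <= g w)%E ->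
  (\int[P]_w f w <= \int[P]_w g w)%E.
Proof.
move=> f0 fg; have g0 w : (0 <= g w)%E := le_trans (f0 w) (fg w).
rewrite !ge0_integralTE//; apply: ereal_sup_le => _ [h hf <-].
by exists h => // w; exact: le_trans (hf w) (fg w).
Qed.

Lemma integral_ge_on (G : set T) (F : T -> \bar R) (r : R) : measurable G -> 0 <= r ->
  (forall w, 0 <= F w)%E -> (forall w, G w -> (r%:E <= F w)%E) ->
  (r%:E * P G <= \int[P]_w F w)%E.
Proof.
move=> mG r0 F0 rF.
have -> : (r%:E * P G = \int[P]_w (r%:E * (\1_G w)%:E))%E.
  rewrite ge0_integralZl//; last by apply/measurable_EFinP; exact: measurable_indic.
  by rewrite integral_indic// setIT.
apply: lower_integral_mono => w; first by rewrite mule_ge0// lee_fin.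
rewrite indicE; have [wG|wG] := boolP (w \in G); last by rewrite mule0.
by rewrite mule1; apply: rF; exact/set_mem.
Qed.

Lemma integral_le_on (G : set T) (F : T -> \bar R) (r : R) : measurable G -> 0 <= r ->
  (forall w, 0 <= F w <= 1)%E -> (forall w, G w -> (F w <= r%:E)%E) ->
  (\int[P]_w F w <= r%:E + P (~` G))%E.
Proof.
move=> mG r0 F01 Fr.
have mGC : measurable (~` G) by exact: measurableC.
have -> : (r%:E + P (~` G) = \int[P]_w (r%:E + (\1_(~` G) w)%:E))%E.
  rewrite ge0_integralD//; last first.
    by apply/measurable_EFinP; exact: measurable_indic.
  rewrite integral_cst// integral_indic// setIT; congr (_ + _)%E.
  by rewrite [X in (_ * X)%E](_ : _ = 1%E) ?mule1//; exact: probability_setT.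
apply: lower_integral_mono => w; first by have /andP[] := F01 w.
have [wG|wG] := pselect (G w).
  by apply: le_trans (Fr w wG) _; rewrite leeDl// lee_fin.
rewrite indicE mem_set//; have /andP[_ F1] := F01 w; apply: (le_trans F1).
by rewrite leeDr// lee_fin.
Qed.

End LowerIntegral.

(** * Orders of magnitude *)
Section Orders.
Context {R : realType}.

Lemma powRN_le (p x y : R) : 0 <= p -> 0 < x -> x <= y -> y `^ (- p) <= x `^ (- p).
Proof.
move=> p0 x0 xy; have y0 := lt_le_trans x0 xy.
by rewrite !powRN lef_pV2 ?posrE ?powR_gt0// ge0_ler_powR ?nnegrE ?(ltW x0) ?(ltW y0).
Qed.

Variables (beta : R) (mu : nat -> R) (C : R).
Hypothesis beta2 : 2 <= beta.
Hypothesis C0 : 0 < C.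
Hypothesis muC : forall j, (0 < j)%N ->
     C^-1 * j%:R `^ (- 1 - 2 * beta) <= mu j <= C * j%:R `^ (- 1 - 2 * beta).

Lemma powR_decay B : (0 < B)%N ->
  B%:R * B%:R `^ (- 1 - 2 * beta) = B%:R `^ (- (2 * beta)) :> R.
Proof.
move=> B0; have BR : (0 : R) < B%:R by rewrite ltr0n.
rewrite -[X in X * _](powRr1 (ltW BR)) -powRD; last by apply/implyP => _; rewrite gt_eqF.
by congr (_ `^ _); ring.
Qed.

Lemma tau_le B : (0 < B)%N -> tau mu B (2 * B) <= C * B%:R `^ (- (2 * beta)).
Proof.
move=> B0; have BR : (0 : R) < B%:R by rewrite ltr0n.
apply: (@le_trans _ _ (\sum_(B <= j < 2 * B) C * B%:R `^ (- 1 - 2 * beta))).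
  apply: ler_sum_nat => j /andP[Bj _]; have j0 := leq_trans B0 Bj.
  have /andP[_ h] := muC j0; apply: (le_trans h); rewrite ler_pM2l//.
  rewrite (_ : - 1 - 2 * beta = - (1 + 2 * beta)); last by ring.
  by apply: powRN_le; rewrite ?ler_nat//; have := beta2; lra.
rewrite sumr_const_nat mul2n -addnn addnK -[leLHS]mulr_natl -(powR_decay B0).
by rewrite mulrCA.
Qed.

Variable cL : R.
Hypothesis cL0 : 0 < cL.

Lemma signal_ge B l : (2 <= B)%N -> 0 < l -> ln (2 * B)%:R <= 2 * l ->
  cL * (B%:R * ((2 * B)%:R `^ (- (1 / 2) - beta) / (2 * l))) <= signal beta B (2 * B) cL.
Proof.
move=> B2 l0 lB; have B0 : (0 < B)%N by rewrite (leq_trans _ B2).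
have -> : B%:R * ((2 * B)%:R `^ (- (1 / 2) - beta) / (2 * l)) =
    \sum_(B <= j < 2 * B) (2 * B)%:R `^ (- (1 / 2) - beta) / (2 * l).
  by rewrite sumr_const_nat mul2n -addnn addnK -[RHS]mulr_natl.
rewrite mulr_sumr; apply: ler_sum_nat => j /andP[Bj jB].
have j0 := leq_trans B0 Bj; have jR : (0 : R) < j%:R by rewrite ltr0n.
have lj : 0 < ln j%:R :> R by rewrite ln_gt0// ltr1n (leq_trans B2).
rewrite ler_pM2l// ler_pM ?powR_ge0 ?invr_ge0 ?mulr_ge0 ?(ltW l0)//.
  rewrite (_ : - (1 / 2) - beta = - (1 / 2 + beta)); last by ring.
  by apply: powRN_le; rewrite ?ler_nat ?(ltnW jB)//; have := beta2; lra.
rewrite lef_pV2 ?posrE ?mulr_gt0// (le_trans _ lB)// ler_ln ?posrE ?ltr0n ?muln_gt0//.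
by rewrite ler_nat ltnW.
Qed.

Definition signal_const : R := 2 `^ (- 1 - 2 * beta) / 4.

Lemma signal_const_gt0 : 0 < signal_const.
Proof. by rewrite divr_gt0// powR_gt0. Qed.

(** In the use below [l] is the logarithm of the cutoff, which [ln (2 B)] exceeds
    by a factor at most 2. *)
Lemma signal_sqr_ge B l : (2 <= B)%N -> 0 < l -> ln (2 * B)%:R <= 2 * l ->
  0 < signal beta B (2 * B) cL /\
  cL ^+ 2 * signal_const * B%:R * B%:R `^ (- (2 * beta)) / l ^+ 2 <=
  signal beta B (2 * B) cL ^+ 2.
Proof.
move=> B2 l0 lB; have h := signal_ge B2 l0 lB.
have B0 : (0 < B)%N by rewrite (leq_trans _ B2).
have BR : (0 : R) < B%:R by rewrite ltr0n.
have BB : (0 : R) < (2 * B)%:R by rewrite ltr0n muln_gt0.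
have low0 : 0 < cL * (B%:R * ((2 * B)%:R `^ (- (1 / 2) - beta) / (2 * l))).
  by rewrite !mulr_gt0// ?powR_gt0// invr_gt0 mulr_gt0.
split; first exact: lt_le_trans h.
have -> : cL ^+ 2 * signal_const * B%:R * B%:R `^ (- (2 * beta)) / l ^+ 2 =
   (cL * (B%:R * ((2 * B)%:R `^ (- (1 / 2) - beta) / (2 * l)))) ^+ 2.
  have e : (2 * B)%:R `^ (- (1 / 2) - beta) ^+ 2 =
      2 `^ (- 1 - 2 * beta) * B%:R `^ (- 1 - 2 * beta).
    rewrite -powR_mulrn ?powR_ge0// -powRrM natrM powRM ?ler0n//.
    by rewrite (_ : (- (1 / 2) - beta) * 2%:R = - 1 - 2 * beta)//; lra.
  rewrite -(powR_decay B0) /signal_const !exprMn exprVn exprMn e.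
  by field; rewrite gt_eqF.
by rewrite lerXn2r ?nnegrE ?(ltW low0)// (le_trans (ltW low0)).
Qed.

(** Up to constants [f_j^2 / mu_j] is [1 / ln^2 j]: the powers of [j] cancel. *)
Lemma low_energy_le C1 D :
  (forall D, (2 <= D)%N ->
     \sum_(2 <= j < D) (ln j%:R ^+ 2)^-1 <= C1 * D%:R / ln D%:R ^+ 2 :> R) ->
  (2 <= D)%N ->
  \sum_(1 <= j < D) fcoef beta cL j ^+ 2 / mu j <=
  cL ^+ 2 * C * (C1 * D%:R / ln D%:R ^+ 2).
Proof.
move=> C1D D2; rewrite big_ltn// {1}/fcoef acoef1 mulr0 expr0n mul0r add0r.
apply: (@le_trans _ _ (\sum_(2 <= j < D) cL ^+ 2 * C * (ln j%:R ^+ 2)^-1)).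
  apply: ler_sum_nat => j /andP[j2 _]; have j0 : (0 < j)%N by rewrite (leq_trans _ j2).
  have m0 := mu_gt0 C0 muC j0; have /andP[mj _] := muC j0.
  have lj : 0 < ln j%:R :> R by rewrite ln_gt0// ltr1n.
  rewrite ler_pdivrMr// /fcoef /acoef !exprMn exprVn -mulrA.
  rewrite -(powR_mulrn 2 (powR_ge0 _ _)) -powRrM.
  rewrite (_ : (- (1 / 2) - beta) * 2%:R = - 1 - 2 * beta); last by lra.
  rewrite -[leRHS]mulrA ler_pM2l ?exprn_gt0// [leRHS]mulrAC ler_pM2r ?invr_gt0 ?exprn_gt0//.
  by rewrite -ler_pdivrMl.
rewrite -mulr_sumr ler_pM2l ?mulr_gt0 ?exprn_gt0//; exact: C1D.
Qed.

End Orders.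

(** * A single experiment *)
Section SingleExperiment.
Context {R : realType}.
Variables (beta sigma : R) (K : R -> R -> R) (mu : nat -> R) (psi : nat -> R -> R) (Cpsi C : R).
Hypothesis beta2 : 2 <= beta.
Hypothesis sigma0 : 0 < sigma.
Hypothesis Kpd : positive_definite K.
Hypothesis onb : orthonormal_basis psi.
Hypothesis Kexp : kernel_expansion K mu psi.
Hypothesis psiC : forall j (t : R), (0 < j)%N -> t \in `[0, 1] -> `|psi j t| <= Cpsi.
Hypothesis C0 : 0 < C.
Hypothesis muC : forall j, (0 < j)%N ->
     C^-1 * j%:R `^ (- 1 - 2 * beta) <= mu j <= C * j%:R `^ (- 1 - 2 * beta).
Variable C1 : R.
Hypothesis C1D : forall D, (2 <= D)%N ->
     \sum_(2 <= j < D) (ln j%:R ^+ 2)^-1 <= C1 * D%:R / ln D%:R ^+ 2 :> R.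

Local Notation k1 := (signal_const beta).

Definition l1_const : R := 2 `^ (beta - 1 / 2) / (beta - 1 / 2).
Definition l2_const : R := 2 `^ (2 * beta) / (2 * beta).

(** [lambda] is the ratio between the lowest frequency of the block and the cutoff
    [D].  The squared signal is proportional to [lambda D], the contributions of
    the frequencies below and above [D] to [D] alone. *)
Variable lambda : nat.
Hypothesis lambda0 : (0 < lambda)%N.
Hypothesis lambda_low : 144 * (C ^+ 2 * C1) <= k1 * lambda%:R.
Hypothesis lambda_high : 288 * (C * l2_const) <= k1 * lambda%:R * sigma ^+ 2.

Variables (cL : R).
Hypothesis cL0 : 0 < cL.

Let k10 : 0 < k1. Proof. exact: signal_const_gt0. Qed.
Let l20 : 0 < l2_const.
Proof. by have := beta2 => b; rewrite divr_gt0 ?powR_gt0//; lra. Qed.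

Section Cutoff.
Variable D : nat.
Hypothesis D2 : (2 <= D)%N.
Hypothesis D_lambda : (2 * lambda <= D)%N.

Local Notation B := (lambda * D)%N.
Local Notation E := (2 * B)%N.
Local Notation l := (ln D%:R : R).
Local Notation w := (B%:R `^ (- (2 * beta)) : R).
Local Notation s0 := (signal beta B E cL).

Let D0' : (0 < D)%N. Proof. exact: leq_trans D2. Qed.
Let D0 : (0 : R) < D%:R. Proof. by rewrite ltr0n. Qed.
Let l0 : 0 < l. Proof. by rewrite ln_gt0// ltr1n. Qed.
Let B2 : (2 <= B)%N. Proof. by rewrite (leq_trans D2)// leq_pmull. Qed.
Let B0 : (0 < B)%N. Proof. exact: leq_trans B2. Qed.
Let w0 : 0 < w. Proof. by rewrite powR_gt0// ltr0n. Qed.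
Let lambdaR : (0 : R) < lambda%:R. Proof. by rewrite ltr0n. Qed.

Let lB : ln E%:R <= 2 * l.
Proof.
rewrite mulr_natl -lnXn// -natrX ler_ln ?posrE ?ltr0n ?muln_gt0 ?expn_gt0 ?D0' ?lambda0//.
by rewrite ler_nat mulnA expnS expn1 leq_mul2r D_lambda orbT.
Qed.

Let s0_gt0 : 0 < s0. Proof. exact: (signal_sqr_ge beta2 cL0 B2 l0 lB).1. Qed.

Let s0_sqr : cL ^+ 2 * k1 * (lambda%:R * D%:R) * w / l ^+ 2 <= s0 ^+ 2.
Proof. by rewrite -natrM; exact: (signal_sqr_ge beta2 cL0 B2 l0 lB).2. Qed.

Let tau_w : tau mu B E <= C * w. Proof. exact: tau_le. Qed.

Let tau0 : 0 <= tau mu B E. Proof. by apply: (tau_ge0 C0 muC). Qed.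

(** Common scale: the squared signal is at least [k1 * lambda * X], the other
    contributions are at most constants times [X]. *)
Let X : R := cL ^+ 2 * w * D%:R / l ^+ 2.

Let X0 : 0 < X. Proof. by rewrite /X !mulr_gt0// ?exprn_gt0// invr_gt0 exprn_gt0. Qed.

Let s0_X : k1 * lambda%:R * X <= s0 ^+ 2.
Proof. by apply: le_trans s0_sqr; rewrite /X le_eqVlt; apply/orP; left; apply/eqP; ring. Qed.

Let low_small :
  (\sum_(1 <= j < D) fcoef beta cL j ^+ 2 / mu j) * tau mu B E <= (s0 / 12) ^+ 2.
Proof.
have h := low_energy_le C0 muC cL0 C1D D2.
apply: (@le_trans _ _ (cL ^+ 2 * C * (C1 * D%:R / l ^+ 2) * (C * w))).
  apply: ler_pM => //.
  rewrite big_nat_cond sumr_ge0// => j /andP[/andP[j0 _] _].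
  by rewrite divr_ge0 ?sqr_ge0// ltW// (mu_gt0 C0 muC).
have -> : cL ^+ 2 * C * (C1 * D%:R / l ^+ 2) * (C * w) = C ^+ 2 * C1 * X by rewrite /X; ring.
have := ler_wpM2r (ltW X0) lambda_low.
have := s0_X; rewrite exprMn; lra.
Qed.

Let high_small n : n%:R <= D%:R * D%:R `^ (2 * beta) ->
  tau mu B E / sigma ^+ 2 * (2 * (n%:R * tail_l2 beta cL D)) <= (s0 / 12) ^+ 2.
Proof.
move=> nD; have s2 : 0 < sigma ^+ 2 by rewrite exprn_gt0.
have t2 : n%:R * tail_l2 beta cL D <= cL ^+ 2 * l2_const * D%:R / l ^+ 2.
  rewrite /tail_l2 -/l2_const.
  have -> : n%:R * (cL ^+ 2 * (l2_const * D%:R `^ (- (2 * beta)) / l ^+ 2)) =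
     (cL ^+ 2 * l2_const / l ^+ 2) * (n%:R * D%:R `^ (- (2 * beta))) by ring.
  have -> : cL ^+ 2 * l2_const * D%:R / l ^+ 2 = (cL ^+ 2 * l2_const / l ^+ 2) * D%:R by ring.
  have c0 : 0 <= cL ^+ 2 * l2_const / l ^+ 2.
    by rewrite divr_ge0 ?sqr_ge0// mulr_ge0 ?sqr_ge0// ltW.
  rewrite (ler_wpM2l c0)//.
  by rewrite powRN ler_pdivrMr// powR_gt0.
apply: (@le_trans _ _ (C * w / sigma ^+ 2 * (2 * (cL ^+ 2 * l2_const * D%:R / l ^+ 2)))).
  apply: ler_pM => //.
  - by rewrite divr_ge0// ltW.
  - by rewrite mulr_ge0// mulr_ge0// ltW// tail_l2_gt0.
  - by rewrite ler_pM2r ?invr_gt0.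
  - by rewrite ler_pM2l.
have -> : C * w / sigma ^+ 2 * (2 * (cL ^+ 2 * l2_const * D%:R / l ^+ 2)) =
   2 * (C * l2_const) * X / sigma ^+ 2 by rewrite /X; ring.
rewrite ler_pdivrMr//.
have := ler_wpM2r (ltW X0) lambda_high.
have := ler_wpM2r (ltW s2) s0_X; rewrite exprMn.
set a := s0 ^+ 2; set b := sigma ^+ 2.
rewrite (_ : k1 * lambda%:R * X * b = k1 * lambda%:R * b * X); last by ring.
lra.
Qed.

(** [2304 = 144 * 16], where 144 comes from the thresholds [signal / 12] and 16 from
    [ln^2 x <= 16 * sqrt x]. *)
Definition error_const : R :=
  2304 * (kappa * C / (cL ^+ 2 * k1)) + (l1_const * Cpsi) ^+ 2 / l2_const * 2 `^ (1 + 2 * beta).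

Let noise_const_ge0 : 0 <= kappa * C / (cL ^+ 2 * k1).
Proof.
apply: divr_ge0; first by rewrite mulr_ge0 ?kappa_ge0 ?ltW.
by rewrite mulr_ge0 ?sqr_ge0 ?(ltW k10).
Qed.

Let lD : l ^+ 2 / D%:R <= 16 / Num.sqrt D%:R.
Proof.
have D1 : (1 : R) <= D%:R by rewrite ler1n (leq_trans _ D2).
have sD : 0 < Num.sqrt D%:R :> R by rewrite sqrtr_gt0.
rewrite ler_pdivrMr// (le_trans (ln_sqr_le_sqrt D1))//.
by rewrite -[X in _ / _ * X](sqr_sqrtr (ltW D0)) expr2 mulrA mulfVK// gt_eqF.
Qed.

Let noise_small a : 0 < a -> a <= 144 ->
  kappa * tau mu B E / s0 ^+ 2 * a <=
  2304 * (kappa * C / (cL ^+ 2 * k1)) / Num.sqrt D%:R.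
Proof.
move=> a0 a144.
have kX : 0 < k1 * lambda%:R * X by rewrite mulr_gt0// mulr_gt0.
have s2 : 0 < s0 ^+ 2 by rewrite exprn_gt0.
have k0 : 0 <= kappa :> R by exact: kappa_ge0.
apply: (@le_trans _ _ (kappa * (C * w) / (k1 * lambda%:R * X) * 144)).
  apply: ler_pM; [|exact: ltW| |exact: a144].
    by apply: divr_ge0; [exact: mulr_ge0 | exact: ltW].
  apply: ler_pM; [exact: mulr_ge0 | by rewrite invr_ge0 ltW | exact: ler_wpM2l |].
  by rewrite lef_pV2 ?posrE.
have -> : kappa * (C * w) / (k1 * lambda%:R * X) * 144 =
   144 * (kappa * C / (cL ^+ 2 * k1)) * (l ^+ 2 / D%:R) * lambda%:R^-1.
  have fl (k c w' k' la cl dd ll : R) : 0 < w' -> 0 < k' -> 0 < la -> 0 < cl ->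
      0 < dd -> 0 < ll -> k * (c * w') / (k' * la * (cl ^+ 2 * w' * dd / ll ^+ 2)) * 144 =
      144 * (k * c / (cl ^+ 2 * k')) * (ll ^+ 2 / dd) * la^-1.
    by move=> ? ? ? ? ? ?; field; rewrite !gt_eqF.
  exact: fl.
apply: (@le_trans _ _ (144 * (kappa * C / (cL ^+ 2 * k1)) * (l ^+ 2 / D%:R))).
  apply: ler_piMr; last by rewrite invf_le1// ler1n.
  apply: mulr_ge0; last by apply: divr_ge0; [exact: sqr_ge0 | exact: ltW].
  by rewrite mulr_ge0.
have Y0 := noise_const_ge0.
have := ler_wpM2l Y0 lD; lra.
Qed.

Lemma powR_half : D%:R `^ (- (beta - 1 / 2)) ^+ 2 = D%:R * D%:R `^ (- (2 * beta)) :> R.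
Proof.
rewrite -(powR_mulrn 2 (powR_ge0 _ _)) -powRrM.
rewrite -[in RHS](powRr1 (ltW D0)) -powRrM -powRD; last by apply/implyP => _; rewrite gt_eqF.
by congr (_ `^ _); rewrite [2%:R]/=; lra.
Qed.

Let design_small m n : (0 < m)%N -> (0 < n)%N ->
  D%:R * D%:R `^ (2 * beta) <= 2 `^ (1 + 2 * beta) * n%:R :> R ->
  (tail_l1 beta cL D * Cpsi) ^+ 2 / ((m * n)%:R * tail_l2 beta cL D) <=
  (l1_const * Cpsi) ^+ 2 / l2_const * 2 `^ (1 + 2 * beta) / Num.sqrt D%:R.
Proof.
move=> m0 n0 nD.
have mR : (1 : R) <= m%:R by rewrite ler1n.
have nR : (0 : R) < n%:R by rewrite ltr0n.
have z0 : (0 : R) < D%:R `^ (- (2 * beta)) by rewrite powR_gt0.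
have fl (cl l1 cp hp dd ll l2 z mm nn : R) : hp ^+ 2 = dd * z -> 0 < cl -> 0 < ll ->
    0 < l2 -> 0 < z -> 0 < mm -> 0 < nn ->
    (cl * (l1 * hp / ll) * cp) ^+ 2 / (mm * nn * (cl ^+ 2 * (l2 * z / ll ^+ 2))) =
    (l1 * cp) ^+ 2 / l2 * (dd / nn) * mm^-1.
  move=> e *; rewrite [LHS](_ : _ = (cl * l1 / ll * cp) ^+ 2 * hp ^+ 2 /
     (mm * nn * (cl ^+ 2 * (l2 * z / ll ^+ 2)))).
    by rewrite e; field; rewrite !gt_eqF.
  by congr (_ / _); ring.
rewrite natrM /tail_l1 /tail_l2 -/l1_const -/l2_const.
rewrite (fl _ _ _ _ D%:R _ _ _ _ _ powR_half)//; last exact: lt_le_trans mR.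
have Y0 : 0 <= (l1_const * Cpsi) ^+ 2 / l2_const by rewrite divr_ge0 ?sqr_ge0 ?(ltW l20).
apply: (@le_trans _ _ ((l1_const * Cpsi) ^+ 2 / l2_const * (D%:R / n%:R))).
  apply: ler_piMr; last by rewrite invf_le1// (lt_le_trans _ mR).
  by rewrite mulr_ge0// divr_ge0 ?ltW.
rewrite -[leRHS]mulrA ler_wpM2l//.
have D1 : (1 : R) <= D%:R by rewrite ler1n.
have sD : 0 < Num.sqrt D%:R :> R by rewrite sqrtr_gt0.
rewrite ler_pdivrMr// mulrAC ler_pdivlMr//; apply: le_trans nD.
rewrite ler_pM2l//; apply: (@le_trans _ _ (Num.sqrt D%:R ^+ 2)).
  rewrite expr2 ler_peMl ?(ltW sD)//.
  by rewrite -[leLHS]sqrtr1 ler_wsqrtr.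
rewrite (sqr_sqrtr (ltW D0)) -[leLHS](powRr1 (ltW D0)).
by apply: ler_powR => //; have := beta2; lra.
Qed.

Let rate_le m n : (0 < m)%N -> (0 < n)%N -> (D <= n)%N ->
  D%:R * D%:R `^ (2 * beta) <= 2 `^ (1 + 2 * beta) * n%:R :> R ->
  rate beta m n <= (2 * lambda%:R) `^ (2 * beta) * w / l ^+ 2.
Proof.
move=> m0 n0 Dn nD; rewrite /rate.
have nR : (0 : R) < n%:R by rewrite ltr0n.
have mR : (0 : R) < m%:R by rewrite ltr0n.
have b := beta2.
rewrite [leRHS]mulrC natrM mulfK ?gt_eqF//; apply: ler_pM.
- by rewrite invr_ge0 sqr_ge0.
- exact: powR_ge0.
- rewrite lef_pV2 ?posrE ?exprn_gt0//; last first.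
    by rewrite -natrM ln_gt0// ltr1n (leq_trans D2)// (leq_trans Dn)// leq_pmulr.
  rewrite lerXn2r ?nnegrE ?(ltW l0)//.
    by rewrite -natrM ln_ge0// ler1n muln_gt0 n0.
  rewrite -natrM ler_ln ?posrE ?ltr0n ?muln_gt0 ?n0//.
  by rewrite ler_nat (leq_trans Dn)// leq_pmulr.
- have dR : (0 : R) < D%:R / 2 by rewrite divr_gt0.
  have e : (2 * lambda%:R) `^ (2 * beta) * w = (D%:R / 2) `^ (- (2 * beta)) :> R.
    have la : (0 : R) < 2 * lambda%:R by rewrite mulr_gt0.
    rewrite (_ : B%:R = 2 * lambda%:R * (D%:R / 2)); last by rewrite natrM; field.
    rewrite [(2 * lambda%:R * (D%:R / 2)) `^ _]powRM ?(ltW la) ?(ltW dR)// mulrA -powRD; last by apply/implyP => _; rewrite gt_eqF.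
    by rewrite subrr powRr0 mul1r.
  rewrite e.
  have h : (D%:R / 2) `^ (1 + 2 * beta) <= n%:R :> R.
    rewrite -(@ler_pM2l _ (2 `^ (1 + 2 * beta))) ?powR_gt0// -powRM ?(ltW dR)// (mulrC 2) divfK//.
    apply: le_trans nD; rewrite powRD; last by apply/implyP => _; rewrite gt_eqF.
    by rewrite powRr1 ?(ltW D0).
  rewrite (_ : - (2 * beta) / (1 + 2 * beta) = - (2 * beta / (1 + 2 * beta))); last by rewrite mulNr.
  apply: (@le_trans _ _ (((D%:R / 2) `^ (1 + 2 * beta)) `^ (- (2 * beta / (1 + 2 * beta))))).
    by apply: powRN_le; rewrite ?powR_gt0// divr_ge0; lra.
  rewrite -powRrM (_ : (1 + 2 * beta) * _ = - (2 * beta))//.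
  by field; apply/eqP; lra.
Qed.

Definition rate_const : R := cL ^+ 2 * k1 / (16 * (2 * lambda%:R) `^ (2 * beta)).

Lemma rate_const_gt0 : 0 < rate_const.
Proof. by rewrite divr_gt0 ?mulr_gt0 ?exprn_gt0 ?powR_gt0// mulr_gt0. Qed.

Let threshold_le m n c : (0 < m)%N -> (0 < n)%N -> (D <= n)%N ->
  D%:R * D%:R `^ (2 * beta) <= 2 `^ (1 + 2 * beta) * n%:R :> R ->
  0 < c <= rate_const ->
  c * rate beta m n * (E - B)%:R <= s0 ^+ 2 / 16.
Proof.
move=> m0 n0 Dn nD /andP[c0 cle].
have r := rate_le m0 n0 Dn nD.
have rate0 : 0 <= rate beta m n :> R by rewrite mulr_ge0 ?powR_ge0// invr_ge0 sqr_ge0.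
have u0 : 0 < (2 * lambda%:R) `^ (2 * beta) :> R by rewrite powR_gt0// mulr_gt0.
rewrite (_ : (E - B)%N = B); last by rewrite mul2n -addnn addnK.
apply: (@le_trans _ _ (rate_const * ((2 * lambda%:R) `^ (2 * beta) * w / l ^+ 2) * B%:R)).
  apply: ler_wpM2r => //; apply: ler_pM => //; exact: ltW.
apply: (@le_trans _ _ (k1 * lambda%:R * X / 16)); last by rewrite ler_pM2r.
rewrite /rate_const /X natrM le_eqVlt; apply/orP; left; apply/eqP.
have fl (cl k u w' ll la dd : R) : 0 < u -> 0 < ll -> cl ^+ 2 * k / (16 * u) * (u * w' / ll ^+ 2) * (la * dd) =
    k * la * (cl ^+ 2 * w' * dd / ll ^+ 2) / 16.
  by move=> ? ?; field; rewrite !gt_eqF.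
exact: fl.
Qed.

(** The conditions on [D] say that it is [n^(1 / (1 + 2 beta))] up to constants.
    The factor 2 in the risk makes up for the probability of the complement of
    [G], at most 1/2 in the limit. *)
Lemma single_experiment d (Omega : measurableType d) (P : probability Omega R) (m n : nat)
    (X_ eps : 'I_m -> 'I_n -> {RV P >-> R}) d' (T : measurableType d')
    (Q : ('I_m -> 'I_n -> R) -> ('I_m -> 'I_n -> R) -> probability T R)
    (f : ('I_m -> 'I_n -> R) -> ('I_m -> 'I_n -> R) -> 'I_m -> R -> T -> R) (c : R) :
  (0 < m)%N -> (0 < n)%N -> (D <= n)%N ->
  n%:R <= D%:R * D%:R `^ (2 * beta) :> R ->
  D%:R * D%:R `^ (2 * beta) <= 2 `^ (1 + 2 * beta) * n%:R :> R ->
  0 < c <= rate_const ->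
  regression_model sigma X_ eps ->
  (forall x y : 'I_m -> 'I_n -> R, (forall k i, x k i \in `[0, 1]) ->
     naive_draws K sigma x y (Q x y) (f x y)) ->
  let f0 := truth psi beta cL in
  let x := design X_ in
  let y := response X_ eps f0 in
  exists2 G : set Omega, measurable G &
  (P (~` G) <= (error_const / Num.sqrt D%:R)%:E)%E /\
  forall w, G w ->
   (aggregated_posterior (Q (x w) (y w)) (f (x w) (y w))
      [set g | (sqnormL2 (fun s => g s - f0 s)%R <= (c * rate beta m n)%:E)%E] <=
    (error_const / Num.sqrt D%:R)%:E)%E /\
   ((2 * (c * rate beta m n))%:E <=
     sqnormL2 (fun s => aggregated_mean (Q (x w) (y w)) (f (x w) (y w)) s - f0 s)%R)%E.
Proof.
move=> m0 n0 Dn nD nD' c0 model draws f0 x y.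
have sD : 0 < Num.sqrt D%:R :> R by rewrite sqrtr_gt0.
have s12 (a : R) : 0 < a -> kappa * tau mu B E / (s0 / a) ^+ 2 = kappa * tau mu B E / s0 ^+ 2 * a ^+ 2.
  by move=> a0; rewrite expr_div_n invf_div mulrA mulrAC.
have [G mG [PG meanG]] := good_event beta2 sigma0 onb Kexp psiC C0 muC B0 model cL0 D2 m0 n0
  s0_gt0 low_small (high_small nD).
exists G => //; split.
  apply: (le_trans PG); rewrite lee_fin s12// /error_const mulrDl; apply: lerD.
    by apply: noise_small; rewrite ?exprn_gt0//; lra.
  exact: design_small.
move=> w' Gw; have mean_small := meanG w' Gw.
have x01 k i : x w' k i \in `[0, 1] by have [+ _ _ _] := model; exact.
have [Hf _] := draws _ (y w') x01.
have th := threshold_le m0 n0 Dn nD' c0.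
split.
  apply: (le_trans (aggregated_posterior_le beta2 sigma0 Kpd onb Kexp psiC C0 muC B0 x01 Hf m0 cL0
    s0_gt0 mean_small th)).
  rewrite lee_fin s12//; apply: (@le_trans _ _ (2304 * (kappa * C / (cL ^+ 2 * k1)) / Num.sqrt D%:R)).
    by apply: noise_small; rewrite ?exprn_gt0//; lra.
  rewrite ler_pM2r ?invr_gt0// /error_const lerDl.
  by apply: mulr_ge0; [apply: divr_ge0; [exact: sqr_ge0 | exact: ltW] | exact: powR_ge0].
have BE : (B < E)%N by rewrite mul2n -addnn -[X in (X < _)%N]addn0 ltn_add2l.
apply: le_trans (aggregated_mean_risk_ge beta2 sigma0 Kpd onb Kexp psiC C0 muC B0 x01 Hf BE cL0
    s0_gt0 mean_small).
have EB : (0 : R) < (E - B)%:R by rewrite ltr0n subn_gt0.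
rewrite lee_fin ler_pdivlMr// -mulrA exprMn.
have := sqr_ge0 s0; move: th; lra.
Qed.

End Cutoff.

End SingleExperiment.

(** * Choice of the cutoff and conclusion *)

Section Cutoff.
Context {R : realType}.
Variable beta : R.
Hypothesis beta2 : 2 <= beta.

Local Notation a := (1 / (1 + 2 * beta)).

Definition cutoff (n : nat) : nat := (Num.truncn ((n%:R : R) `^ a)).+1.

Let b0 : 0 < 1 + 2 * beta. Proof. by have := beta2; lra. Qed.
Let a0 : 0 <= a. Proof. by rewrite divr_ge0// ltW. Qed.

Let powR_invK (x : R) : 0 <= x -> (x `^ a) `^ (1 + 2 * beta) = x.
Proof. by move=> x0; rewrite -powRrM mul1r mulVf ?gt_eqF// powRr1. Qed.

Let powR_exp (x : R) : 0 < x -> x * x `^ (2 * beta) = x `^ (1 + 2 * beta).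
Proof.
by move=> x0; rewrite powRD ?powRr1 ?(ltW x0)//; apply/implyP => _; rewrite gt_eqF.
Qed.

Lemma cutoff_ge n : n%:R <= (cutoff n)%:R * (cutoff n)%:R `^ (2 * beta) :> R.
Proof.
rewrite powR_exp ?ltr0n// -[leLHS](powR_invK (ler0n R n)).
by apply: ge0_ler_powR; rewrite ?nnegrE ?powR_ge0 ?ler0n ?(ltW b0)// ltW// truncnS_gt.
Qed.

Lemma cutoff_le n : (0 < n)%N ->
  (cutoff n)%:R * (cutoff n)%:R `^ (2 * beta) <= 2 `^ (1 + 2 * beta) * n%:R :> R.
Proof.
move=> n0; rewrite powR_exp ?ltr0n// -[X in _ <= _ * X](powR_invK (ler0n R n)) -powRM ?powR_ge0//.
apply: ge0_ler_powR; rewrite ?nnegrE ?ler0n ?mulr_ge0 ?powR_ge0 ?(ltW b0)//.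
have na1 : 1 <= n%:R `^ a :> R by rewrite -[leLHS](powRr0 n%:R) ler_powR// ler1n.
have := truncn_le (n%:R `^ a : R); rewrite powR_ge0 /cutoff => h.
by rewrite -natr1; move: h na1; set t := (Num.truncn _)%:R; lra.
Qed.

Lemma cutoff_leq n : (2 <= n)%N -> (cutoff n <= n)%N.
Proof.
move=> n2; have nR : (1 : R) < n%:R by rewrite ltr1n.
rewrite /cutoff truncn_lt_nat ?powR_ge0// ltNge; apply/negP => h.
have n0 : (0 : R) <= n%:R by [].
have : (n%:R : R) `^ (1 + 2 * beta) <= (n%:R `^ a) `^ (1 + 2 * beta).
  by apply: ge0_ler_powR; rewrite ?nnegrE ?powR_ge0 ?(ltW b0).
rewrite powR_invK//; apply/negP; rewrite -ltNge.
apply: (@lt_le_trans _ _ (n%:R `^ 2)).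
  by rewrite powR_mulrn// expr2 ltr_pMr// (lt_trans ltr01).
by apply: ler_powR; [exact: ltW | have := beta2; lra].
Qed.

Lemma cutoff_large (M : nat) : exists N, forall n, (N <= n)%N -> (M <= cutoff n)%N.
Proof.
exists (Num.truncn ((M%:R : R) `^ (1 + 2 * beta))).+1 => n Nn.
rewrite ltnW// ltnS truncn_ge_nat ?powR_ge0//.
have -> : (M%:R : R) = (M%:R `^ (1 + 2 * beta)) `^ a.
  by rewrite -powRrM mul1r mulfV ?gt_eqF// powRr1.
apply: ge0_ler_powR; rewrite ?nnegrE ?powR_ge0//.
by rewrite (le_trans (ltW (truncnS_gt _)))// ler_nat.
Qed.

(** As [m] is at most a power of [n], the product [n m] can only diverge with
    [n]. *)
Lemma local_size_large (n m : nat -> nat) (A : R) :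
  (forall l, (0 < n l)%N /\ (0 < m l)%N) ->
  (n l * m l)%N @[l --> \oo] --> \oo ->
  (forall l, (m l)%:R <= A * (n l)%:R `^ a) ->
  forall N, \forall l \near \oo, (N <= n l)%N.
Proof.
move=> nm0 /cvgnyPge nmoo mA N.
have := nmoo (Num.truncn (`|A| * N%:R ^+ 2)).+1.
apply: filterS => l; rewrite leqNgt => h; rewrite leqNgt; apply: contra h => nN.
rewrite ltnS truncn_ge_nat ?mulr_ge0// natrM.
have [n0 m0] := nm0 l; have nR : (1 : R) <= (n l)%:R by rewrite ler1n.
have nN' : ((n l)%:R : R) <= N%:R by rewrite ler_nat ltnW.
have na : (n l)%:R `^ a <= N%:R :> R.
  apply: le_trans nN'; rewrite -[leRHS](powRr1 (ler0n R _)); apply: ler_powR => //.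
  by rewrite ler_pdivrMr//; have := beta2; lra.
apply: (@le_trans _ _ (N%:R * (`|A| * N%:R))).
  apply: ler_pM => //; apply: (le_trans (mA l)).
  by apply: (le_trans (ler_wpM2r (powR_ge0 _ _) (ler_norm A))); rewrite ler_wpM2l.
by rewrite le_eqVlt; apply/orP; left; apply/eqP; ring.
Qed.

Lemma inv_sqrt_cvg0 (D : nat -> nat) (k : R) :
  (forall M, \forall l \near \oo, (M <= D l)%N) ->
  k / Num.sqrt (D l)%:R @[l --> \oo] --> (0 : R).
Proof.
move=> Doo; apply/cvgrPdist_le => e e0.
have := Doo (Num.truncn ((k / e) ^+ 2)).+1; apply: filterS => l Ml.
have D0 : (0 : R) < (D l)%:R by rewrite ltr0n (leq_trans _ Ml).
have sD : 0 < Num.sqrt (D l)%:R :> R by rewrite sqrtr_gt0.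
rewrite sub0r normrN normrM [X in _ * X]ger0_norm ?invr_ge0 ?(ltW sD)//.
rewrite ler_pdivrMr// -ler_pdivrMl// mulrC -[X in _ / X](gtr0_norm e0) -normf_div -sqrtr_sqr.
rewrite ler_wsqrtr//; apply: (le_trans (ltW (truncnS_gt _))).
by rewrite ler_nat.
Qed.

End Cutoff.

Lemma exists_nat_scale (R : realType) (x y k s : R) : 0 < k -> 0 < s ->
  exists lambda : nat, [/\ (0 < lambda)%N, x <= k * lambda%:R & y <= k * lambda%:R * s].
Proof.
move=> k0 s0; exists (Num.truncn (`|x| / k + `|y| / (k * s))).+1.
have := truncnS_gt (`|x| / k + `|y| / (k * s)); set t := (_.+1%:R) => h.
have ks0 : 0 < k * s by rewrite mulr_gt0.
have x0 : 0 <= `|x| / k by rewrite divr_ge0// ltW.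
have y0 : 0 <= `|y| / (k * s) by rewrite divr_ge0// ltW.
split=> //.
  by rewrite (le_trans (ler_norm x))// [leRHS]mulrC -ler_pdivrMr//; lra.
by rewrite (le_trans (ler_norm y))// mulrAC [leRHS]mulrC -ler_pdivrMr//; lra.
Qed.

Theorem theorem3p1 (R : realType) (beta L sigma : R)
    (K : R -> R -> R) (mu : nat -> R) (psi : nat -> R -> R) (Cpsi C : R) :
  2 <= beta -> 0 < L -> 0 < sigma ->
  stationary K -> positive_definite K ->
  orthonormal_basis psi -> kernel_expansion K mu psi ->
  (forall j (t : R), (0 < j)%N -> t \in `[0, 1] -> `|psi j t| <= Cpsi) ->
  0 < C ->
  (forall j, (0 < j)%N ->
     C^-1 * j%:R `^ (- 1 - 2 * beta) <= mu j <= C * j%:R `^ (- 1 - 2 * beta)) ->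
  exists cbar : R, 0 < cbar /\
  forall cL : R, 0 < cL <= cbar ->
  let f0 := truth psi beta cL in
  Sobolev_ball psi beta L f0 /\
  forall (n m : nat -> nat) (A : R),
  (forall l, (0 < n l)%N /\ (0 < m l)%N) ->
  (n l * m l)%N @[l --> \oo] --> \oo ->
  (ln (n l)%:R) ^+ 2 / (m l)%:R @[l --> \oo] --> (0 : R) ->
  (forall l, (m l)%:R <= A * (n l)%:R `^ (1 / (1 + 2 * beta))) ->
  exists c0 : R, 0 < c0 /\
  forall c : R, 0 < c <= c0 ->
  forall (d : measure_display) (Omega : measurableType d)
    (P : probability Omega R)
    (X eps : forall l, 'I_(m l) -> 'I_(n l) -> {RV P >-> R})
    (d' : measure_display) (T : measurableType d')
    (Q : forall l, ('I_(m l) -> 'I_(n l) -> R) ->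
                   ('I_(m l) -> 'I_(n l) -> R) -> probability T R)
    (f : forall l, ('I_(m l) -> 'I_(n l) -> R) ->
                   ('I_(m l) -> 'I_(n l) -> R) -> 'I_(m l) -> R -> T -> R),
  (forall l, regression_model sigma (X l) (eps l)) ->
  (forall l (x y : 'I_(m l) -> 'I_(n l) -> R), (forall k i, x k i \in `[0, 1]) ->
     naive_draws K sigma x y (Q l x y) (f l x y)) ->
  let Pi l w :=
    aggregated_posterior
      (Q l (design (X l) w) (response (X l) (eps l) f0 w))
      (f l (design (X l) w) (response (X l) (eps l) f0 w)) in
  let fhat l w :=
    aggregated_mean
      (Q l (design (X l) w) (response (X l) (eps l) f0 w))
      (f l (design (X l) w) (response (X l) (eps l) f0 w)) in
  (\forall l \near \oo,
     ((c * rate beta (m l) (n l))%:E <=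
      \int[P]_w sqnormL2 (fun s => fhat l w s - f0 s)%R)%E) /\
  (\int[P]_w Pi l w
      [set g | (sqnormL2 (fun s => g s - f0 s)%R <=
                (c * rate beta (m l) (n l))%:E)%E])%E
    @[l --> \oo] --> 0%E.
Proof.
move=> beta2 L0 sigma0 _ Kpd onb Kexp psiC C0 muC.
have [cbar [cbar0 Sob]] := truth_Sobolev beta2 onb psiC L0.
exists cbar; split => // cL cL_bounds f0; split; first exact: Sob.
have /andP[cL0 _] := cL_bounds.
move=> n m A nm0 nmoo _ mA.
have [C1 C1D] := @sum_inv_ln2_le R.
pose k1 := signal_const beta; have k10 : 0 < k1 by exact: signal_const_gt0.
have s2 : 0 < sigma ^+ 2 by rewrite exprn_gt0.
have [lambda [lambda0 lambda_low lambda_high]] :=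
  exists_nat_scale (144 * (C ^+ 2 * C1)) (288 * (C * l2_const beta)) k10 s2.
exists (rate_const beta lambda cL); split; first exact: rate_const_gt0.
move=> c c_bounds d Omega P X eps d' T Q f model draws Pi fhat.
have /andP[c0 _] := c_bounds.
have n_large := local_size_large beta2 nm0 nmoo mA.
pose D l := cutoff beta (n l).
have D_large M : \forall l \near \oo, (M <= D l)%N.
  have [N hN] := cutoff_large beta2 M.
  by apply: filterS (n_large N) => l; exact: hN.
pose err := error_const beta Cpsi C cL.
have err_cvg := inv_sqrt_cvg0 err D_large.
pose good l := exists2 G : set Omega, measurable G &
  (P (~` G) <= (err / Num.sqrt (D l)%:R)%:E)%E /\
  forall w, G w ->
   (Pi l w [set g | (sqnormL2 (fun s => g s - f0 s)%R <=
                     (c * rate beta (m l) (n l))%:E)%E] <=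
      (err / Num.sqrt (D l)%:R)%:E)%E /\
   ((2 * (c * rate beta (m l) (n l)))%:E <= sqnormL2 (fun s => fhat l w s - f0 s)%R)%E.
have good_near : \forall l \near \oo, good l.
  near=> l; have [n0 m0] := nm0 l.
  have n2 : (2 <= n l)%N by near: l; exact: n_large.
  apply: (single_experiment beta2 sigma0 Kpd onb Kexp psiC C0 muC C1D (lambda := lambda)
    _ lambda_low lambda_high cL0 (D := D l)) => //.
  - by near: l; exact: D_large.
  - by near: l; exact: D_large.
  - exact: cutoff_leq.
  - exact: cutoff_ge.
  - exact: cutoff_le.
  - exact: draws.
have rate0 l : 0 <= c * rate beta (m l) (n l).
  by rewrite mulr_ge0 ?(ltW c0)// mulr_ge0 ?powR_ge0// invr_ge0 sqr_ge0.
have Pi01 l w : (0 <= Pi l w [set g | (sqnormL2 (fun s => g s - f0 s)%R <=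
                     (c * rate beta (m l) (n l))%:E)%E] <= 1)%E.
  have x01 k i : design (X l) w k i \in `[0, 1] by have [+ _ _ _] := model l; exact.
  have [Hf _] := draws l _ (response (X l) (eps l) f0 w) x01.
  rewrite measure_ge0/=.
  exact: (aggregated_posterior_le1 beta2 onb psiC Hf cL0).
split.
  near=> l.
  have [G mG [PG FG]] : good l by near: l.
  have err2 : err / Num.sqrt (D l)%:R <= 1 / 2.
    by near: l; apply: (cvgr_le _ err_cvg).
  have half : ((1 / 2)%:E <= P G)%E.
    move: PG; rewrite probability_setC// -(fineK (fin_num_measure P G mG)) -EFinB !lee_fin.
    by move: err2; set e := err / _; lra.
  apply: (@le_trans _ _ ((2 * (c * rate beta (m l) (n l)))%:E * P G)%E).
    apply: (@le_trans _ _ ((2 * (c * rate beta (m l) (n l)))%:E * (1 / 2)%:E)%E).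
      by rewrite -EFinM lee_fin; lra.
    by apply: lee_wpmul2l => //; rewrite lee_fin mulr_ge0.
  apply: integral_ge_on => //; first by rewrite mulr_ge0.
  - by move=> w; apply: integral_ge0 => s _; rewrite lee_fin sqr_ge0.
  - by move=> w /FG[].
apply: (@squeeze_cvge _ _ _ _ (fun=> 0%E) _
  (fun l => (err / Num.sqrt (D l)%:R + err / Num.sqrt (D l)%:R)%:E)).
- near=> l.
  have [G mG [PG FG]] : good l by near: l.
  apply/andP; split.
    by apply: integral_ge0 => w _; have /andP[] := Pi01 l w.
  rewrite EFinD; apply: le_trans (leeD (lexx _) PG).
  (* Off G the posterior mass is only known to be at most 1. *)
  apply: integral_le_on => //.
  - by rewrite -lee_fin (le_trans _ PG).
  - by move=> w /FG[].
- exact: cvg_cst.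
- by apply: cvg_EFin; [exact: nearW | rewrite -[X in _ --> X]addr0; exact: cvgD].
Unshelve. all: by end_near.
Qed.
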